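(* Let $K(z)=\frac{\bar z}{z^2}$ for $z\in\mathbb{C}\setminus\{0\}$. There exists a $1$-dimensional purely unrectifiable Borel probability measure $\mu$ on $\mathbb{C}$ with the property that $$\|T_{\mu}(1)\|_{L^{\infty}(\mathbb{C}\setminus \operatorname{supp}(\mu))}<\infty .$$
   Context: $B(z,r)$ denotes the closed disc in $\mathbb{C}$ with centre $z$ and radius $r>0$. For a set $E\subset\mathbb{C}$, $\mathcal{H}^1(E)=\sup_{\delta>0}\inf\{\sum_j r_j : E\subset\bigcup_j B(x_j,r_j),\ r_j\le\delta\}$. $\operatorname{supp}(\mu)$ is the closed support of $\mu$. A finite Borel measure $\mu$ on $\mathbb{C}$ is called $1$-dimensional if $\mathcal{H}^1(\operatorname{supp}(\mu))<\infty$ and there is a constant $C>0$ such that $\mu(B(z,r))\le Cr$ for all $z\in\mathbb{C}$ and $r>0$. A measure $\mu$ is purely unrectifiable if $\mathcal{H}^1(\Gamma\cap\operatorname{supp}(\mu))=0$ for every rectifiable curve $\Gamma\subset\mathbb{C}$. For a finite measure $\mu$, $T_\mu(f)(z)=\int_{\mathbb{C}}K(z-\xi)f(\xi)\,d\mu(\xi)$ for $z\notin\operatorname{supp}(\mu)$; in particular $T_\mu(1)(z)=\int_{\mathbb{C}}K(z-\xi)\,d\mu(\xi)$. The $L^\infty$ norm is with respect to planar Lebesgue measure. *)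

(* Defs.v *)
From mathcomp Require Import all_boot all_order all_algebra.
From mathcomp Require Import complex.
From mathcomp Require Import all_classical all_reals all_analysis measurable_realfun.
Import Order.TTheory GRing.Theory Num.Theory numFieldNormedType.Exports.

Set Implicit Arguments.
Unset Strict Implicit.
Unset Printing Implicit Defensive.

Local Open Scope classical_set_scope.
Local Open Scope ring_scope.

(* The complex plane carries its topology and measurable structure as [R * R];
   arithmetic is done in [R[i]], through [toC]. By [measurable_planeE] below, the
   canonical (product) sigma-algebra of [R * R] is the Borel sigma-algebra, so
   that Borel measures on C are exactly measures on this measurable type. *)
Definition toC {R : realType} (z : R * R) : R[i] := Complex z.1 z.2.

(* The modulus as an element of [R]; the generic norm [`|z|] of [R[i]] is
   [R[i]]-valued, and the norm of [R * R] is the sup norm. *)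
Definition cmod {R : realType} (z : R[i]) : R := ComplexField.Normc.normc z.

Definition cdisc {R : realType} (z : R * R) (r : R) : set (R * R) :=
  [set w | cmod (toC w - toC z) <= r].

Lemma open_measurable_plane (R : realType) (U : set (R * R)) :
  open U -> measurable U.
Proof.
move=> oU.
pose Bx (q : (rat * rat) * (rat * rat)) : set (R * R) :=
  `]ratr q.1.1, ratr q.1.2[%classic `*` `]ratr q.2.1, ratr q.2.2[%classic.
have -> : U = \bigcup_(q in [set q | Bx q `<=` U]) Bx q.
  apply/seteqP; split => [[x y] Uxy|z [q qU qz]]; last exact: qU.
  have /(nbhs_ballP _)[e /= e0 eU] : nbhs (x, y) U by exact: open_nbhs_nbhs.
  have xe : x - e < x by rewrite ltrBlDr ltrDl.
  have ex : x < x + e by rewrite ltrDl.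
  have ye : y - e < y by rewrite ltrBlDr ltrDl.
  have ey : y < y + e by rewrite ltrDl.
  have [a] := rat_in_itvoo xe; have [b] := rat_in_itvoo ex.
  have [c] := rat_in_itvoo ye; have [d] := rat_in_itvoo ey.
  rewrite !in_itv/= => /andP[yd dy] /andP[yc cy] /andP[xb bx] /andP[xa ax].
  exists ((a, b), (c, d)).
    move=> -[u v]; rewrite /Bx/= !in_itv/= => -[/andP[au ub] /andP[cv vd]].
    apply: eU; split; rewrite /ball/= ltr_distlC.
      by rewrite (lt_trans xa au) (lt_trans ub bx).
    by rewrite (lt_trans yc cv) (lt_trans vd dy).
  by rewrite /Bx/= !in_itv/= ax xb cy yd.
rewrite bigcup_mkcond; apply: countable_bigcupT_measurable => [|q].
  exact: countableP.
by case: ifPn => // _; apply: measurableX; exact: measurable_itv.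
Qed.

Lemma measurable_planeE (R : realType) :
  (measurable : set (set (R * R))) = <<s (@open (R * R)%type) >>.
Proof.
apply/seteqP; split; last first.
  by apply: smallest_sub; [exact: sigma_algebra_measurable|
                           exact: open_measurable_plane].
pose P := g_sigma_algebraType (@open (R * R)%type).
have mopen (f : P -> R) : continuous (f : R * R -> R) -> measurable_fun setT f.
  move=> cf; apply: (measurability _ (RGenOInfty.measurableE R)).
  move=> _ [_ [a ->] <-]; rewrite setTI; apply: sub_sigma_algebra.
  by move/continuousP : cf; apply; exact: interval_open.
have m1 : measurable_fun setT (fst : P -> R) by apply: mopen => z; exact: cvg_fst.
have m2 : measurable_fun setT (snd : P -> R) by apply: mopen => z; exact: cvg_snd.
have mid : measurable_fun setT (fun z : P => (z.1, z.2)).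
  exact: measurable_fun_pair.
move=> A mA; have := mid measurableT A mA; rewrite setTI.
by congr (<<s _ >> _); apply/seteqP; split => -[].
Qed.

Definition kernelK {R : realType} (z : R[i]) : R[i] := conjc z / z ^+ 2.

Section definitions.
Context {R : realType}.
Implicit Types (mu : {finite_measure set (R * R)%type -> \bar R}).
Implicit Types (E D : set (R * R)).

(* Covers are indexed by subsets of [nat], i.e. are finite or countable. *)
Definition hausdorff_content (delta : R) E : \bar R :=
  ereal_inf [set s | exists (J : set nat) (x : nat -> R * R) (r : nat -> R),
    [/\ forall j, J j -> 0 < r j <= delta,
        E `<=` \bigcup_(j in J) cdisc (x j) (r j) &
        s = (\esum_(j in J) (r j)%:E)%E]].

Definition hausdorff1 E : \bar R :=
  ereal_sup [set hausdorff_content delta E | delta in [set d : R | 0 < d]].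

Definition msupp mu : set (R * R) :=
  [set z | forall U : set (R * R), open U -> U z -> (0 < mu U)%E].

Definition one_dimensional mu : Prop :=
  (hausdorff1 (msupp mu) < +oo)%E /\
  exists2 C : R, 0 < C &
    forall (z : R * R) (r : R), 0 < r -> (mu (cdisc z r) <= (C * r)%:E)%E.

(* Length of the inscribed polygonal line with vertices at the times
   [a :: s]; same encoding of subdivisions as in [variation]. *)
Definition polygon_length (a b : R) (gamma : R -> R * R) (s : seq R) : R :=
  let t := nth b (a :: s) in
  \sum_(0 <= n < size s) cmod (toC (gamma (t n.+1)) - toC (gamma (t n))).

Definition curve_length (a b : R) (gamma : R -> R * R) : \bar R :=
  ereal_sup [set (polygon_length a b gamma s)%:E | s in itv_partition a b].

Definition rectifiable_curve (Gamma : set (R * R)) : Prop :=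
  exists (a b : R) (gamma : R -> R * R),
    [/\ a <= b, {within `[a, b], continuous gamma},
        (curve_length a b gamma < +oo)%E & Gamma = gamma @` `[a, b]].

Definition purely_unrectifiable mu : Prop :=
  forall Gamma : set (R * R), rectifiable_curve Gamma ->
    hausdorff1 (Gamma `&` msupp mu) = 0%E.

(* Only meant for [z] outside [msupp mu], where the integrand is bounded in
   [xi] (for bounded [f]) up to a [mu]-negligible set. *)
Definition Top mu (f : R * R -> R[i]) (z : R * R) : R[i] :=
  let F xi := kernelK (toC z - toC xi) * f xi in
  Complex (\int[mu]_xi complex.Re (F xi)) (\int[mu]_xi complex.Im (F xi)).

(* Extending a function by 0 outside of [D] does not change its essential
   supremum over [D]. *)
Definition Linfty_norm D (f : R * R -> R[i]) : \bar R :=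
  'N[(@lebesgue_measure R \x @lebesgue_measure R)%E]_+oo%E
    [(fun z => (cmod (f z))%:E) \_ D]%E.

End definitions.

(* Main.v *)
(* The field of the uniform measure on a disc, for the kernel conj z / z^2,
   vanishes inside the disc: by homogeneity the field of each circle vanishes
   inside it, and outside a circle of radius rho it is (|z|^2 - 2 rho^2) / z^3,
   which averages to zero over rho <= |z|. Hence a disc of mass and radius r may
   be replaced by m discs of mass and radius r / m, spread so evenly over it that
   the field changes by O(M^(-1/2)) only, where M is the number of concentric
   circles on which the new discs are placed. Iterating with M = M_n such that
   the sum of M_n^(-1/2) converges gives a Cantor measure with bounded transform.
   Its discs of generation n have total radius 1, whence dimension one. The gaps
   between them are much larger than their radii, so a curve of length L meets
   only about L / gap of them, with total radius O(L r / gap), which tends to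
   zero: the measure is purely unrectifiable. All fields are estimated through
   finite sums over roots of unity, which have closed forms. *)

Require Import Defs.
From HB Require Import structures.
From mathcomp Require Import all_boot all_order all_algebra.
From mathcomp Require Import cyclic separable cyclotomic.
From mathcomp Require Import complex.
From mathcomp Require Import all_classical all_reals all_analysis measurable_realfun.
From mathcomp Require Import ring lra zify.
Import Order.TTheory GRing.Theory Num.Theory numFieldNormedType.Exports.

Set Implicit Arguments.
Unset Strict Implicit.
Unset Printing Implicit Defensive.

(** The obstacle is uniformity in the number of generations. At a point z off the support, every
    generation contributes the field of the siblings of the disc nearest to z. This is only O(1) in
    general, which would add up to a bound growing with the depth; it improves to O(1/a), where M =
    a^2, when z lies in the parent disc. A point close to a child does lie in the parent disc, so
    O(1) is paid at most once, at the generation where the descent towards z stops, and the other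
    errors form a geometric series. The exponent -1/2 comes from the centre of the disc: the
    innermost circles have radius about 1/a, and rescaling them to the unit circle costs a factor a.
    The closed forms blow up near the points of a circle, and z may be arbitrarily close to one of
    them. Hence the nearest new disc is always set apart, and the rest of its circle is estimated at
    a point moved radially away from the circle. *)

Local Open Scope ring_scope.

(** * Modulus and kernel *)

Section modulus.
Context {R : realType}.
Implicit Types (x y z w : R[i]).

Lemma cmod_ge0 z : 0 <= cmod z.
Proof. by case: z => a b; rewrite sqrtr_ge0. Qed.

Lemma cmod0 : cmod (0 : R[i]) = 0.
Proof. exact: ComplexField.Normc.normc0. Qed.

Lemma cmod1 : cmod (1 : R[i]) = 1.
Proof. exact: ComplexField.Normc.normc1. Qed.

Lemma cmodM x y : cmod (x * y) = cmod x * cmod y.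
Proof. exact: ComplexField.Normc.normcM. Qed.

Lemma cmodV x : cmod x^-1 = (cmod x)^-1.
Proof. exact: ComplexField.Normc.normcV. Qed.

Lemma cmodX x n : cmod (x ^+ n) = cmod x ^+ n.
Proof. by elim: n => [|n IH]; rewrite ?expr0 ?cmod1 // !exprS cmodM IH. Qed.

Lemma cmod_eq0 z : (cmod z == 0) = (z == 0).
Proof.
apply/eqP/eqP => [/ComplexField.Normc.eq0_normc //|->]; exact: cmod0.
Qed.

Lemma cmod_gt0 z : (0 < cmod z) = (z != 0).
Proof. by rewrite lt_neqAle cmod_ge0 andbT eq_sym cmod_eq0. Qed.

Lemma cmodN z : cmod (- z) = cmod z.
Proof. exact: normcN. Qed.

Lemma cmod_distC x y : cmod (x - y) = cmod (y - x).
Proof. by rewrite -cmodN opprB. Qed.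

Lemma ler_cmodD x y : cmod (x + y) <= cmod x + cmod y.
Proof. exact: le_normcD. Qed.

Lemma ler_cmodB x y : cmod (x - y) <= cmod x + cmod y.
Proof. by rewrite -(cmodN y); exact: ler_cmodD. Qed.

Lemma lerB_cmod x y : cmod x - cmod y <= cmod (x - y).
Proof. by rewrite lerBlDr -{1}(subrK y x); exact: ler_cmodD. Qed.

Lemma ler_dist_cmod x y : `|cmod x - cmod y| <= cmod (x - y).
Proof.
by rewrite ler_norml lerB_cmod andbT lerNl opprB cmod_distC lerB_cmod.
Qed.

Lemma ler_cmod_dist z x y : cmod (x - y) <= cmod (x - z) + cmod (z - y).
Proof. by rewrite -{1}(subrK z x) -addrA; exact: ler_cmodD. Qed.

Lemma ler_cmod_sum (I : Type) (r : seq I) (P : pred I) (F : I -> R[i]) :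
  cmod (\sum_(i <- r | P i) F i) <= \sum_(i <- r | P i) cmod (F i).
Proof.
elim/big_ind2 : _ => //; first by rewrite cmod0.
by move=> x1 x2 y1 y2 h1 h2; apply: (le_trans (ler_cmodD _ _)); exact: lerD.
Qed.

Lemma sqr_cmod z : cmod z ^+ 2 = complex.Re z ^+ 2 + complex.Im z ^+ 2.
Proof. by case: z => a b; rewrite sqr_sqrtr //= addr_ge0 ?sqr_ge0. Qed.

Lemma sqr_cmodC z : (cmod z ^+ 2)%:C%C = z * conjc z.
Proof.
by case: z => a b; rewrite sqr_cmod; apply/eqP; rewrite eq_complex /=; apply/andP; split; apply/eqP; ring.
Qed.

Lemma cmodJ z : cmod (conjc z) = cmod z.
Proof. by case: z => a b; rewrite /cmod /= sqrrN. Qed.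

Lemma cmod_real (a : R) : cmod a%:C%C = `|a|.
Proof. by rewrite /cmod /= expr0n /= addr0 sqrtr_sqr. Qed.

Lemma cmod_nat n : cmod (n%:R : R[i]) = n%:R.
Proof. by rewrite -(rmorph_nat (real_complex R)) cmod_real normr_nat. Qed.

Lemma ler_Re_cmod z : `|complex.Re z| <= cmod z.
Proof.
by case: z => a b; rewrite -sqrtr_sqr ler_sqrt ?lerDl ?sqr_ge0 // addr_ge0 ?sqr_ge0.
Qed.

Lemma ler_Im_cmod z : `|complex.Im z| <= cmod z.
Proof.
by case: z => a b; rewrite -sqrtr_sqr ler_sqrt ?lerDr ?sqr_ge0 // addr_ge0 ?sqr_ge0.
Qed.

Lemma cmod_leD z : cmod z <= `|complex.Re z| + `|complex.Im z|.
Proof.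
rewrite -(@ler_pXn2r _ 2) ?nnegrE ?cmod_ge0 ?addr_ge0 //.
rewrite sqr_cmod sqrrD !real_normK ?num_real // addrAC lerDl.
by rewrite mulrn_wge0 // mulr_ge0.
Qed.

Lemma ReD x y : complex.Re (x + y) = complex.Re x + complex.Re y.
Proof. by case: x; case: y. Qed.

Lemma ReN x : complex.Re (- x) = - complex.Re x.
Proof. by case: x. Qed.

Lemma Re_sum (I : Type) (r : seq I) (P : pred I) (F : I -> R[i]) :
  complex.Re (\sum_(i <- r | P i) F i) = \sum_(i <- r | P i) complex.Re (F i).
Proof. by elim/big_ind2 : _ => // x1 x2 y1 y2 <- <-; rewrite ReD. Qed.

Lemma conjcB x y : conjc (x - y) = conjc x - conjc y.
Proof. exact: rmorphB. Qed.

Lemma conjcM x y : conjc (x * y) = conjc x * conjc y.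
Proof. exact: rmorphM. Qed.

Lemma conjc_realE (a : R) : conjc a%:C%C = a%:C%C.
Proof. by rewrite conjc_real. Qed.

Lemma cmod_kernelK z : cmod (kernelK z) = (cmod z)^-1.
Proof.
have [->|z0] := eqVneq z 0.
  by rewrite /kernelK conjc0 mul0r cmod0 invr0.
have : cmod z != 0 by rewrite cmod_eq0.
by move=> c0; rewrite /kernelK cmodM cmodJ cmodV cmodX; field.
Qed.

Lemma kernelK_scale (a : R) z : kernelK (a%:C%C * z) = (a^-1)%:C%C * kernelK z.
Proof.
have [->|a0] := eqVneq a 0.
  by rewrite invr0 !mul0r /kernelK conjc0 mul0r.
rewrite /kernelK conjcM conjc_realE fmorphV /=.
have A0 : a%:C%C != 0 :> R[i] by rewrite (fmorph_eq0 (real_complex R)).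
have [->|z0] := eqVneq z 0; first by rewrite conjc0 !mul0r !mulr0 mul0r.
by move: (a%:C%C) A0 => A A0; field; rewrite A0 z0.
Qed.

(** Moving the argument costs only inverse squares of distances, and the sum of these over a circle
    is a Poisson kernel with a closed form. All comparisons between nearby points or nearby masses
    rest on this. *)
Lemma kernelK_lipschitz x y : x != 0 -> y != 0 ->
  cmod (kernelK x - kernelK y) <=
  cmod (x - y) * (2 / cmod x ^+ 2 + (cmod x * cmod y)^-1).
Proof.
move=> x0 y0.
have cx0 : cmod x != 0 by rewrite cmod_eq0.
have cy0 : cmod y != 0 by rewrite cmod_eq0.
have -> : kernelK x - kernelK y = conjc (x - y) / x ^+ 2
    - conjc y * ((x - y) * (x + y) / (x ^+ 2 * y ^+ 2)).
  by rewrite /kernelK conjcB; field; rewrite x0 y0.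
apply: (le_trans (ler_cmodB _ _)).
rewrite !cmodM !cmodV !cmodM !cmodJ -!expr2.
have -> : cmod (x - y) * (2 / cmod x ^+ 2 + (cmod x * cmod y)^-1) =
   cmod (x - y) / cmod x ^+ 2 +
   cmod y * (cmod (x - y) * (cmod x + cmod y) / (cmod x ^+ 2 * cmod y ^+ 2)).
  by field; rewrite cx0 cy0.
rewrite lerD2l; apply: ler_wpM2l; first exact: cmod_ge0.
apply: ler_wpM2r; first by rewrite invr_ge0 mulr_ge0 // exprn_ge0 // cmod_ge0.
by apply: ler_wpM2l; [exact: cmod_ge0|exact: ler_cmodD].
Qed.

End modulus.

(** * Kernel sums over roots of unity *)

Section log_derivative.
Context {F : fieldType} (I : Type).
Implicit Types (r : seq I) (x : I -> F) (w : F).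

Lemma deriv_prod_XsubC r x w : (forall i, w != x i) ->
  (\prod_(i <- r) ('X - (x i)%:P))^`().[w] =
  (\prod_(i <- r) ('X - (x i)%:P)).[w] * \sum_(i <- r) (w - x i)^-1.
Proof.
move=> wx; elim: r => [|i r IH]; first by rewrite !big_nil derivC horner0 mulr0.
rewrite !big_cons derivM derivXsubC mul1r hornerD !hornerM IH !hornerXsubC.
by have := wx i; rewrite -subr_eq0 => h; field.
Qed.

(** P''/P is the square of P'/P plus the derivative of P'/P. For P = X^q - 1 both quotients are
    explicit, which yields the sum of inverse squares. *)
Lemma deriv2_prod_XsubC r x w : (forall i, w != x i) ->
  (\prod_(i <- r) ('X - (x i)%:P))^`()^`().[w] =
  (\prod_(i <- r) ('X - (x i)%:P)).[w] *
    ((\sum_(i <- r) (w - x i)^-1) ^+ 2 - \sum_(i <- r) (w - x i)^-2).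
Proof.
move=> wx; elim: r => [|i r IH].
  by rewrite !big_nil derivC deriv0 horner0 expr0n /= subr0 mulr0.
rewrite !big_cons derivM derivXsubC mul1r derivD derivM derivXsubC mul1r.
rewrite !(hornerXsubC, hornerD, hornerM) IH !deriv_prod_XsubC //.
by have := wx i; rewrite -subr_eq0 => h; field.
Qed.
End log_derivative.

Section roots_of_unity.
Context {R : realType}.
Implicit Types (w : R[i]).

Lemma prim_root_exists n : (0 < n)%N -> {z : R[i] | n.-primitive_root z}.
Proof.
pose p : {poly R[i]} := 'X^n - 1; have [r Dp] := closed_field_poly_normal p.
move=> n_gt0; apply/sigW; rewrite (monicP _) ?monicXnsubC // scale1r in Dp.
have rn1 : all n.-unity_root r by apply/allP=> z; rewrite -root_prod_XsubC -Dp.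
have sz_r : (n < (size r).+1)%N.
  by rewrite -(size_prod_XsubC r id) -Dp size_XnsubC.
have [|z] := hasP (has_prim_root n_gt0 rn1 _ sz_r); last by exists z.
by rewrite -separable_prod_XsubC -Dp separable_Xn_sub_1 // pnatr_eq0 -lt0n.
Qed.

Context (q : nat) (om : R[i]).
Context (q4 : (4 <= q)%N) (om_prim : q.-primitive_root om).

Let q0 : (0 < q)%N. Proof. exact: leq_trans q4. Qed.

Lemma prim_root_expr i : (om ^+ i) ^+ q = 1.
Proof. by rewrite exprAC (prim_expr_order om_prim) expr1n. Qed.

Lemma cmod_prim_root i : cmod (om ^+ i) = 1.
Proof.
apply/eqP; rewrite -(@pexpr_eq1 _ _ q) ?cmod_ge0 //.
by rewrite -cmodX prim_root_expr cmod1.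
Qed.

Lemma prim_root_neq0 i : om ^+ i != 0.
Proof. by rewrite -cmod_eq0 cmod_prim_root oner_eq0. Qed.

Lemma conj_prim_root i : conjc (om ^+ i) = (om ^+ i)^-1.
Proof.
apply: (mulfI (prim_root_neq0 i)); rewrite -sqr_cmodC cmod_prim_root expr1n.
by rewrite divff // prim_root_neq0.
Qed.

Lemma prim_root_neq w i : w ^+ q != 1 -> w != om ^+ i.
Proof. by apply: contra => /eqP ->; rewrite prim_root_expr. Qed.

Lemma prod_prim_root : \prod_(i < q) ('X - (om ^+ i)%:P) = 'X^q - 1.
Proof. by rewrite -(factor_Xn_sub_1 om_prim) big_mkord. Qed.

Lemma sum_inv_prim_root w : w ^+ q != 1 ->
  \sum_(i < q) (w - om ^+ i)^-1 = q%:R * w ^+ q.-1 / (w ^+ q - 1).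
Proof.
move=> wq; have wx (i : 'I_q) : w != om ^+ i by exact: prim_root_neq.
have := deriv_prod_XsubC (index_enum _) wx; rewrite prod_prim_root.
rewrite derivB derivXn derivC subr0 !hornerE hornerMn !hornerE => h.
move: wq; rewrite -subr_eq0 => wq; apply: (mulfI wq); rewrite -h.
by rewrite mulrCA divff // mulr1 mulr_natl.
Qed.

Lemma sum_inv2_prim_root w : w ^+ q != 1 ->
  \sum_(i < q) (w - om ^+ i)^-2 = (q%:R * w ^+ q.-1 / (w ^+ q - 1)) ^+ 2
    - q%:R * q.-1%:R * w ^+ q.-2 / (w ^+ q - 1).
Proof.
move=> wq; have wx (i : 'I_q) : w != om ^+ i by exact: prim_root_neq.
have := deriv2_prod_XsubC (index_enum _) wx; rewrite prod_prim_root.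
rewrite (sum_inv_prim_root wq).
rewrite derivB derivXn derivC subr0 derivMn derivXn !(hornerE, hornerMn) => h.
move: wq h; rewrite -subr_eq0; set Q := \sum_(i < q) _; set A := _ / _ => wq h.
have -> : Q = A ^+ 2 - (w ^+ q - 1)^-1 * ((w ^+ q - 1) * (A ^+ 2 - Q)).
  by rewrite mulKf // opprB addrC subrK.
by rewrite -h -[in LHS]mulr_natr -[in LHS]mulr_natr; congr (_ - _); ring.
Qed.

(** The closed form above at w = 0, where w^(q-1) vanishes. *)
Lemma sum_prim_rootV : \sum_(i < q) (om ^+ i)^-1 = 0.
Proof.
have /sum_inv_prim_root : (0 : R[i]) ^+ q != 1.
  by rewrite expr0n gtn_eqF //= eq_sym oner_eq0.
rewrite expr0n -subn1 subn_eq0 leqNgt (leq_trans _ q4) //= mulr0 mul0r => h.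
apply: oppr_inj; rewrite oppr0 -[RHS]h -sumrN.
by apply: eq_bigr => i _; rewrite sub0r invrN.
Qed.

(** A geometric series of ratio om^-3, which is not 1 because q >= 4 cannot divide 3. *)
Lemma sum_prim_rootV3 : \sum_(i < q) (om ^+ i) ^- 3 = 0.
Proof.
have om0 : om != 0 by have := prim_root_neq0 1; rewrite expr1.
set y := om ^- 3.
have -> : \sum_(i < q) om ^+ i ^- 3 = \sum_(i < q) y ^+ i.
  by apply: eq_bigr => i _; rewrite /y exprVn exprAC.
have y1 : y - 1 != 0.
  rewrite subr_eq0 /y -[1]invr1 (inj_eq invr_inj) -(prim_order_dvd om_prim).
  by apply/negP => /dvdn_leq => /(_ isT); rewrite leqNgt q4.
apply: (mulfI y1); rewrite mulr0 -subrX1 /y exprVn exprAC.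
by rewrite (prim_expr_order om_prim) expr1n invr1 subrr.
Qed.

(* This is where the cubic homogeneity of the kernel cancels: the field of a
   circle vanishes at its centre. *)
Lemma sum_kernelK0 : \sum_(i < q) kernelK (0 - om ^+ i) = 0.
Proof.
transitivity (- \sum_(i < q) (om ^+ i) ^- 3); last first.
  by rewrite sum_prim_rootV3 oppr0.
rewrite -sumrN; apply: eq_bigr => i _.
rewrite /kernelK sub0r rmorphN /= conj_prim_root sqrrN mulNr -invfM.
by rewrite -exprS.
Qed.

(* With [u = w ^+ q], the field of the uniform measure on the unit circle is
   recovered in the limits [u -> 0] (it is [0] inside) and [u -> oo]
   (it is [(`|w| ^+ 2 - 2) / w ^+ 3] outside). *)
Lemma sum_kernelK w : w != 0 -> w ^+ q != 1 ->
  \sum_(i < q) kernelK (w - om ^+ i) = q%:R / w ^+ 3 *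
   (((cmod w ^+ 2)%:C%C - 2) * (w ^+ q / (w ^+ q - 1)) +
    ((cmod w ^+ 2)%:C%C - 1) * q%:R * (w ^+ q / (w ^+ q - 1) ^+ 2)).
Proof.
move=> w0 wq.
pose P := \sum_(i < q) (w - om ^+ i)^-1.
pose Q := \sum_(i < q) (w - om ^+ i)^-2.
have -> : \sum_(i < q) kernelK (w - om ^+ i) = (conjc w - w^-1) * Q - w ^- 2 * P.
  (* On the unit circle conj x = 1/x, so each summand is a rational function of x; this is its
     partial fraction expansion. *)
  transitivity (\sum_(i < q) ((conjc w - w^-1) * (w - om ^+ i)^-2
      - w ^- 2 * (w - om ^+ i)^-1 - w ^- 2 * (om ^+ i)^-1)).
    apply: eq_bigr => i _; have x0 := prim_root_neq0 i.
    have wx : w - om ^+ i != 0 by rewrite subr_eq0 prim_root_neq.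
    rewrite /kernelK conjcB conj_prim_root.
    by move: (om ^+ i) x0 wx => x x0 wx; field; rewrite x0 w0.
  by rewrite !sumrB -!mulr_sumr sum_prim_rootV mulr0 subr0.
rewrite /P /Q sum_inv_prim_root // sum_inv2_prim_root // sqr_cmodC.
have [n qE] : exists n, q = n.+2 by exists q.-2; move: q4; lia.
rewrite qE /=; move: wq; rewrite qE -subr_eq0 !exprS -natr1.
move: (n.+1%:R : R[i]) (w ^+ n) (conjc w) => N v wb wq.
by field; rewrite w0 wq.
Qed.
End roots_of_unity.

(** * Elementary bounds for real powers *)

Section real_powers.
Context {R : realFieldType}.
Implicit Types (x t : R).

Lemma bernoulli_ge t n : 1 <= t -> 1 + n%:R * (t - 1) <= t ^+ n.
Proof.
move=> t1; elim: n => [|n IH]; first by rewrite mul0r addr0 expr0.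
rewrite exprS; apply: (@le_trans _ _ (t * (1 + n%:R * (t - 1)))).
  rewrite -natr1; have : 0 <= n%:R * (t - 1) ^+ 2 by rewrite mulr_ge0 ?sqr_ge0.
  by move: (n%:R : R) => N; nra.
by rewrite ler_wpM2l // (le_trans ler01).
Qed.

(** Each of the n terms of (1 - t^n) / (1 - t) is at least t^(n-1). Inside a circle this absorbs the
    surplus factor q of the field. *)
Lemma subr1_expr_ge t n : 0 <= t <= 1 ->
  n%:R * ((1 - t) * t ^+ n.-1) <= 1 - t ^+ n.
Proof.
case: n => [|n] /andP[t0 t1]; first by rewrite mul0r expr0 subrr.
have -> : 1 - t ^+ n.+1 = (1 - t) * \sum_(i < n.+1) t ^+ i.
  by rewrite -opprB subrX1 -mulNr opprB.
rewrite mulrCA ler_wpM2l ?subr_ge0 //= mulr_natl -[in leLHS](card_ord n.+1) -sumr_const.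
by apply: ler_sum => i _; rewrite ler_wiXn2l // -ltnS.
Qed.

(** A relative distance 1/n from the unit circle already keeps w^n away from 1 by a fixed amount. *)
Lemma exprn_ge2 n : (0 < n)%N -> 2 <= (1 + n%:R^-1) ^+ n :> R.
Proof.
move=> n0; have h : 1 <= 1 + n%:R^-1 :> R by rewrite lerDl invr_ge0.
apply: (le_trans _ (bernoulli_ge n h)).
by rewrite [1 + _^-1]addrC addrK divff // pnatr_eq0 -lt0n.
Qed.

(** Multiplied by (1 + 1/n)^n >= 2, the power becomes (1 - n^-2)^n <= 1. *)
Lemma exprn_le_half n : (0 < n)%N -> (1 - n%:R^-1) ^+ n <= 2^-1 :> R.
Proof.
move=> n0; have n1 : n%:R^-1 <= 1 :> R by rewrite invf_le1 ?ler1n ?ltr0n.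
have h2 := exprn_ge2 n0; set b := 1 + _ in h2.
have b0 : 0 < b ^+ n by apply: lt_le_trans h2.
rewrite -[leRHS]mul1r ler_pdivlMr //; apply: (@le_trans _ _ ((1 - n%:R^-1) ^+ n * b ^+ n)).
  by rewrite ler_wpM2l // exprn_ge0 // subr_ge0.
rewrite -exprMn exprn_ile1 //.
  by rewrite mulr_ge0 ?subr_ge0 // addr_ge0.
by rewrite /b; have : 0 <= n%:R^-1 :> R by []; nra.
Qed.
End real_powers.

(** * Separation and inverse-square sums on the unit circle *)

Section ring_estimates.
Context {R : realType}.
Implicit Types (w x z : R[i]).

Lemma Re_cayley w x : complex.Re ((w + x) / (w - x)) =
  (cmod w ^+ 2 - cmod x ^+ 2) / cmod (w - x) ^+ 2.
Proof.
have ReV z y : complex.Re (z / y) = complex.Re (z * conjc y) / cmod y ^+ 2.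
  rewrite sqr_cmod; case: z => a b; case: y => c d /=.
  by rewrite mulrDl !mulrA; ring.
rewrite ReV; congr (_ / _).
by rewrite !sqr_cmod; case: w => a b; case: x => c d /=; ring.
Qed.

Context (q : nat) (om : R[i]).
Context (q4 : (4 <= q)%N) (om_prim : q.-primitive_root om).

Let q0 : (0 < q)%N. Proof. exact: leq_trans q4. Qed.
Let qR0 : 0 < q%:R :> R. Proof. by rewrite ltr0n. Qed.

(** No trigonometry is involved: the powers of y = om^j / om^i sum to 0, whereas for y within 1/(2q)
    of 1 all of them would be within 1/2 of 1 and their sum would have modulus at least q/2. *)
Lemma prim_root_sep (i j : 'I_q) : i != j ->
  (2 * q%:R)^-1 <= cmod (om ^+ i - om ^+ j).
Proof.
move=> ij; rewrite leNgt; apply/negP => lt_d.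
pose y := om ^+ j / om ^+ i.
have i0 := prim_root_neq0 q4 om_prim i.
have cy : cmod y = 1.
  by rewrite cmodM cmodV !(cmod_prim_root q4 om_prim) invr1 mulr1.
have y1 : y - 1 != 0.
  rewrite subr_eq0 /y; apply: contra ij => /eqP h.
  rewrite eq_sym -val_eqE /= -[val i](modn_small (ltn_ord i)).
  rewrite -[val j](modn_small (ltn_ord j)) -(eq_prim_root_expr om_prim).
  by rewrite -[om ^+ j](mulfVK i0) h mul1r.
have sum0 : \sum_(k < q) y ^+ k = 0.
  apply: (mulfI y1); rewrite -subrX1 mulr0 /y exprMn exprVn.
  by rewrite !(prim_root_expr om_prim) invr1 mulr1 subrr.
have dE : cmod (y - 1) = cmod (om ^+ i - om ^+ j).
  rewrite -[LHS]mul1r -(cmod_prim_root q4 om_prim i) -cmodM mulrBr mulr1.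
  by rewrite mulrC mulfVK // cmod_distC.
have d_le (k : 'I_q) : cmod (1 - y ^+ k) <= 2^-1.
  rewrite cmod_distC subrX1 cmodM dE; apply: (@le_trans _ _ ((2 * q%:R)^-1 * q%:R)).
    apply: ler_pM; rewrite ?cmod_ge0 //; first exact: ltW.
    apply: (le_trans (ler_cmod_sum _ _ _)).
    rewrite (eq_bigr (fun=> 1)) => [|l _]; last by rewrite cmodX cy expr1n.
    by rewrite sumr_const card_ord ler_nat ltnW.
  by rewrite invfM mulrVK // unitfE pnatr_eq0 -lt0n.
suff : q%:R <= q%:R * 2^-1 :> R by have := qR0; lra.
rewrite -[leLHS]cmod_nat -[(q%:R : R[i])]subr0 -sum0.
have -> : (q%:R : R[i]) = \sum_(k < q) 1 by rewrite sumr_const card_ord.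
rewrite -sumrB; apply: (le_trans (ler_cmod_sum _ _ _)).
apply: (le_trans (ler_sum _ (fun k _ => d_le k))).
by rewrite sumr_const card_ord mulr_natl.
Qed.

(* Poisson kernel: the summand is [Re ((w + x) / (w - x))] up to the factor
   [cmod w ^+ 2 - 1]. *)
Lemma sum_inv_sqr w : cmod w != 1 -> w ^+ q != 1 ->
  \sum_(i < q) (cmod (w - om ^+ i) ^+ 2)^-1 =
  q%:R * ((cmod (w ^+ q) ^+ 2 - 1) / cmod (w ^+ q - 1) ^+ 2) / (cmod w ^+ 2 - 1).
Proof.
move=> w1 wq.
have d0 : cmod w ^+ 2 - 1 != 0 by rewrite subr_eq0 (@pexpr_eq1 _ _ 2) // cmod_ge0.
apply: (mulIf d0); rewrite mulfVK // mulr_suml.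
transitivity (complex.Re (\sum_(i < q) ((w + om ^+ i) / (w - om ^+ i)))).
  rewrite Re_sum; apply: eq_bigr => i _.
  by rewrite Re_cayley (cmod_prim_root q4 om_prim) expr1n mulrC.
have -> : \sum_(i < q) ((w + om ^+ i) / (w - om ^+ i)) =
    \sum_(i < q) (2 * w * (w - om ^+ i)^-1 - 1).
  apply: eq_bigr => i _; have := prim_root_neq om_prim i wq; rewrite -subr_eq0 => h.
  by field.
rewrite sumrB -mulr_sumr (sum_inv_prim_root om_prim) // sumr_const card_ord.
have := Re_cayley (w ^+ q) 1; rewrite cmod1 expr1n => <-.
have -> : 2 * w * (q%:R * w ^+ q.-1 / (w ^+ q - 1)) - 1 *+ q =
   (q%:R : R)%:C%C * ((w ^+ q + 1) / (w ^+ q - 1)).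
  rewrite (rmorph_nat (real_complex R)); move: wq; rewrite -subr_eq0.
  by rewrite -(prednK q0) exprS /=; move: (w ^+ q.-1) => v wq; field.
by case: (_ / _) => a b /=; rewrite mul0r subr0.
Qed.

End ring_estimates.

(** * Field of a single circle of points *)

Section ring_kernel.
Context {R : realType}.
Implicit Types (w x z : R[i]).
Context (q : nat) (om : R[i]).
Context (q4 : (4 <= q)%N) (om_prim : q.-primitive_root om).

Let q0 : (0 < q)%N. Proof. exact: leq_trans q4. Qed.
Let qR0 : 0 < q%:R :> R. Proof. by rewrite ltr0n. Qed.
Let qR4 : 4 <= q%:R :> R. Proof. by rewrite (ler_nat _ 4). Qed.

Notation ringsum w := (\sum_(i < q) kernelK (w - om ^+ i)).

Let cmod_sub2 (T : R) : cmod (T%:C%C - 2) = `|T - 2|.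
Proof. by rewrite -(rmorph_nat (real_complex R)) -rmorphB cmod_real. Qed.

Let cmod_sub1 (T : R) : cmod (T%:C%C - 1) = `|T - 1|.
Proof. by rewrite -(rmorph1 (real_complex R)) -rmorphB cmod_real. Qed.

(** Suited to the outside, where u = w^q is large: writing u / (u - 1) as 1 + 1 / (u - 1), the 1
    produces the field of the uniform circle and the rest is an error. *)
Lemma ring_kernel_approx w : w != 0 -> w ^+ q != 1 ->
  cmod (ringsum w - (q%:R * (cmod w ^+ 2 - 2))%:C%C / w ^+ 3) <=
  q%:R / cmod w ^+ 3 * (`|cmod w ^+ 2 - 2| / cmod (w ^+ q - 1)
    + `|cmod w ^+ 2 - 1| * q%:R * (cmod w ^+ q / cmod (w ^+ q - 1) ^+ 2)).
Proof.
move=> w0 wq; rewrite (sum_kernelK q4 om_prim) //.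
have -> : (q%:R * (cmod w ^+ 2 - 2))%:C%C = q%:R * ((cmod w ^+ 2)%:C%C - 2) :> R[i].
  rewrite (rmorphM (real_complex R)) (rmorphB (real_complex R)).
  by rewrite !(rmorph_nat (real_complex R)).
set A := _%:C%C - 2; set B := _%:C%C - 1.
set X := (X in cmod X).
have -> : X = q%:R / w ^+ 3 *
    (A / (w ^+ q - 1) + B * q%:R * (w ^+ q / (w ^+ q - 1) ^+ 2)).
  rewrite {}/X; move: wq w0; rewrite -subr_eq0; move: (w ^+ q) => v v1 w0.
  by field; rewrite w0 v1.
rewrite cmodM cmodM cmodV cmodX cmod_nat ler_wpM2l ?divr_ge0 ?exprn_ge0 ?cmod_ge0 //.
apply: (le_trans (ler_cmodD _ _)).
by rewrite !cmodM !cmodV !cmodX cmod_nat cmod_sub2 cmod_sub1.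
Qed.

Lemma ring_kernel_le w : w != 0 -> w ^+ q != 1 ->
  cmod (ringsum w) <=
  q%:R / cmod w ^+ 3 * (`|cmod w ^+ 2 - 2| * (cmod w ^+ q / cmod (w ^+ q - 1))
    + `|cmod w ^+ 2 - 1| * q%:R * (cmod w ^+ q / cmod (w ^+ q - 1) ^+ 2)).
Proof.
move=> w0 wq; rewrite (sum_kernelK q4 om_prim) //.
rewrite cmodM cmodM cmodV cmodX cmod_nat ler_wpM2l ?divr_ge0 ?exprn_ge0 ?cmod_ge0 //.
apply: (le_trans (ler_cmodD _ _)).
by rewrite !cmodM !cmodV !cmodX cmod_nat cmod_sub2 cmod_sub1.
Qed.

Let cmod_gt1 w : 1 < cmod w -> w != 0.
Proof. by move=> h; rewrite -cmod_gt0 (lt_trans _ h). Qed.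

Let expr_neq1 w : cmod w ^+ q != 1 -> w ^+ q != 1.
Proof. by rewrite -cmodX; apply: contra => /eqP ->; rewrite cmod1. Qed.

Let outer_dist w : cmod w ^+ q - 1 <= cmod (w ^+ q - 1).
Proof. by rewrite -[in leLHS]cmodX -[X in _ - X]cmod1 lerB_cmod. Qed.

Let inner_dist w : 1 - cmod w ^+ q <= cmod (w ^+ q - 1).
Proof. by rewrite -[in leLHS]cmodX -[X in X - _]cmod1 cmod_distC lerB_cmod. Qed.

(** With s = |w|^q, the quotient (s^2 - 1) / (s - 1)^2 = (s + 1) / (s - 1) is at most 3 for s >= 2.
    Inside the circle the same 3 bounds (1 + s) / (1 - s) for s <= 1/2. *)
Lemma sum_inv_sqr_outer w : 1 < cmod w -> 2 <= cmod w ^+ q ->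
  \sum_(i < q) (cmod (w - om ^+ i) ^+ 2)^-1 <= 3 * q%:R / (cmod w ^+ 2 - 1).
Proof.
move=> w1 s2; rewrite (sum_inv_sqr q4 om_prim); last 2 first.
- by rewrite gt_eqF.
- by apply: expr_neq1; rewrite gt_eqF // (lt_le_trans _ s2) // ltr1n.
have d0 : 0 < cmod w ^+ 2 - 1 by rewrite subr_gt0 exprn_egt1.
apply: ler_wpM2r; first by rewrite invr_ge0 ltW.
rewrite mulrC; apply: ler_wpM2r => //; rewrite cmodX.
have := outer_dist w; move: (cmod w ^+ q) s2 (cmod (w ^+ q - 1)) => s s2 D sD.
have D0 : 0 < D by lra.
by rewrite ler_pdivrMr ?exprn_gt0 //; nra.
Qed.

Lemma sum_inv_sqr_inner w : cmod w < 1 -> cmod w ^+ q <= 2^-1 ->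
  \sum_(i < q) (cmod (w - om ^+ i) ^+ 2)^-1 <= 3 * q%:R / (1 - cmod w ^+ 2).
Proof.
move=> w1 s2; rewrite (sum_inv_sqr q4 om_prim); last 2 first.
- by rewrite lt_eqF.
- by apply: expr_neq1; rewrite lt_eqF // (le_lt_trans s2) // invf_lt1 ?ltr1n.
have d0 : 0 < 1 - cmod w ^+ 2 by rewrite subr_gt0 exprn_ilt1 // cmod_ge0.
rewrite -[cmod w ^+ 2 - 1]opprB -[_ ^+ 2 - 1]opprB invrN !(mulNr, mulrN) opprK.
apply: ler_wpM2r; first by rewrite invr_ge0 ltW.
rewrite mulrC; apply: ler_wpM2r => //; rewrite cmodX.
have := inner_dist w; have : 0 <= cmod w ^+ q by rewrite exprn_ge0 ?cmod_ge0.
move: (cmod w ^+ q) s2 (cmod (w ^+ q - 1)) => s s2 D s0 sD.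
have D0 : 0 < D by lra.
by rewrite ler_pdivrMr ?exprn_gt0 //; nra.
Qed.

Lemma ring_kernel_outer w : 1 < cmod w -> 2 <= cmod w ^+ q ->
  cmod (ringsum w - (q%:R * (cmod w ^+ 2 - 2))%:C%C / w ^+ 3) <=
  q%:R * (6 * q%:R / cmod w ^+ q).
Proof.
move=> w1 s2; apply: (le_trans (ring_kernel_approx _ _)).
- exact: cmod_gt1.
- by apply: expr_neq1; rewrite gt_eqF // (lt_le_trans _ s2) // ltr1n.
rewrite -[leLHS]mulrA ler_wpM2l //.
have := outer_dist w; move: (cmod w ^+ q) s2 => s s2.
move: (cmod (w ^+ q - 1)) => D sD; move: (cmod w) w1 => t t1.
have D0 : 0 < D by lra.
have s0 : 0 < s by lra.
have DV : D^-1 <= 2 / s.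
  by rewrite -[D^-1]mul1r ler_pdivlMr // mulrAC ler_pdivrMr //; lra.
have DV2 : s / D ^+ 2 <= 4 / s.
  by rewrite ler_pdivlMr // mulrAC ler_pdivrMr ?exprn_gt0 //; nra.
rewrite mulrC ler_pdivrMr ?exprn_gt0 //; last by lra.
have T2 : `|t ^+ 2 - 2| <= t ^+ 2 by rewrite ler_norml; apply/andP; split; nra.
have T1 : `|t ^+ 2 - 1| <= t ^+ 2 by rewrite ler_norml; apply/andP; split; nra.
apply: (@le_trans _ _ (t ^+ 2 * (2 / s) + t ^+ 2 * q%:R * (4 / s))).
  apply: lerD; apply: ler_pM => //; rewrite ?invr_ge0 ?mulr_ge0 ?invr_ge0 ?exprn_ge0 //; try lra.
  by rewrite ler_wpM2r.
have -> : t ^+ 2 * (2 / s) + t ^+ 2 * q%:R * (4 / s) =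
    (t ^+ 2 * (2 + 4 * q%:R)) / s by rewrite mulrDl; ring.
have -> : 6 * q%:R / s * t ^+ 3 = (t ^+ 2 * (6 * q%:R * t)) / s by ring.
rewrite ler_wpM2r ?invr_ge0 ?ler_wpM2l ?sqr_ge0 //; first lra.
by have := qR4; nra.
Qed.

Let inner_expr (t : R) : 0 < t -> t ^+ q = t ^+ 3 * t ^+ (q - 3).
Proof. by move=> t0; rewrite -exprD subnKC // ltnW. Qed.

(** The factor w^-3 of the closed form is paid for by w^q, hence the exponent q - 3. At w = 0 the
    closed form is meaningless and the cancellation [sum_kernelK0] replaces it. *)
Lemma ring_kernel_inner w : cmod w < 1 -> cmod w ^+ q <= 2^-1 ->
  cmod (ringsum w) <= q%:R * (8 * q%:R * cmod w ^+ (q - 3)).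
Proof.
have [->|w0] := eqVneq w 0.
  move=> _ _; rewrite (sum_kernelK0 q4 om_prim) cmod0.
  by rewrite !mulr_ge0 ?exprn_ge0.
move=> w1 s2; apply: (le_trans (ring_kernel_le w0 _)).
  by apply: expr_neq1; rewrite lt_eqF // (le_lt_trans s2) // invf_lt1 ?ltr1n.
rewrite -[leLHS]mulrA ler_wpM2l //.
have t0 : 0 < cmod w by rewrite cmod_gt0.
have := inner_dist w; have s0 : 0 <= cmod w ^+ q by rewrite exprn_ge0 ?cmod_ge0.
move: s2 s0; rewrite (inner_expr t0).
move: (cmod (w ^+ q - 1)) => D; move: (cmod w) w1 t0 => t t1 t0.
have t30 : 0 < t ^+ 3 by rewrite exprn_gt0.
move: (t ^+ 3) t30 => t3 t30.
have p0 : 0 <= t ^+ (q - 3) by rewrite exprn_ge0 // ltW.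
move: (t ^+ (q - 3)) p0 => p p0 s2 s0 sD.
have D0 : 0 < D by lra.
rewrite mulrC ler_pdivrMr //.
have DV : t3 * p / D <= 2 * (t3 * p) by rewrite ler_pdivrMr //; nra.
have DV2 : t3 * p / D ^+ 2 <= 4 * (t3 * p) 
  by rewrite ler_pdivrMr ?exprn_gt0 // mulrAC ler_peMl //; nra.
have T2 : `|t ^+ 2 - 2| <= 2 by rewrite ler_norml; apply/andP; split; nra.
have T1 : `|t ^+ 2 - 1| <= 1 by rewrite ler_norml; apply/andP; split; nra.
apply: (@le_trans _ _ (2 * (2 * (t3 * p)) + 1 * q%:R * (4 * (t3 * p)))).
  have DV0 : 0 <= t3 * p / D by rewrite divr_ge0 // ltW.
  have DV20 : 0 <= t3 * p / D ^+ 2 by rewrite divr_ge0 // exprn_ge0 // ltW.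
  by apply: lerD; apply: ler_pM => //; rewrite ler_wpM2r.
by have := qR4; nra.
Qed.

(** With t = |w|, the dangerous factor (t^2 - 1) q / |w^q - 1| is at most t + 1, because |w^q - 1|
    >= t^q - 1 >= q (t - 1) by Bernoulli. The bound 7 is what the radial shift by 1 + 1/q makes of
    |w| <= 6 when q >= 6. *)
Lemma ring_kernel_bounded_outer w : 1 + q%:R^-1 <= cmod w <= 7 ->
  cmod (ringsum w) <= 120 * q%:R.
Proof.
move=> /andP[tq t7].
have w1 : 1 < cmod w by apply: lt_le_trans tq; rewrite ltrDl invr_gt0.
have s2 : 2 <= cmod w ^+ q.
  apply: (le_trans (exprn_ge2 q0)); by rewrite lerXn2r ?nnegrE ?cmod_ge0.
apply: (le_trans (ring_kernel_le _ _)).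
- exact: cmod_gt1.
- by apply: expr_neq1; rewrite gt_eqF // (lt_le_trans _ s2) // ltr1n.
rewrite -[leLHS]mulrA [leRHS]mulrC ler_wpM2l //.
have := outer_dist w; have := bernoulli_ge q (ltW w1).
move: (cmod w ^+ q) s2 => s s2.
move: (cmod (w ^+ q - 1)) => D; move: (cmod w) w1 t7 {tq} => t t1 t7 bn sD.
have D0 : 0 < D by lra.
have t30 : 1 < t ^+ 3 by rewrite exprn_egt1.
rewrite mulrC ler_pdivrMr //; last lra.
have DV : s / D <= 2 by rewrite ler_pdivrMr //; lra.
have DV0 : 0 <= s / D by rewrite divr_ge0 //; lra.
have -> : `|t ^+ 2 - 1| * q%:R * (s / D ^+ 2) = (t + 1) * (q%:R * (t - 1) / D) * (s / D).
  by rewrite ger0_norm ?subr_ge0 ?exprn_ege1 ?ltW //; field; rewrite gt_eqF.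
have B1 : q%:R * (t - 1) / D <= 1 by rewrite ler_pdivrMr //; lra.
have B0 : 0 <= q%:R * (t - 1) / D by rewrite divr_ge0 ?mulr_ge0 //; lra.
have T2 : `|t ^+ 2 - 2| <= 47 by rewrite ler_norml; apply/andP; split; nra.
have T0 : 0 <= `|t ^+ 2 - 2| by [].
have P1 : `|t ^+ 2 - 2| * (s / D) <= 47 * 2 by rewrite ler_pM.
have E8 : (t + 1) * (q%:R * (t - 1) / D) <= 8 * 1 by rewrite ler_pM //; lra.
have E0 : 0 <= (t + 1) * (q%:R * (t - 1) / D) by rewrite mulr_ge0 //; lra.
have P2 : (t + 1) * (q%:R * (t - 1) / D) * (s / D) <= 8 * 1 * 2 by rewrite ler_pM.
by apply: (le_trans (lerD P1 P2)); lra.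
Qed.

(** Here the surplus factor q is absorbed by q (1 - t) t^(q-3) <= 2, a consequence of
    [subr1_expr_ge] with exponent q - 2 and of q <= 2 (q - 2). *)
Lemma ring_kernel_bounded_inner w : cmod w <= 1 - q%:R^-1 ->
  cmod (ringsum w) <= 120 * q%:R.
Proof.
have [->|w0] := eqVneq w 0.
  by move=> _; rewrite (sum_kernelK0 q4 om_prim) cmod0 mulr_ge0.
move=> tq.
have w1 : cmod w < 1 by apply: le_lt_trans tq _; rewrite gtrBl invr_gt0.
have s2 : cmod w ^+ q <= 2^-1.
  apply: le_trans (exprn_le_half q0); rewrite lerXn2r ?nnegrE ?cmod_ge0 //.
  by rewrite (le_trans (cmod_ge0 w)).
apply: (le_trans (ring_kernel_le w0 _)).
  by apply: expr_neq1; rewrite lt_eqF // (le_lt_trans s2) // invf_lt1 ?ltr1n.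
rewrite -[leLHS]mulrA [leRHS]mulrC ler_wpM2l //.
have t0 : 0 < cmod w by rewrite cmod_gt0.
have bn : (q - 2)%:R * ((1 - cmod w) * cmod w ^+ (q - 3)) <= 1.
  apply: (@le_trans _ _ (1 - cmod w ^+ (q - 2))).
    rewrite (_ : (q - 3 = (q - 2).-1)%N); last by lia.
    by apply: subr1_expr_ge; rewrite (ltW t0) (ltW w1).
  by rewrite gerBl exprn_ge0 ?ltW.
rewrite natrB in bn; last by move: q4; lia.
have := inner_dist w; have s0 : 0 <= cmod w ^+ q by rewrite exprn_ge0 ?cmod_ge0.
have p0 : 0 <= cmod w ^+ (q - 3) by rewrite exprn_ge0 // ltW.
have p1 : cmod w ^+ (q - 3) <= 1 by rewrite exprn_ile1 // ltW.
move: s2 s0; rewrite (inner_expr t0).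
move: (cmod (w ^+ q - 1)) => D; move: (cmod w) w1 t0 bn p0 p1 {tq} => t t1 t0.
have t30 : 0 < t ^+ 3 by rewrite exprn_gt0.
move: (t ^+ 3) t30 => t3 t30; move: (t ^+ (q - 3)) => p bn p0 p1 s2 s0 sD.
have D0 : 0 < D by lra.
rewrite mulrC ler_pdivrMr //.
have DV : t3 * p / D <= 2 * (t3 * p) by rewrite ler_pdivrMr //; nra.
have DV2 : t3 * p / D ^+ 2 <= 4 * (t3 * p) 
  by rewrite ler_pdivrMr ?exprn_gt0 // mulrAC ler_peMl //; nra.
have T2 : `|t ^+ 2 - 2| <= 2 by rewrite ler_norml; apply/andP; split; nra.
have T1 : `|t ^+ 2 - 1| <= 2 * (1 - t) by rewrite ler_norml; apply/andP; split; nra.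
apply: (@le_trans _ _ (2 * (2 * (t3 * p)) + 2 * (1 - t) * q%:R * (4 * (t3 * p)))).
  have DV0 : 0 <= t3 * p / D by rewrite divr_ge0 // ltW.
  have DV20 : 0 <= t3 * p / D ^+ 2 by rewrite divr_ge0 // exprn_ge0 // ltW.
  by apply: lerD; apply: ler_pM => //; rewrite ler_wpM2r.
have bq : q%:R * ((1 - t) * p) <= 2.
  have : 0 <= (1 - t) * p by rewrite mulr_ge0 //; lra.
  by have := qR4; move: ((1 - t) * p) bn => b; nra.
have -> : 2 * (2 * (t3 * p)) + 2 * (1 - t) * q%:R * (4 * (t3 * p)) =
  t3 * (4 * p + 8 * (q%:R * ((1 - t) * p))) by ring.
by rewrite mulrC ler_wpM2r //; lra.
Qed.

End ring_kernel.

(** * A circle of points without its nearest point *)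

Section punctured_ring.
Context {R : realType}.
Implicit Types (w x z : R[i]).
Context (q : nat) (om : R[i]).
Context (q6 : (6 <= q)%N) (om_prim : q.-primitive_root om).

Let q4 : (4 <= q)%N. Proof. exact: leq_trans q6. Qed.
Let q0 : (0 < q)%N. Proof. exact: leq_trans q6. Qed.
Let qR0 : 0 < q%:R :> R. Proof. by rewrite ltr0n. Qed.
Let qR6 : 6 <= q%:R :> R. Proof. by rewrite (ler_nat _ 6). Qed.
Let qV0 : 0 < q%:R^-1 :> R. Proof. by rewrite invr_gt0. Qed.
Let qqV : q%:R * q%:R^-1 = 1 :> R. Proof. by rewrite divff // gt_eqF. Qed.
Let qV6 : q%:R^-1 <= 6^-1 :> R.
Proof. by rewrite lef_pV2 ?posrE. Qed.

(* Moving radially by a relative amount [1/q] away from the circle puts the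
   point where the closed forms are harmless. *)
Lemma ring_radial_shift w : cmod w <= 6 -> exists w',
  [/\ cmod (w' - w) <= 6 * q%:R^-1,
      \sum_(i < q) (cmod (w' - om ^+ i) ^+ 2)^-1 <= 3 * q%:R ^+ 2,
      cmod (\sum_(i < q) kernelK (w' - om ^+ i)) <= 120 * q%:R &
      forall i, q%:R^-1 <= cmod (w' - om ^+ i)].
Proof.
move=> w6; have w0 := cmod_ge0 w.
have v0 := qV0; have v6 := qV6; have r6 := qR6; have rv := qqV.
have [w1|w1] := leP 1 (cmod w).
  exists ((1 + q%:R^-1)%:C%C * w).
  have c1 : cmod ((1 + q%:R^-1)%:C%C * w) = (1 + q%:R^-1) * cmod w.
    by rewrite cmodM cmod_real ger0_norm // addr_ge0 // ltW.
  have g1 : 1 + q%:R^-1 <= cmod ((1 + q%:R^-1)%:C%C * w) by rewrite c1; nra.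
  have s2 : 2 <= cmod ((1 + q%:R^-1)%:C%C * w) ^+ q.
    by apply: (le_trans (exprn_ge2 q0)); rewrite lerXn2r ?nnegrE ?cmod_ge0.
  split.
  - have -> : (1 + q%:R^-1)%:C%C * w - w = (q%:R^-1)%:C%C * w.
      by rewrite (rmorphD (real_complex R)) (rmorph1 (real_complex R)); ring.
    by rewrite cmodM cmod_real (ger0_norm (ltW qV0)); nra.
  - apply: (le_trans (sum_inv_sqr_outer q4 om_prim _ s2)); first lra.
    set c := cmod _ in g1 *; have h : q%:R^-1 <= c ^+ 2 - 1 by nra.
    rewrite ler_pdivrMr; last by lra.
    have : 3 * q%:R ^+ 2 * q%:R^-1 <= 3 * q%:R ^+ 2 * (c ^+ 2 - 1).
      by rewrite ler_wpM2l // mulr_ge0.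
    by apply: le_trans; rewrite expr2 -!mulrA rv; lra.
  - by apply: ring_kernel_bounded_outer => //; rewrite g1 c1 /=; nra.
  - move=> i; apply: le_trans (lerB_cmod _ _).
    by rewrite (cmod_prim_root q4 om_prim); lra.
exists ((1 - q%:R^-1)%:C%C * w).
have c1 : cmod ((1 - q%:R^-1)%:C%C * w) = (1 - q%:R^-1) * cmod w.
  by rewrite cmodM cmod_real ger0_norm //; lra.
have g1 : cmod ((1 - q%:R^-1)%:C%C * w) <= 1 - q%:R^-1 by rewrite c1; nra.
have s2 : cmod ((1 - q%:R^-1)%:C%C * w) ^+ q <= 2^-1.
  apply: le_trans (exprn_le_half q0); rewrite lerXn2r ?nnegrE ?cmod_ge0 //.
  by lra.
have g0 := cmod_ge0 ((1 - q%:R^-1)%:C%C * w).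
split.
- have -> : (1 - q%:R^-1)%:C%C * w - w = - ((q%:R^-1)%:C%C * w).
    by rewrite (rmorphB (real_complex R)) (rmorph1 (real_complex R)); ring.
  by rewrite cmodN cmodM cmod_real (ger0_norm (ltW qV0)); nra.
- apply: (le_trans (sum_inv_sqr_inner q4 om_prim _ s2)); first lra.
  set c := cmod _ in g1 g0 *; have h : q%:R^-1 <= 1 - c ^+ 2 by nra.
  rewrite ler_pdivrMr; last by lra.
  have : 3 * q%:R ^+ 2 * q%:R^-1 <= 3 * q%:R ^+ 2 * (1 - c ^+ 2).
    by rewrite ler_wpM2l // mulr_ge0.
  by apply: le_trans; rewrite expr2 -!mulrA rv; lra.
- exact: ring_kernel_bounded_inner.
- move=> i; rewrite cmod_distC; apply: le_trans (lerB_cmod _ _).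
  by rewrite (cmod_prim_root q4 om_prim); lra.
Qed.

(** The closed forms hold at the shifted point w'. Returning to w costs at most a constant factor in
    each distance, once the one point that may be much closer to w is dropped. *)
Lemma punctured_ring w : cmod w <= 6 -> exists i0 : 'I_q,
  [/\ forall i, i != i0 -> (4 * q%:R)^-1 <= cmod (w - om ^+ i),
      \sum_(i < q | i != i0) (cmod (w - om ^+ i) ^+ 2)^-1 <= 2 * 10 ^+ 3 * q%:R ^+ 2 &
      cmod (\sum_(i < q | i != i0) kernelK (w - om ^+ i)) <= 4 * 10 ^+ 4 * q%:R].
Proof.
move=> w6; have v0 := qV0; have v6 := qV6; have r6 := qR6; have rv := qqV.
have [i0 sep] : exists i0 : 'I_q,
    forall i, i != i0 -> (4 * q%:R)^-1 <= cmod (w - om ^+ i).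
  (* Points are 1/(2q) apart, so at most one lies within 1/(4q) of w; if none does, any index will
     do. *)
  case: (pickP (fun i : 'I_q => cmod (w - om ^+ i) < (4 * q%:R)^-1)) => [i0 h0|h].
    exists i0 => i /(prim_root_sep q4 om_prim) h.
    have := ler_cmod_dist w (om ^+ i) (om ^+ i0); rewrite [cmod (_ - w)]cmod_distC.
    by rewrite !invfM in h h0 *; lra.
  by exists (Ordinal q0) => i _; rewrite leNgt h.
exists i0.
have [w' [dw sq bd far]] := ring_radial_shift w6.
have A0 i : i != i0 -> 0 < cmod (w - om ^+ i).
  by move=> /sep; apply: lt_le_trans; rewrite invr_gt0 mulr_gt0.
have B0 i : 0 < cmod (w' - om ^+ i) by apply: lt_le_trans (far i).
(* The shift is at most 6/q, that is 24 times the lower bound 1/(4q), whence 25 = 1 + 24. *)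
have BA (i : 'I_q) : i != i0 -> cmod (w' - om ^+ i) <= 25 * cmod (w - om ^+ i).
  move=> /sep h; apply: (le_trans (ler_cmod_dist w _ _)).
  by rewrite invfM in h; lra.
have sqB : \sum_(i < q | i != i0) (cmod (w' - om ^+ i) ^+ 2)^-1 <= 3 * q%:R ^+ 2.
  apply: le_trans sq; rewrite [leRHS](bigID (fun i => i != i0)) /= lerDl.
  by apply: sumr_ge0 => i _; rewrite invr_ge0 sqr_ge0.
have sqA : \sum_(i < q | i != i0) (cmod (w - om ^+ i) ^+ 2)^-1 <= 2 * 10 ^+ 3 * q%:R ^+ 2.
  apply: (@le_trans _ _ (25 ^+ 2 * (3 * q%:R ^+ 2))); last first.
    by rewrite mulrA ler_wpM2r ?exprn_ge0 //; lra.
  apply: le_trans (ler_wpM2l _ sqB) => //; rewrite mulr_sumr; apply: ler_sum => i ii0.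
  have := BA i ii0; have := A0 i ii0; have := B0 i.
  move: (cmod (w' - om ^+ i)) (cmod (w - om ^+ i)) => B A hB hA h.
  rewrite ler_pdivlMr ?exprn_gt0 // mulrC ler_pdivrMr ?exprn_gt0 //.
  by rewrite -exprMn lerXn2r //  ?nnegrE ?mulr_ge0 ?ltW.
split => //.
have -> : \sum_(i < q | i != i0) kernelK (w - om ^+ i) =
    \sum_(i < q | i != i0) (kernelK (w - om ^+ i) - kernelK (w' - om ^+ i)) +
    (\sum_(i < q) kernelK (w' - om ^+ i) - kernelK (w' - om ^+ i0)).
  rewrite [X in _ + (X - _)](bigD1 i0) //= sumrB.
  by rewrite [kernelK (w' - _) + _]addrC addrK subrK.
apply: (@le_trans _ _ (6 * (3 * (2 * 10 ^+ 3) + 3) * q%:R + (120 * q%:R + q%:R))).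
  2: by rewrite -{3}[q%:R]mul1r -!mulrDl ler_wpM2r //; lra.
apply: (le_trans (ler_cmodD _ _)); apply: lerD; last first.
  apply: (le_trans (ler_cmodB _ _)); apply: lerD => //.
  by rewrite cmod_kernelK -[leRHS]invrK lef_pV2 ?posrE.
apply: (le_trans (ler_cmod_sum _ _ _)).
(* With A and B the inverse distances to w and w', the Lipschitz weight 2 A^2 + A B is at most 3 A^2
   + B^2, which separates the two inverse-square sums. *)
apply: (@le_trans _ _ (\sum_(i < q | i != i0) (6 * q%:R^-1) *
   (3 * (cmod (w - om ^+ i) ^+ 2)^-1 + (cmod (w' - om ^+ i) ^+ 2)^-1))).
  apply: ler_sum => i ii0; apply: (le_trans (kernelK_lipschitz _ _)).
  - by rewrite -cmod_gt0 A0.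
  - by rewrite -cmod_gt0.
  have -> : w - om ^+ i - (w' - om ^+ i) = w - w' by ring.
  have : 0 < (cmod (w - om ^+ i))^-1 by rewrite invr_gt0 A0.
  have : 0 < (cmod (w' - om ^+ i))^-1 by rewrite invr_gt0.
  rewrite -!exprVn invfM cmod_distC.
  move: (cmod (w' - om ^+ i))^-1 (cmod (w - om ^+ i))^-1 => B A hB hA.
  apply: ler_pM; rewrite ?cmod_ge0 //; last by nra.
  by rewrite addr_ge0 ?mulr_ge0 ?exprn_ge0 ?ltW.
rewrite -mulr_sumr big_split /= -mulr_sumr.
apply: (@le_trans _ _ (6 * q%:R^-1 * (3 * (2 * 10 ^+ 3 * q%:R ^+ 2) + 3 * q%:R ^+ 2))).
  by apply: ler_wpM2l; [rewrite mulr_ge0 ?ltW|apply: lerD => //; rewrite ler_wpM2l].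
have -> : 6 * q%:R^-1 * (3 * (2 * 10 ^+ 3 * q%:R ^+ 2) + 3 * q%:R ^+ 2) =
  6 * (3 * (2 * 10 ^+ 3) + 3) * q%:R * (q%:R * q%:R^-1) :> R by ring.
by rewrite qqV mulr1.
Qed.
End punctured_ring.

(** * The configuration of points in the unit disc *)

Section disc_points.
Context {R : realType}.
Implicit Types (w x z : R[i]) (a : nat).

(* With [M = a ^ 2], the unit disc receives [M] concentric circles carrying
   [ringsize a] equispaced points each. Equal spacing of the squared radii makes
   the configuration mimic the uniform measure on the disc, whose field vanishes
   inside; [ringsize a] is so large that every circle but the nearest one is
   as good as continuous, see [ringsize_growth]. *)
Definition ringsize a : nat := (2 * (16 * a ^ 2) ^ 3 + 2).+1.

(** Indexed by the predecessor of the order, so that the order is positive by construction. *)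
Definition unity_root n : R[i] := sval (@prim_root_exists R n.+1 (ltn0Sn n)).

(** The squared radius is the midpoint of [k/M, (k+1)/M]: ring [k] stands for the k-th of M annuli
    of equal area. *)
Definition radius a (k : nat) : R := Num.sqrt ((2 * k + 1)%:R / (2 * a%:R ^+ 2)).

Definition disc_point a (k i : nat) : R[i] :=
  (radius a k)%:C%C * unity_root (ringsize a).-1 ^+ i.

Lemma unity_rootP n : n.+1.-primitive_root (unity_root n).
Proof. exact: (svalP (@prim_root_exists R n.+1 (ltn0Sn n))). Qed.

Context (a : nat).
Context (a64 : (64 <= a)%N).

Notation q := (ringsize a).
Notation M := (a ^ 2)%N.
Notation rho := (radius a).
Notation om := (unity_root (ringsize a).-1).
Notation pt k i := (disc_point a k i).

Let om_prim : q.-primitive_root om. Proof. exact: unity_rootP. Qed.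

Let ar64 : 64 <= a%:R :> R. Proof. by rewrite (ler_nat _ 64). Qed.
Let Mr : M%:R = a%:R ^+ 2 :> R. Proof. by rewrite natrX. Qed.

Lemma ringsizeE : q%:R = 2 * (16 * a%:R ^+ 2) ^+ 3 + 3 :> R.
Proof. by rewrite /ringsize -addnS natrD natrM natrX natrM natrX. Qed.

Lemma ringsize_ge : 64 * a%:R ^+ 2 <= q%:R :> R.
Proof.
have a1 := ar64; rewrite ringsizeE.
have : 1 <= a%:R ^+ 2 :> R by nra.
by move: (a%:R ^+ 2) => b b1; nra.
Qed.

Lemma ringsize_ge6 : (6 <= q)%N.
Proof.
rewrite -(ler_nat R); apply: le_trans ringsize_ge.
by have a1 := ar64; nra.
Qed.
Let q4 : (4 <= q)%N. Proof. exact: leq_trans ringsize_ge6. Qed.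
Let q0 : (0 < q)%N. Proof. by []. Qed.

(** Lower bound for the quotient of |z| and the radius of a ring, in either order, when their
    squares differ by half the width 1/M of an annulus; [growth_ratio_sqr] is the comparison. *)
Definition growth_ratio : R := 1 + (8 * a%:R ^+ 2)^-1.

(** A single use of Bernoulli only gives order q/M, which is too small. But q - 3 = n + n with n =
    (16 M)^3, each half gives 2^9 M^2, and the product 2^18 M^4 beats 8 q M, whose leading term is
    2^16 M^4. *)
Lemma ringsize_growth : 8 * q%:R * a%:R ^+ 2 <= growth_ratio ^+ (q - 3).
Proof.
have a1 := ar64; have M1 : 1 <= a%:R ^+ 2 :> R by nra.
set n := ((16 * a ^ 2) ^ 3)%N.
have -> : (q - 3 = n + n)%N by rewrite /ringsize -/n; lia.
have nE : n%:R = (16 * a%:R ^+ 2) ^+ 3 :> R by rewrite natrX natrM natrX.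
rewrite exprD ringsizeE; rewrite -nE.
have g1 : 1 <= growth_ratio by rewrite lerDl invr_ge0; lra.
have := bernoulli_ge n g1; rewrite {1}/growth_ratio [1 + _^-1]addrC addrK.
have -> : n%:R / (8 * a%:R ^+ 2) = 2 ^+ 9 * (a%:R ^+ 2) ^+ 2 :> R.
  by rewrite nE; field; rewrite gt_eqF //; lra.
rewrite nE; move: (a%:R ^+ 2) M1 => b b1; move: (growth_ratio ^+ n) => g h.
have h0 : 2 ^+ 9 * b ^+ 2 <= g by nra.
apply: (@le_trans _ _ ((2 ^+ 9 * b ^+ 2) * (2 ^+ 9 * b ^+ 2))); last first.
  by apply: ler_pM => //; nra.
have -> : 8 * (2 * (16 * b) ^+ 3 + 3) * b = 2 ^+ 16 * b ^+ 4 + 24 * b by ring.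
have -> : 2 ^+ 9 * b ^+ 2 * (2 ^+ 9 * b ^+ 2) = 2 ^+ 16 * b ^+ 4 + 3 * 2 ^+ 16 * b ^+ 4 by ring.
rewrite lerD2l -[leLHS]mulr1; apply: (@le_trans _ _ (24 * b * b ^+ 3)).
  by rewrite ler_wpM2l ?exprn_ege1 //; lra.
by have : 0 <= b ^+ 4; [rewrite exprn_ge0 //; lra|rewrite -mulrA -exprS; lra].
Qed.

Lemma sqr_radius k : rho k ^+ 2 = (2 * k + 1)%:R / (2 * a%:R ^+ 2).
Proof. by rewrite sqr_sqrtr // divr_ge0 ?mulr_ge0 ?exprn_ge0. Qed.

Lemma radius_ge0 k : 0 <= rho k. Proof. exact: sqrtr_ge0. Qed.
Hint Resolve radius_ge0 : core.

Lemma radius_ge k : (2 * a%:R)^-1 <= rho k.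
Proof.
have a1 := ar64.
rewrite -(@ler_pXn2r _ 2) ?nnegrE ?invr_ge0 ?mulr_ge0 // sqr_radius.
apply: (@le_trans _ _ (1 / (2 * a%:R ^+ 2))).
  by rewrite mul1r exprVn lef_pV2 ?posrE; nra.
by rewrite ler_wpM2r ?invr_ge0 ?mulr_ge0 ?exprn_ge0 // ler1n addn1.
Qed.

Lemma radius_gt0 k : 0 < rho k.
Proof. by apply: lt_le_trans (radius_ge k); rewrite invr_gt0; have := ar64; lra. Qed.

Hint Resolve radius_gt0 : core.

(** The margin 1/(4 M) ensures that the concentric enlargement of a child disc by the factor 4 stays
    inside the parent disc. *)
Lemma radius_le (k : 'I_M) : rho k <= 1 - (4 * a%:R ^+ 2)^-1.
Proof.
have a1 := ar64; have M1 : 1 <= a%:R ^+ 2 :> R by nra.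
have V1 : (4 * a%:R ^+ 2)^-1 <= 1 :> R by rewrite invf_le1; lra.
rewrite -(@ler_pXn2r _ 2) ?nnegrE ?subr_ge0 // sqr_radius.
have kM : k%:R + 1 <= a%:R ^+ 2 :> R by rewrite -Mr natr1 ler_nat.
apply: (@le_trans _ _ (1 - (2 * a%:R ^+ 2)^-1)).
  rewrite ler_pdivrMr; last lra.
  rewrite mulrBl mul1r mulVf ?gt_eqF //; last lra.
  by rewrite natrD natrM; lra.
have -> : (2 * a%:R ^+ 2)^-1 = 2 * (4 * a%:R ^+ 2)^-1 :> R.
  by field; rewrite gt_eqF //; lra.
by move: (_^-1) => v; nra.
Qed.

Lemma radius_le1 (k : 'I_M) : rho k <= 1.
Proof.
apply: (le_trans (radius_le k)); rewrite gerBl invr_ge0.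
by have a1 := ar64; nra.
Qed.

Lemma cmod_disc_point k i : cmod (pt k i) = rho k.
Proof. by rewrite cmodM (cmod_prim_root q4 om_prim) mulr1 cmod_real ger0_norm. Qed.

Lemma cmod_disc_scale k z : cmod ((rho k)^-1%:C%C * z) = cmod z / rho k.
Proof. by rewrite cmodM cmod_real mulrC ger0_norm // invr_ge0. Qed.

Lemma disc_point_dist k z i : z - pt k i = (rho k)%:C%C * ((rho k)^-1%:C%C * z - om ^+ i).
Proof.
by rewrite mulrBr mulrA -(rmorphM (real_complex R)) divff ?gt_eqF // mul1r.
Qed.

Lemma sum_kernelK_ring (P : pred 'I_q) k z :
  \sum_(i < q | P i) kernelK (z - pt k i) =
  (rho k)^-1%:C%C * \sum_(i < q | P i) kernelK ((rho k)^-1%:C%C * z - om ^+ i).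
Proof.
by rewrite mulr_sumr; apply: eq_bigr => i _; rewrite disc_point_dist kernelK_scale.
Qed.

Lemma sum_inv_sqr_ring (P : pred 'I_q) k z :
  \sum_(i < q | P i) (cmod (z - pt k i) ^+ 2)^-1 =
  (rho k) ^- 2 * \sum_(i < q | P i) (cmod ((rho k)^-1%:C%C * z - om ^+ i) ^+ 2)^-1.
Proof.
rewrite mulr_sumr; apply: eq_bigr => i _.
by rewrite disc_point_dist cmodM cmod_real ger0_norm // exprMn invfM.
Qed.

Lemma invr_radius_le k : (rho k)^-1 <= 2 * a%:R.
Proof.
by rewrite -[leRHS]invrK lef_pV2 ?posrE ?radius_ge ?invr_gt0 //; have := ar64; lra.
Qed.

Lemma growth_ratio_gt1 : 1 < growth_ratio.
Proof. by rewrite ltrDl invr_gt0; have a1 := ar64; nra. Qed.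

Lemma growth_ratio_expr : 2 <= growth_ratio ^+ q.
Proof.
apply: (@le_trans _ _ (growth_ratio ^+ (q - 3))); last first.
  by rewrite ler_weXn2l ?leq_subr // ltW // growth_ratio_gt1.
apply: le_trans ringsize_growth; have := ringsize_ge; have a1 := ar64.
have M1 : 1 <= a%:R ^+ 2 :> R by nra.
by move: (q%:R : R) (a%:R ^+ 2) M1 => Q b b1 h; nra.
Qed.

Lemma growth_ratio_sqr : growth_ratio ^+ 2 <= 1 + (2 * a%:R ^+ 2)^-1.
Proof.
have a1 := ar64; have M1 : 1 <= a%:R ^+ 2 :> R by nra.
have -> : (2 * a%:R ^+ 2)^-1 = 4 * (8 * a%:R ^+ 2)^-1 :> R.
  by field; rewrite gt_eqF //; lra.
have V1 : (8 * a%:R ^+ 2)^-1 <= 1 :> R by rewrite invf_le1; lra.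
have V0 : 0 <= (8 * a%:R ^+ 2)^-1 :> R by rewrite invr_ge0; lra.
by rewrite /growth_ratio; move: (_^-1) V0 V1 => v; nra.
Qed.

(** After scaling to the unit circle, [ringsize_growth] makes the error at most q/M, and undoing the
    scaling costs 1/rho <= 2a. Summed over the M = a^2 rings this is 2 a q, no more than the order
    of the other errors. *)
Lemma far_ring_outer (k : 'I_M) z :
  rho k ^+ 2 + (2 * a%:R ^+ 2)^-1 <= cmod z ^+ 2 ->
  cmod (\sum_(i < q) kernelK (z - pt k i)
        - (q%:R * (cmod z ^+ 2 - 2 * rho k ^+ 2))%:C%C / z ^+ 3) <= 2 * q%:R / a%:R /\
  \sum_(i < q) (cmod (z - pt k i) ^+ 2)^-1 <= 6 * q%:R * a%:R ^+ 2.
Proof.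
move=> hz; have a1 := ar64; have M1 : 1 <= a%:R ^+ 2 :> R by nra.
have r0 := radius_gt0 k; have r1 := radius_le1 k.
have V0 : 0 < (2 * a%:R ^+ 2)^-1 :> R by rewrite invr_gt0; lra.
pose w := (rho k)^-1%:C%C * z.
have wE : cmod w = cmod z / rho k by exact: cmod_disc_scale.
have w_ge : growth_ratio <= cmod w.
  rewrite -(@ler_pXn2r _ 2) ?nnegrE ?cmod_ge0 //; last by have := growth_ratio_gt1; lra.
  apply: (le_trans growth_ratio_sqr); rewrite wE expr_div_n ler_pdivlMr ?exprn_gt0 //.
  have : rho k ^+ 2 <= 1 by rewrite exprn_ile1.
  by move: (rho k ^+ 2) hz => r hz r2; nra.
have w1 : 1 < cmod w by exact: lt_le_trans growth_ratio_gt1 w_ge.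
have g0 : 0 <= growth_ratio by have := growth_ratio_gt1; lra.
have s2 : 2 <= cmod w ^+ q.
  by apply: (le_trans growth_ratio_expr); rewrite lerXn2r ?nnegrE ?cmod_ge0.
have z0 : z != 0.
  by rewrite -cmod_gt0; have := cmod_ge0 z; nra.
split.
  have := ring_kernel_outer q4 om_prim w1 s2; set S := \sum_(i < q) _ => h.
  have -> : \sum_(i < q) kernelK (z - pt k i) -
     (q%:R * (cmod z ^+ 2 - 2 * rho k ^+ 2))%:C%C / z ^+ 3 =
     (rho k)^-1%:C%C * (S - (q%:R * (cmod w ^+ 2 - 2))%:C%C / w ^+ 3).
    rewrite sum_kernelK_ring [RHS]mulrBr; congr (_ - _).
    have -> : (q%:R * (cmod w ^+ 2 - 2))%:C%C =
        (rho k)^-1%:C%C ^+ 2 * (q%:R * (cmod z ^+ 2 - 2 * rho k ^+ 2))%:C%C :> R[i].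
      rewrite wE -(rmorphXn (real_complex R)) -(rmorphM (real_complex R)).
      by congr (_%:C%C); field; rewrite gt_eqF.
    have c0 : (rho k)^-1%:C%C != 0 :> R[i].
      by rewrite (fmorph_eq0 (real_complex R)) invr_eq0 gt_eqF.
    rewrite /w; move: (_%:C%C) (_%:C%C) c0 => c N c0.
    by field; rewrite z0 c0.
  rewrite cmodM cmod_real ger0_norm ?invr_ge0 //.
  apply: (@le_trans _ _ (2 * a%:R * (q%:R * (a%:R ^+ 2)^-1))); last first.
    by rewrite le_eqVlt; apply/orP; left; apply/eqP; field; rewrite gt_eqF //; lra.
  apply: ler_pM; rewrite ?cmod_ge0 ?invr_ge0 ?invr_radius_le //.
  apply: (le_trans h); rewrite ler_wpM2l //.
  rewrite ler_pdivrMr; last by lra.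
  rewrite [leRHS]mulrC ler_pdivlMr; last by lra.
  apply: (@le_trans _ _ (8 * q%:R * a%:R ^+ 2)).
    by rewrite !ler_wpM2r //; lra.
  apply: (le_trans ringsize_growth); apply: (@le_trans _ _ (growth_ratio ^+ q)).
    by rewrite ler_weXn2l ?leq_subr // ltW // growth_ratio_gt1.
  by rewrite lerXn2r ?nnegrE ?cmod_ge0.
rewrite sum_inv_sqr_ring.
apply: (le_trans (ler_wpM2l _ (sum_inv_sqr_outer q4 om_prim w1 s2))).
  by rewrite invr_ge0 exprn_ge0.
rewrite wE expr_div_n.
have -> : rho k ^- 2 * (3 * q%:R / (cmod z ^+ 2 / rho k ^+ 2 - 1)) =
   3 * q%:R / (cmod z ^+ 2 - rho k ^+ 2).
  have r_neq0 : rho k != 0 by rewrite gt_eqF.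
  have d_neq0 : cmod z ^+ 2 - rho k ^+ 2 != 0 by rewrite gt_eqF //; lra.
  by field; rewrite r_neq0 d_neq0.
rewrite ler_pdivrMr; last by lra.
have : (2 * a%:R ^+ 2)^-1 <= cmod z ^+ 2 - rho k ^+ 2 by lra.
move/(ler_wpM2l (_ : 0 <= 6 * q%:R * a%:R ^+ 2)) => h.
apply: le_trans (h _); last by rewrite !mulr_ge0 //; lra.
by rewrite le_eqVlt; apply/orP; left; apply/eqP; field; rewrite gt_eqF //; lra.
Qed.

End disc_points.

Lemma sum_pair_split (V : zmodType) (I J : finType) (p0 : I * J) (F : I * J -> V) :
  \sum_(p | p != p0) F p =
  \sum_(k | k != p0.1) \sum_i F (k, i) + \sum_(i | i != p0.2) F (p0.1, i).
Proof.
have E : \sum_p F p = F p0 + \sum_(p | p != p0) F p by rewrite (bigD1 p0).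
apply: (addrI (F p0)); rewrite -E.
have -> : \sum_p F p = \sum_k \sum_i F (k, i).
  by rewrite pair_bigA; apply: eq_bigr => -[].
rewrite (bigD1 p0.1) //= (bigD1 p0.2) //=; case: p0 E => k0 i0 /= _.
by rewrite -addrA [X in _ + X]addrC.
Qed.

Section disc_configuration.
Context {R : realType}.
Implicit Types (w x z : R[i]).
Context (a : nat).
Context (a64 : (64 <= a)%N).

Notation q := (ringsize a).
Notation M := (a ^ 2)%N.
Notation rho := (@radius R a).
Notation om := (@unity_root R (ringsize a).-1).
Notation pt k i := (@disc_point R a k i).
Notation growth_ratio := (@growth_ratio R a).

Let om_prim : q.-primitive_root om. Proof. exact: unity_rootP. Qed.
Let ar64 : 64 <= a%:R :> R. Proof. by rewrite (ler_nat _ 64). Qed.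
Let Mr : M%:R = a%:R ^+ 2 :> R. Proof. by rewrite natrX. Qed.
Let q6 : (6 <= q)%N. Proof. exact: (@ringsize_ge6 R). Qed.
Let q4 : (4 <= q)%N. Proof. exact: leq_trans q6. Qed.
Let M64 : 64 * a%:R <= a%:R ^+ 2 :> R.
Proof. by have a1 := ar64; rewrite expr2 ler_wpM2r. Qed.
Let rho_gt0 k : 0 < rho k. Proof. exact: radius_gt0. Qed.
Let rho_ge0 k : 0 <= rho k. Proof. exact: radius_ge0. Qed.
Hint Resolve rho_gt0 rho_ge0 : core.

Lemma far_ring_inner (k : 'I_M) z :
  cmod z ^+ 2 <= rho k ^+ 2 - (2 * a%:R ^+ 2)^-1 ->
  cmod (\sum_(i < q) kernelK (z - pt k i)) <= 2 * q%:R / a%:R /\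
  \sum_(i < q) (cmod (z - pt k i) ^+ 2)^-1 <= 6 * q%:R * a%:R ^+ 2.
Proof.
move=> hz; have a1 := ar64; have M1 := M64.
have r0 := rho_gt0 k; have r1 : rho k <= 1 := radius_le1 a64 k.
have V0 : 0 < (2 * a%:R ^+ 2)^-1 :> R by rewrite invr_gt0; lra.
pose w := (rho k)^-1%:C%C * z.
have wE : cmod w = cmod z / rho k by exact: cmod_disc_scale.
have g1 : 1 < growth_ratio by exact: growth_ratio_gt1.
have w0 := cmod_ge0 w.
have w_le : cmod w * growth_ratio <= 1.
  rewrite -(@ler_pXn2r _ 2) ?nnegrE ?mulr_ge0 //; last by lra.
  rewrite expr1n exprMn.
  have w2 : cmod w ^+ 2 <= 1 - (2 * a%:R ^+ 2)^-1.
    rewrite wE expr_div_n ler_pdivrMr ?exprn_gt0 //.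
    have : rho k ^+ 2 <= 1 by rewrite exprn_ile1.
    by move: (rho k ^+ 2) hz => r hz r2; nra.
  have g2 : growth_ratio ^+ 2 <= 1 + (2 * a%:R ^+ 2)^-1 by exact: growth_ratio_sqr.
  apply: (le_trans (ler_pM _ _ w2 g2)); rewrite ?exprn_ge0 //; first lra.
  by move: (_^-1) => v; nra.
have w_expr n : cmod w ^+ n <= (growth_ratio ^+ n)^-1.
  rewrite -[leRHS]mul1r ler_pdivlMr ?exprn_gt0; try lra.
  by rewrite -exprMn exprn_ile1 // mulr_ge0 //; lra.
have w1 : cmod w < 1 by nra.
have s2 : cmod w ^+ q <= 2^-1.
  apply: (le_trans (w_expr q)); rewrite lef_pV2 ?posrE ?exprn_gt0 //; try lra.
  exact: growth_ratio_expr.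
split.
  rewrite sum_kernelK_ring // cmodM cmod_real ger0_norm ?invr_ge0 //.
  have := ring_kernel_inner q4 om_prim w1 s2; rewrite -/w => h.
  apply: (@le_trans _ _ (2 * a%:R * (q%:R * (a%:R ^+ 2)^-1))); last first.
    by rewrite le_eqVlt; apply/orP; left; apply/eqP; field; rewrite gt_eqF //; lra.
  apply: ler_pM; rewrite ?cmod_ge0 ?invr_ge0 ?invr_radius_le //.
  apply: (le_trans h); rewrite ler_wpM2l //.
  apply: (@le_trans _ _ (8 * q%:R * (growth_ratio ^+ (q - 3))^-1)).
    by rewrite ler_wpM2l // mulr_ge0.
  rewrite ler_pdivrMr ?exprn_gt0 //; last lra.
  rewrite [leRHS]mulrC ler_pdivlMr ?exprn_gt0 //; last lra.
  exact: ringsize_growth.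
rewrite sum_inv_sqr_ring //.
apply: (le_trans (ler_wpM2l _ (sum_inv_sqr_inner q4 om_prim w1 s2))).
  by rewrite invr_ge0 exprn_ge0.
rewrite wE expr_div_n.
have -> : rho k ^- 2 * (3 * q%:R / (1 - cmod z ^+ 2 / rho k ^+ 2)) =
   3 * q%:R / (rho k ^+ 2 - cmod z ^+ 2).
  have r_neq0 : rho k != 0 by rewrite gt_eqF.
  have d_neq0 : rho k ^+ 2 - cmod z ^+ 2 != 0 by rewrite gt_eqF //; lra.
  by field; rewrite r_neq0 d_neq0.
rewrite ler_pdivrMr; last by lra.
have : (2 * a%:R ^+ 2)^-1 <= rho k ^+ 2 - cmod z ^+ 2 by lra.
move/(ler_wpM2l (_ : 0 <= 6 * q%:R * a%:R ^+ 2)) => h.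
apply: le_trans (h _); last by rewrite !mulr_ge0 //; lra.
by rewrite le_eqVlt; apply/orP; left; apply/eqP; field; rewrite gt_eqF //; lra.
Qed.

Lemma sqr_radiusD k : rho k ^+ 2 + (2 * a%:R ^+ 2)^-1 = k.+1%:R / a%:R ^+ 2.
Proof.
have a1 := ar64; rewrite sqr_radius natrD natrM -natr1.
by field; rewrite gt_eqF //; lra.
Qed.

Lemma sqr_radiusB k : rho k ^+ 2 - (2 * a%:R ^+ 2)^-1 = k%:R / a%:R ^+ 2.
Proof.
have a1 := ar64; rewrite sqr_radius natrD natrM.
by field; rewrite gt_eqF //; lra.
Qed.

(** With T = |z|^2, [k0] is the annulus containing z, or the last one if z is outside the unit disc.
    The squared radii of all other rings then differ from T by at least 1/(2M). *)
Lemma nearest_ring (T : R) : 0 <= T -> exists k0 : 'I_M,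
  [/\ k0%:R / a%:R ^+ 2 <= T, T <= 1 -> T <= k0.+1%:R / a%:R ^+ 2 &
      1 < T -> k0.+1 = M].
Proof.
move=> T0; have a1 := ar64; have M1 := M64.
have M0 : 0 < a%:R ^+ 2 :> R by lra.
have MN0 : (0 < M)%N by rewrite -(ltr_nat R) Mr.
(* T = 1 goes with the outside, since the integer part of M T would be M, one past the last ring. *)
have [T1|T1] := leP 1 T.
  have h : (M.-1 < M)%N by rewrite prednK.
  have e : (Ordinal h).+1 = M by rewrite /= prednK.
  exists (Ordinal h); split => // [|T1'].
    apply: le_trans T1; rewrite ler_pdivrMr // mul1r -Mr ler_nat /=.
    exact: leq_pred.
  by rewrite e Mr divff ?gt_eqF.
have /andP[t1 t2] := truncn_itv (mulr_ge0 (ltW M0) T0).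
have h : (Num.truncn (a%:R ^+ 2 * T) < M)%N.
  by rewrite -(ltr_nat R) Mr; apply: (le_lt_trans t1); nra.
exists (Ordinal h); split => /= [|_|T1'].
- by rewrite ler_pdivrMr // [leRHS]mulrC.
- by rewrite ler_pdivlMr // [leLHS]mulrC ltW.
- by rewrite ltNge (ltW T1) in T1'.
Qed.

Lemma ring_dist (k : 'I_M) z i : `|cmod z ^+ 2 - rho k ^+ 2| <=
  (cmod z + 1) * cmod (z - pt k i).
Proof.
have -> : cmod z ^+ 2 - rho k ^+ 2 = (cmod z + rho k) * (cmod z - rho k) by ring.
rewrite normrM (ger0_norm (addr_ge0 (cmod_ge0 z) (radius_ge0 _ _))).
rewrite ler_pM ?addr_ge0 ?cmod_ge0 //.
  by rewrite lerD2l (radius_le1 a64).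
by rewrite -{1}(@cmod_disc_point R a a64 k i) ler_dist_cmod.
Qed.

(** The first [k0] odd numbers add up to k0^2. This is the discrete form of the averaging to zero:
    for T in the annulus of [k0] the last factor is at most 1/M. *)
Lemma sum_radius (T : R) (k0 : 'I_M) :
  \sum_(k < M | (k < k0)%N) (T - 2 * rho k ^+ 2) = k0%:R * (T - k0%:R / a%:R ^+ 2).
Proof.
rewrite -(big_ord_widen M (fun k => T - 2 * rho k ^+ 2)) 1?ltnW //.
have a1 := ar64.
elim: (k0 : nat) => [|n IH]; first by rewrite big_ord0 mul0r.
rewrite big_ord_recr /= IH sqr_radius natrD natrM -natr1.
by field; rewrite gt_eqF //; lra.
Qed.

End disc_configuration.

(** * Field of the whole configuration *)

Section disc_fields.
Context {R : realType}.
Implicit Types (w x z : R[i]).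
Context (a : nat).
Context (a64 : (64 <= a)%N).

Notation q := (ringsize a).
Notation M := (a ^ 2)%N.
Notation rho := (@radius R a).
Notation om := (@unity_root R (ringsize a).-1).
Notation pt k i := (@disc_point R a k i).

Let om_prim : q.-primitive_root om. Proof. exact: unity_rootP. Qed.
Let ar64 : 64 <= a%:R :> R. Proof. by rewrite (ler_nat _ 64). Qed.
Let Mr : M%:R = a%:R ^+ 2 :> R. Proof. by rewrite natrX. Qed.
Let q6 : (6 <= q)%N. Proof. exact: (@ringsize_ge6 R). Qed.
Let M64 : 64 * a%:R <= a%:R ^+ 2 :> R.
Proof. by have a1 := ar64; rewrite expr2 ler_wpM2r. Qed.
Let qge : 64 * a%:R ^+ 2 <= q%:R :> R. Proof. exact: ringsize_ge. Qed.
Let rho_gt0 k : 0 < rho k. Proof. exact: radius_gt0. Qed.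
Let rho_ge0 k : 0 <= rho k. Proof. exact: radius_ge0. Qed.
Hint Resolve rho_gt0 rho_ge0 : core.

(* Contribution of the rings that [z] lies outside of; it almost vanishes in
   the unit disc because the rings mimic the uniform measure there. *)
Lemma inner_rings_field z (k0 : 'I_M) : k0%:R / a%:R ^+ 2 <= cmod z ^+ 2 ->
  (1 < cmod z ^+ 2 -> k0.+1 = M) ->
  (cmod z ^+ 2 <= 1 -> cmod z ^+ 2 <= k0.+1%:R / a%:R ^+ 2) ->
  let S := \sum_(k < M | (k < k0)%N)
     (q%:R * (cmod z ^+ 2 - 2 * rho k ^+ 2))%:C%C / z ^+ 3 in
  cmod S <= a%:R ^+ 2 * q%:R /\ (cmod z <= 1 -> cmod S <= a%:R * q%:R).
Proof.
have a1 := ar64; have M1 := M64; have q1 := qge.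
have M0 : 0 < a%:R ^+ 2 :> R by lra.
move=> h1 h2 h3 S.
have SE : cmod S = q%:R * (k0%:R * (cmod z ^+ 2 - k0%:R / a%:R ^+ 2)) / cmod z ^+ 3.
  rewrite /S -mulr_suml -(raddf_sum (real_complex R)) -mulr_sumr sum_radius //.
  by rewrite cmodM cmodV cmodX cmod_real ger0_norm // !mulr_ge0 // subr_ge0.
rewrite SE.
have [k00|k00] := posnP k0.
  by rewrite k00 mul0r mulr0 mul0r; split => *; rewrite !mulr_ge0 //; lra.
have k1 : 1 <= k0%:R :> R by rewrite ler1n.
have kM : k0%:R <= a%:R ^+ 2 :> R by rewrite -Mr ler_nat ltnW.
have t0 := cmod_ge0 z.
have at1 : 1 <= a%:R * cmod z.
  rewrite -(@ler_pXn2r _ 2) ?nnegrE ?mulr_ge0 // expr1n exprMn.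
  by rewrite ler_pdivrMr // in h1; lra.
have tgt0 : 0 < cmod z by nra.
move: (cmod z) h1 h2 h3 at1 tgt0 {t0 SE} => t h1 h2 h3 at1 t0.
(* The difference is at most 1/M and k0/M is at most t^2, so apart from q the quotient is at most
   1/t, and 1/t <= a because [k0] is positive. *)
have small : t <= 1 -> q%:R * (k0%:R * (t ^+ 2 - k0%:R / a%:R ^+ 2)) / t ^+ 3
    <= a%:R * q%:R.
  move=> t1; rewrite ler_pdivrMr ?exprn_gt0 // -[leRHS]mulrA [leRHS]mulrCA.
  rewrite ler_wpM2l //.
  have t2 : t ^+ 2 <= 1 by rewrite exprn_ile1 // ltW.
  have d1 : t ^+ 2 - k0%:R / a%:R ^+ 2 <= (a%:R ^+ 2)^-1.
    by have := h3 t2; rewrite -natr1 mulrDl mul1r; lra.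
  apply: (@le_trans _ _ (t ^+ 2)).
    by apply: le_trans h1; rewrite ler_wpM2l.
  by rewrite [t ^+ 3]exprS mulrA ler_peMl // exprn_ge0 // ltW.
split => //.
have [t1|t1] := leP t 1.
  apply: (le_trans (small t1)); rewrite ler_wpM2r //; lra.
rewrite ler_pdivrMr ?exprn_gt0 // [a%:R ^+ 2 * _]mulrC -[leRHS]mulrA ler_wpM2l //.
apply: ler_pM => //; first by rewrite subr_ge0.
apply: (@le_trans _ _ (t ^+ 2)).
  by rewrite gerBl divr_ge0 //; lra.
by rewrite [t ^+ 3]exprS ler_peMl ?exprn_ge0 // ltW.
Qed.

(** In units of the parent radius a child has radius 1/(a^2 q). Four such radii are the distance
    from which [kernelK_perturb] allows a child to be replaced by a point mass. *)
Lemma near_point_dist z k i :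
  (4 * q%:R)^-1 <= cmod ((rho k)^-1%:C%C * z - om ^+ i) ->
  4 / (a%:R ^+ 2 * q%:R) <= cmod (z - pt k i).
Proof.
move=> sep; have a1 := ar64; have q1 := qge.
have q0 : 0 < q%:R :> R by apply: lt_le_trans q1; rewrite mulr_gt0 ?exprn_gt0; lra.
rewrite disc_point_dist // cmodM cmod_real ger0_norm //.
apply: (@le_trans _ _ ((2 * a%:R)^-1 * (4 * q%:R)^-1)); last first.
  by apply: ler_pM; rewrite ?invr_ge0 ?mulr_ge0 ?radius_ge.
rewrite ler_pdivrMr; last by rewrite mulr_gt0 ?exprn_gt0; lra.
rewrite -invfM mulrC ler_pdivlMr; last by rewrite !mulr_gt0; lra.
have -> : 4 * (2 * a%:R * (4 * q%:R)) = 32 * a%:R * q%:R :> R by ring.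
by apply: ler_wpM2r; [exact: ltW|nra].
Qed.

Lemma far_point_dist z (k : 'I_M) i : cmod z <= 4 ->
  (2 * a%:R ^+ 2)^-1 <= `|cmod z ^+ 2 - rho k ^+ 2| ->
  4 / (a%:R ^+ 2 * q%:R) <= cmod (z - pt k i).
Proof.
have a1 := ar64; have M1 := M64; have q1 := qge => z4 hd.
have M0 : 0 < a%:R ^+ 2 :> R by lra.
have h5 : (2 * a%:R ^+ 2)^-1 <= 5 * cmod (z - pt k i).
  apply: (le_trans hd); apply: (le_trans (ring_dist a64 k z i)).
  by apply: ler_wpM2r; [exact: cmod_ge0|lra].
have : 1 <= 5 * cmod (z - pt k i) * (2 * a%:R ^+ 2).
  by rewrite -ler_pdivrMr ?div1r //; lra.
have := cmod_ge0 (z - pt k i); move: (cmod (z - pt k i)) => d d0 h8.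
rewrite ler_pdivrMr; last by rewrite mulr_gt0 //; lra.
apply: (@le_trans _ _ (d * (a%:R ^+ 2 * (64 * a%:R ^+ 2)))); last first.
  by do 2 (apply: ler_wpM2l => //); exact: ltW.
move: (a%:R ^+ 2) M1 h8 {q1 z4 hd h5 M0} => b M1 h8.
have b64 : 64 <= b by lra.
have db : 10^-1 <= d * b by lra.
have -> : d * (b * (64 * b)) = d * b * (64 * b) by ring.
by apply: (@le_trans _ _ (10^-1 * (64 * 64))); [lra|apply: ler_pM => //; lra].
Qed.

Lemma disc_field z : cmod z <= 4 -> exists p0 : 'I_M * 'I_q,
  [/\ forall p : 'I_M * 'I_q, p != p0 ->
        4 / (a%:R ^+ 2 * q%:R) <= cmod (z - pt p.1 p.2),
      cmod (\sum_(p : 'I_M * 'I_q | p != p0) kernelK (z - pt p.1 p.2)) <=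
        10 ^+ 5 * (a%:R ^+ 2 * q%:R),
      cmod z <= 1 ->
      cmod (\sum_(p : 'I_M * 'I_q | p != p0) kernelK (z - pt p.1 p.2)) <=
        10 ^+ 5 * (a%:R * q%:R) &
      \sum_(p : 'I_M * 'I_q | p != p0) (cmod (z - pt p.1 p.2) ^+ 2)^-1 <=
        10 ^+ 5 * (a%:R ^+ 3 * q%:R ^+ 2)].
Proof.
have a1 := ar64; have M1 := M64; have q1 := qge.
have aq0 : 0 <= a%:R * q%:R :> R by rewrite mulr_ge0.
(* The three summands are the errors of the far rings, the limit fields of the rings that z is
   outside of, and the punctured nearest ring. *)
have close_far : 2 * (a%:R * q%:R) + a%:R ^+ 2 * q%:R + 8 * 10 ^+ 4 * (a%:R * q%:R) <=
    10 ^+ 5 * (a%:R ^+ 2 * q%:R) :> R.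
  have : a%:R * q%:R <= a%:R ^+ 2 * q%:R :> R by apply: ler_wpM2r => //; lra.
  by lra.
have close_near : 2 * (a%:R * q%:R) + a%:R * q%:R + 8 * 10 ^+ 4 * (a%:R * q%:R) <=
    10 ^+ 5 * (a%:R * q%:R) :> R by lra.
have close_sqr : 6 * q%:R * a%:R ^+ 4 + 8 * 10 ^+ 3 * (a%:R ^+ 2 * q%:R ^+ 2) <=
    10 ^+ 5 * (a%:R ^+ 3 * q%:R ^+ 2) :> R.
  have e1 : 6 * q%:R * a%:R ^+ 4 <= a%:R ^+ 3 * q%:R ^+ 2 :> R.
    have -> : 6 * q%:R * a%:R ^+ 4 = (a%:R ^+ 3 * q%:R) * (6 * a%:R) :> R by ring.
    have -> : a%:R ^+ 3 * q%:R ^+ 2 = (a%:R ^+ 3 * q%:R) * q%:R :> R by ring.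
    by apply: ler_wpM2l; [rewrite mulr_ge0 ?exprn_ge0|lra].
  have e2 : a%:R ^+ 2 * q%:R ^+ 2 <= a%:R ^+ 3 * q%:R ^+ 2 :> R.
    by rewrite ler_wpM2r ?exprn_ge0 // [leRHS]exprS ler_peMl //; lra.
  have e3 : 0 <= a%:R ^+ 3 * q%:R ^+ 2 :> R by rewrite mulr_ge0 ?exprn_ge0.
  lra.
move=> z4; have t0 := cmod_ge0 z.
have M0 : 0 < a%:R ^+ 2 :> R by lra.
have aN0 : a%:R != 0 :> R by rewrite gt_eqF //; lra.
have [k0 [h1 h2 h3]] := nearest_ring a64 (exprn_ge0 2 t0).
pose w := (rho k0)^-1%:C%C * z.
(* For |z| <= 1, |z|^2 <= (k0 + 1)/M <= 2 rho^2. For 1 < |z| <= 4 the nearest ring is the last one,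
   where 2 rho^2 >= 1, so that |z|^2 <= 16 <= 32 rho^2. *)
have w6 : cmod w <= 6.
  rewrite cmod_disc_scale ler_pdivrMr // -(@ler_pXn2r _ 2) ?nnegrE ?mulr_ge0 //.
  rewrite exprMn.
  have rE : 2 * rho k0 ^+ 2 = (2 * k0%:R + 1) / a%:R ^+ 2.
    by rewrite sqr_radius natrD natrM; field.
  have [T1|T1] := leP (cmod z ^+ 2) 1.
    have := h2 T1; rewrite -natr1 => h.
    have : (k0%:R + 1) / a%:R ^+ 2 <= (2 * k0%:R + 1) / a%:R ^+ 2 :> R.
      apply: ler_wpM2r; first by rewrite invr_ge0 ltW.
      by have : 0 <= k0%:R :> R by []; lra.
    by rewrite -rE; have := sqr_ge0 (rho k0); lra.
  have kE : k0%:R + 1 = a%:R ^+ 2 :> R by rewrite natr1 (h3 T1) Mr.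
  have : 1 <= 2 * rho k0 ^+ 2 by rewrite rE ler_pdivlMr // mul1r; lra.
  have : cmod z ^+ 2 <= 16 by rewrite (_ : 16 = 4 ^+ 2); [rewrite lerXn2r ?nnegrE|ring].
  lra.
have [i0 [sep sq fld]] := punctured_ring q6 om_prim w6.
(* The field of the uniform circle: zero inside it, so only the rings below [k0] contribute. *)
pose mainF (k : 'I_M) := if (k < k0)%N then
  (q%:R * (cmod z ^+ 2 - 2 * rho k ^+ 2))%:C%C / z ^+ 3 else 0 : R[i].
have far (k : 'I_M) : k != k0 ->
   [/\ cmod (\sum_(i < q) kernelK (z - pt k i) - mainF k) <= 2 * q%:R / a%:R,
       \sum_(i < q) (cmod (z - pt k i) ^+ 2)^-1 <= 6 * q%:R * a%:R ^+ 2 &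
       (2 * a%:R ^+ 2)^-1 <= `|cmod z ^+ 2 - rho k ^+ 2|].
  move=> kk0; rewrite /mainF; case: ifPn => [lt_k|].
    have hz : rho k ^+ 2 + (2 * a%:R ^+ 2)^-1 <= cmod z ^+ 2.
      rewrite sqr_radiusD //; apply: le_trans h1.
      by apply: ler_wpM2r; [rewrite invr_ge0 ltW|rewrite ler_nat].
    have [f1 f2] := far_ring_outer a64 hz; split => //.
    by apply: le_trans (ler_norm _); rewrite lerBrDl.
  rewrite -leqNgt leq_eqVlt eq_sym (inj_eq val_inj) (negbTE kk0) /= => lt_k.
  have hz : cmod z ^+ 2 <= rho k ^+ 2 - (2 * a%:R ^+ 2)^-1.
    rewrite sqr_radiusB //.
    have T1 : cmod z ^+ 2 <= 1.
      rewrite leNgt; apply/negP => /h3 e; move: (ltn_ord k).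
      by rewrite -[X in (_ < X)%N]e ltnS leqNgt lt_k.
    apply: (le_trans (h2 T1)); by apply: ler_wpM2r; [rewrite invr_ge0 ltW|rewrite ler_nat].
  have [f1 f2] := far_ring_inner a64 hz; rewrite subr0; split => //.
  by rewrite distrC; apply: le_trans (ler_norm _); rewrite lerBrDl -lerBrDr.
exists (k0, i0).
have rV : (rho k0)^-1 <= 2 * a%:R by exact: invr_radius_le.
have near_field : cmod (\sum_(i < q | i != i0) kernelK (z - pt k0 i)) <=
    8 * 10 ^+ 4 * (a%:R * q%:R).
  rewrite sum_kernelK_ring // cmodM cmod_real ger0_norm ?invr_ge0 //.
  apply: (le_trans (ler_pM _ _ rV fld)); rewrite ?cmod_ge0 ?invr_ge0 //.
  by rewrite mulrACA; apply: ler_wpM2r; [rewrite mulr_ge0//; lra|lra].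
have fieldE : \sum_(p : 'I_M * 'I_q | p != (k0, i0)) kernelK (z - pt p.1 p.2) =
    \sum_(k | k != k0) (\sum_(i < q) kernelK (z - pt k i) - mainF k) +
    \sum_(k < M | (k < k0)%N)
      (q%:R * (cmod z ^+ 2 - 2 * rho k ^+ 2))%:C%C / z ^+ 3 +
    \sum_(i < q | i != i0) kernelK (z - pt k0 i).
  rewrite (sum_pair_split _ (fun p : 'I_M * 'I_q => kernelK (z - pt p.1 p.2))) /=.
  congr (_ + _); rewrite sumrB -[LHS]addr0 -addrA; congr (_ + _).
  rewrite addrC [X in X - _](_ : _ = \sum_(k | k != k0) mainF k) ?subrr //.
  rewrite /mainF -big_mkcondr /=; apply: eq_bigl => k.
  by case: eqVneq => [->|//]; rewrite ltnn.
have far_field : cmod (\sum_(k | k != k0)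
    (\sum_(i < q) kernelK (z - pt k i) - mainF k)) <= 2 * (a%:R * q%:R).
  apply: (le_trans (ler_cmod_sum _ _ _)).
  apply: (@le_trans _ _ (\sum_(k < M) 2 * q%:R / a%:R)).
    rewrite [leRHS](bigID (fun k => k != k0)) /= -[leLHS]addr0; apply: lerD.
      by apply: ler_sum => k /far[].
    by apply: sumr_ge0 => *; rewrite divr_ge0 // mulr_ge0.
  rewrite sumr_const card_ord -[leLHS]mulr_natl Mr le_eqVlt; apply/orP; left.
  by apply/eqP; field.
have [main1 main2] := inner_rings_field h1 h3 h2.
split.
- move=> [k i] /= ne; have [kk0|kk0] := eqVneq k k0.
    have ii0 : i != i0 by apply: contra ne => /eqP ->; rewrite kk0.
    by rewrite kk0; apply: near_point_dist; exact: sep.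
  by have [_ _ d] := far k kk0; exact: far_point_dist.
- rewrite fieldE; apply: (le_trans (ler_cmodD _ _)).
  apply: (le_trans (lerD (ler_cmodD _ _) (lexx _))).
  exact: (le_trans (lerD (lerD far_field main1) near_field)).
- move=> z1; rewrite fieldE; apply: (le_trans (ler_cmodD _ _)).
  apply: (le_trans (lerD (ler_cmodD _ _) (lexx _))).
  exact: (le_trans (lerD (lerD far_field (main2 z1)) near_field)).
rewrite (sum_pair_split _ (fun p : 'I_M * 'I_q => (cmod (z - pt p.1 p.2) ^+ 2)^-1)) /=.
have s1 : \sum_(k | k != k0) \sum_(i < q) (cmod (z - pt k i) ^+ 2)^-1 <=
    6 * q%:R * a%:R ^+ 4.
  apply: (@le_trans _ _ (\sum_(k < M) 6 * q%:R * a%:R ^+ 2)).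
    rewrite [leRHS](bigID (fun k => k != k0)) /= -[leLHS]addr0; apply: lerD.
      by apply: ler_sum => k /far[].
    by apply: sumr_ge0 => *; rewrite !mulr_ge0 //; lra.
  rewrite sumr_const card_ord -[leLHS]mulr_natl Mr le_eqVlt; apply/orP; left.
  by apply/eqP; ring.
have s2 : \sum_(i < q | i != i0) (cmod (z - pt k0 i) ^+ 2)^-1 <=
   8 * 10 ^+ 3 * (a%:R ^+ 2 * q%:R ^+ 2).
  rewrite sum_inv_sqr_ring //.
  have rV2 : rho k0 ^- 2 <= (2 * a%:R) ^+ 2.
    by rewrite -exprVn lerXn2r ?nnegrE ?invr_ge0 ?mulr_ge0.
  apply: (le_trans (ler_pM _ _ rV2 sq)); rewrite ?invr_ge0 ?sqr_ge0 //.
    by apply: sumr_ge0 => *; rewrite invr_ge0 sqr_ge0.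
  by rewrite le_eqVlt; apply/orP; left; apply/eqP; ring.
exact: (le_trans (lerD s1 s2)).
Qed.

End disc_fields.

(** * Separation and counting of the points *)

Lemma card_nat_interval (R : realType) n (A : {set 'I_n}) (L : R) :
  0 <= L -> (forall i j : 'I_n, i \in A -> j \in A -> i%:R - j%:R <= L) ->
  #|A|%:R <= L + 1.
Proof.
move=> L0 h; have [->|[j0 j0A]] := set_0Vmem A.
  by rewrite cards0 addr_ge0.
pose j1 := [arg min_(j < j0 in A) (j : nat)].
have [j1A j1min] : j1 \in A /\ forall i, i \in A -> (j1 <= i)%N.
  by rewrite /j1; case: arg_minnP => // j jA hj.
have /andP[K1 K2] := truncn_itv L0.
suff : (#|A| <= (Num.truncn L).+1)%N.
  by rewrite -(ler_nat R) => /le_trans; apply; rewrite -natr1 lerD2r.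
rewrite cardE -(size_map val) -(size_iota j1 (Num.truncn L).+1).
apply: uniq_leq_size; first by rewrite (map_inj_uniq val_inj) enum_uniq.
move=> _ /mapP[i iA ->]; rewrite mem_enum in iA; rewrite mem_iota j1min //=.
rewrite -(ltr_nat R) natrD -ltrBlDl; apply: le_lt_trans K2; exact: h.
Qed.

Section counting.
Context {R : realType}.
Implicit Types (w x z : R[i]).

(** Counting by the Poisson kernel instead of arc length: seen from (1 + b) om^i1, each counted
    point is within 2b and contributes at least 1/(4 b^2) to a sum that is at most 3q/(2b). *)
Lemma ring_count (q : nat) (om : R[i]) (i1 : 'I_q) (b : R) :
  (4 <= q)%N -> q.-primitive_root om -> q%:R^-1 <= b ->
  #|[set i : 'I_q | cmod (om ^+ i - om ^+ i1) <= b]|%:R <= 6 * q%:R * b.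
Proof.
move=> q4 om_prim qb; have q0 : (0 < q)%N by exact: leq_trans q4.
have qV0 : 0 < q%:R^-1 :> R by rewrite invr_gt0 ltr0n.
have b0 : 0 < b by lra.
pose w := (1 + b)%:C%C * om ^+ i1.
have cw : cmod w = 1 + b.
  by rewrite cmodM (cmod_prim_root q4 om_prim) mulr1 cmod_real ger0_norm; lra.
have w1 : 1 < cmod w by rewrite cw; lra.
have s2 : 2 <= cmod w ^+ q.
  by apply: (le_trans (exprn_ge2 q0)); rewrite cw lerXn2r ?nnegrE; lra.
have := sum_inv_sqr_outer q4 om_prim w1 s2.
set A := [set i | _] => h.
have : #|A|%:R * (4 * b ^+ 2)^-1 <= 3 * q%:R / (2 * b).
  apply: le_trans (le_trans h _); last first.
    apply: ler_wpM2l; first by rewrite mulr_ge0.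
    by rewrite cw lef_pV2 ?posrE; nra.
  rewrite mulr_natl -sumr_const [leRHS](bigID (mem A)) /= -[leLHS]addr0.
  apply: lerD; last by apply: sumr_ge0 => *; rewrite invr_ge0 sqr_ge0.
  apply: ler_sum => i; rewrite inE => hi.
  have d0 : 0 < cmod (w - om ^+ i).
    apply: lt_le_trans (lerB_cmod _ _); rewrite (cmod_prim_root q4 om_prim).
    by lra.
  have dle : cmod (w - om ^+ i) <= 2 * b.
    apply: (le_trans (ler_cmod_dist (om ^+ i1) _ _)).
    rewrite [cmod (_ - om ^+ i)]cmod_distC.
    have -> : w - om ^+ i1 = b%:C%C * om ^+ i1.
      by rewrite /w (rmorphD (real_complex R)) (rmorph1 (real_complex R)); ring.
    rewrite cmodM (cmod_prim_root q4 om_prim) mulr1 cmod_real (ger0_norm (ltW b0)).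
    lra.
  by rewrite lef_pV2 ?posrE ?exprn_gt0 ?mulr_gt0 //; nra.
rewrite ler_pdivrMr; last by rewrite mulr_gt0 ?exprn_gt0.
move/le_trans; apply; rewrite le_eqVlt; apply/orP; left; apply/eqP.
by field; rewrite gt_eqF.
Qed.

Context (a : nat).
Context (a64 : (64 <= a)%N).

Notation q := (ringsize a).
Notation M := (a ^ 2)%N.
Notation rho := (@radius R a).
Notation om := (@unity_root R (ringsize a).-1).
Notation pt k i := (@disc_point R a k i).

Let om_prim : q.-primitive_root om. Proof. exact: unity_rootP. Qed.
Let ar64 : 64 <= a%:R :> R. Proof. by rewrite (ler_nat _ 64). Qed.
Let Mr : M%:R = a%:R ^+ 2 :> R. Proof. by rewrite natrX. Qed.
Let q6 : (6 <= q)%N. Proof. exact: (@ringsize_ge6 R). Qed.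
Let q4 : (4 <= q)%N. Proof. exact: leq_trans q6. Qed.
Let M64 : 64 * a%:R <= a%:R ^+ 2 :> R.
Proof. by have a1 := ar64; rewrite expr2 ler_wpM2r. Qed.
Let qge : 64 * a%:R ^+ 2 <= q%:R :> R. Proof. exact: ringsize_ge. Qed.
Let rho_gt0 k : 0 < rho k. Proof. exact: radius_gt0. Qed.
Let rho_ge0 k : 0 <= rho k. Proof. exact: radius_ge0. Qed.
Hint Resolve rho_gt0 rho_ge0 : core.

Lemma radius_sep (k k' : 'I_M) : k != k' ->
  (2 * a%:R ^+ 2)^-1 <= `|rho k - rho k'|.
Proof.
have a1 := ar64; have M1 := M64.
have M0 : 0 < a%:R ^+ 2 :> R by lra.
wlog kk : k k' / (k' < k)%N.
  move=> H; rewrite neq_ltn => /orP[] h.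
    by rewrite distrC; apply: H; rewrite // neq_ltn h orbT.
  by apply: H; rewrite // neq_ltn h orbT.
move=> _; apply: le_trans (ler_norm _).
have r1 : rho k <= 1 by exact: radius_le1.
have r1' : rho k' <= 1 by exact: radius_le1.
have h : (a%:R ^+ 2)^-1 <= rho k ^+ 2 - rho k' ^+ 2.
  rewrite !sqr_radius -mulrBl -[leLHS]mul1r.
  have -> : 1 / a%:R ^+ 2 = 2 / (2 * a%:R ^+ 2) :> R by field; rewrite gt_eqF //; lra.
  apply: ler_wpM2r; first by rewrite invr_ge0; lra.
  have : k'%:R + 1 <= k%:R :> R by rewrite natr1 ler_nat.
  by rewrite !(natrD _ (2 * _)) !natrM; lra.
have : rho k ^+ 2 - rho k' ^+ 2 = (rho k - rho k') * (rho k + rho k') by ring.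
have r2 : 0 <= rho k - rho k'.
  rewrite subr_ge0 -(@ler_pXn2r _ 2) ?nnegrE // -subr_ge0; apply: le_trans h.
  by rewrite invr_ge0 ltW.
move=> e; rewrite invfM; rewrite e in h.
have := rho_ge0 k; have := rho_ge0 k'; nra.
Qed.

Lemma disc_point_sep (p p' : 'I_M * 'I_q) : p != p' ->
  (4 * a%:R * q%:R)^-1 <= cmod (pt p.1 p.2 - pt p'.1 p'.2).
Proof.
have a1 := ar64; have M1 := M64; have q1 := qge.
case: p p' => k i [k' i'] /= ne.
have [kk|kk] := eqVneq k k'.
  have ii : i != i' by apply: contra ne => /eqP ->; rewrite kk.
  rewrite kk -mulrBr cmodM cmod_real ger0_norm //.
  apply: (@le_trans _ _ ((2 * a%:R)^-1 * (2 * q%:R)^-1)); last first.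
    apply: ler_pM; rewrite ?invr_ge0 ?mulr_ge0 ?radius_ge //.
    exact: (prim_root_sep q4 om_prim).
  rewrite -invfM le_eqVlt; apply/orP; left; apply/eqP; congr (_^-1); ring.
apply: (le_trans _ (ler_dist_cmod _ _)).
rewrite !(@cmod_disc_point R a a64); apply: (le_trans _ (radius_sep kk)).
rewrite lef_pV2 ?posrE ?mulr_gt0 //; try lra.
by apply: ler_pM; lra.
Qed.

(** Linear growth within one generation; the lower bound on [tau] is the radius of a child. For
    [tau] >= 1 all points are counted; for [tau] >= 1/(16M), all points of the rings met; below that
    only one ring can be met, as rings are 1/(2M) apart, and [ring_count] applies. *)
Lemma disc_count z (tau : R) : (a%:R ^+ 2 * q%:R)^-1 <= tau ->
  #|[set p : 'I_M * 'I_q | cmod (z - pt p.1 p.2) <= tau]|%:R <=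
  30 * (a%:R ^+ 2 * q%:R * tau).
Proof.
have a1 := ar64; have M1 := M64; have q1 := qge => htau.
set S := [set p | _].
have Mq0 : 0 < a%:R ^+ 2 * q%:R :> R by rewrite mulr_gt0 //; lra.
have mt1 : 1 <= a%:R ^+ 2 * q%:R * tau by rewrite mulrC -ler_pdivrMr // div1r.
have tau0 : 0 < tau by apply: lt_le_trans htau; rewrite invr_gt0.
have [t1|t1] := leP 1 tau.
  apply: (@le_trans _ _ (a%:R ^+ 2 * q%:R)); last by nra.
  rewrite -Mr -natrM ler_nat (leq_trans (max_card _)) //.
  by rewrite card_prod !card_ord.
have [t2|t2] := leP (16 * a%:R ^+ 2)^-1 tau.
  pose A := [set k : 'I_M | `|cmod z ^+ 2 - rho k ^+ 2| <= 3 * tau].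
  have cA : #|A|%:R <= 6 * a%:R ^+ 2 * tau + 1.
    apply: card_nat_interval; first by rewrite !mulr_ge0 //; lra.
    move=> i j; rewrite !inE !ler_norml => /andP[i1 i2] /andP[j1 j2].
    have : rho i ^+ 2 - rho j ^+ 2 <= 6 * tau by lra.
    rewrite !sqr_radius -mulrBl ler_pdivrMr; last by lra.
    by rewrite !(natrD _ (2 * _)) !natrM; lra.
  apply: (@le_trans _ _ (#|A|%:R * q%:R)).
    rewrite -natrM ler_nat -[X in (_ <= _ * X)%N]card_ord -cardsT -cardsX.
    apply/subset_leq_card/fintype.subsetP => -[k i]; rewrite !inE andbT /= => h.
    have d : `|cmod z - rho k| <= tau.
      by apply: le_trans h; rewrite -{1}(@cmod_disc_point R a a64 k i) ler_dist_cmod.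
    have -> : cmod z ^+ 2 - rho k ^+ 2 = (cmod z + rho k) * (cmod z - rho k) by ring.
    rewrite normrM ger0_norm ?addr_ge0 ?cmod_ge0 //.
    apply: ler_pM => //; first by rewrite addr_ge0 ?cmod_ge0.
    have := @radius_le1 R a a64 k; move: d; rewrite ler_norml => /andP[_ d].
    by move=> r1; lra.
  have m16 : 1 <= tau * (16 * a%:R ^+ 2) by rewrite -ler_pdivrMr ?div1r //; lra.
  apply: (@le_trans _ _ ((6 * a%:R ^+ 2 * tau + 1) * q%:R)).
    by apply: ler_wpM2r.
  have -> : 30 * (a%:R ^+ 2 * q%:R * tau) = (30 * a%:R ^+ 2 * tau) * q%:R by ring.
  by apply: ler_wpM2r => //; lra.
have [->|[[k1 i1] p1S]] := set_0Vmem S.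
  by rewrite cards0 mulr_ge0 // !mulr_ge0 //; lra.
have p1h : cmod (z - pt k1 i1) <= tau by move: p1S; rewrite inE.
(* Two counted points are within 2 [tau], which becomes 4 a [tau] on the unit circle as 1/rho <= 2a;
   1/q is added to meet the hypothesis of [ring_count]. *)
pose b := 4 * a%:R * tau + q%:R^-1.
have qV0 : 0 < q%:R^-1 :> R by rewrite invr_gt0; lra.
have cB := @ring_count q om i1 b q4 om_prim.
apply: (@le_trans _ _ (6 * q%:R * b)); last first.
  have -> : 6 * q%:R * b = 24 * a%:R * q%:R * tau + 6.
    by rewrite /b; field; rewrite gt_eqF //; lra.
  have : a%:R * (q%:R * tau) <= a%:R ^+ 2 * (q%:R * tau).
    by apply: ler_wpM2r; rewrite ?mulr_ge0 //; lra.
  by lra.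
apply: le_trans (cB _); last by rewrite /b lerDr !mulr_ge0 //; lra.
have pair_inj : injective (fun i : 'I_q => (k1, i)) by move=> i j [].
rewrite ler_nat -(card_imset _ pair_inj).
apply/subset_leq_card/fintype.subsetP => -[k i]; rewrite inE /= => h.
have d2 : cmod (pt k i - pt k1 i1) <= 2 * tau.
  apply: (le_trans (ler_cmod_dist z _ _)).
  by rewrite [cmod (pt k i - z)]cmod_distC; lra.
have kk : k = k1.
  apply/eqP/negPn/negP => /radius_sep.
  rewrite leNgt => /negP; apply; apply: (@le_lt_trans _ _ (2 * tau)).
    have := ler_dist_cmod (pt k i) (pt k1 i1).
    by rewrite !(@cmod_disc_point R a a64) => /le_trans; exact.
  have -> : (2 * a%:R ^+ 2)^-1 = 8 * (16 * a%:R ^+ 2)^-1 :> R.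
    by field; rewrite gt_eqF //; lra.
  by lra.
rewrite kk; apply/imsetP; exists i => //; rewrite inE.
move: d2; rewrite kk -mulrBr cmodM cmod_real ger0_norm // => d2.
have rV := @invr_radius_le R a a64 k1.
have : (rho k1)^-1 * (rho k1 * cmod (om ^+ i - om ^+ i1)) <= 2 * a%:R * (2 * tau).
  by apply: ler_pM; rewrite ?invr_ge0 ?mulr_ge0 ?cmod_ge0.
by rewrite mulKf ?gt_eqF // /b; lra.
Qed.

End counting.

(** * The tree of discs *)

Section tree.
Context {R : realType}.
Implicit Types (w x y z : R[i]).

(** Doubling makes the errors 1/side a geometric series and the ratio of gap to radius unbounded.
    The offset 8 gives side >= 64 and the numerical room needed in [center_sep]. *)
Definition side n : nat := (2 ^ (n + 8))%N.

Definition branching n : nat := (side n ^ 2 * ringsize (side n))%N.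

Fixpoint population n : nat :=
  if n is n'.+1 then (population n' * branching n')%N else 1%N.

Definition scale n : R := (population n)%:R^-1.

(* The disc of generation [n] and index [k] has mass and radius [scale n]; its
   descendants stay within [2 * scale n] of its centre. *)
Fixpoint center n (k : nat) : R[i] :=
  if n is n'.+1 then
    center n' (k %/ branching n') + (scale n')%:C%C *
      disc_point (side n') (k %% branching n' %/ ringsize (side n'))
                           (k %% branching n' %% ringsize (side n'))
  else 0.

Notation ringi n := 'I_(ringsize (side n)).
Notation child n := ('I_(side n ^ 2) * ringi n)%type.

Definition child_index n (i : nat) (p : child n) : nat :=
  (i * branching n + (p.1 * ringsize (side n) + p.2))%N.

Lemma side_ge64 n : (64 <= side n)%N.
Proof. by rewrite /side (@leq_trans (2 ^ 6)) // leq_exp2l // addnS ltnW // !addnS !ltnS. Qed.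

Lemma ringsize_gt0 n : (0 < ringsize n)%N. Proof. by []. Qed.

Lemma branching_gt0 n : (0 < branching n)%N.
Proof. by rewrite muln_gt0 ringsize_gt0 expn_gt0 /side expn_gt0. Qed.

Lemma population_gt0 n : (0 < population n)%N.
Proof. by elim: n => //= n IH; rewrite muln_gt0 IH branching_gt0. Qed.

Lemma scale_gt0 n : 0 < scale n.
Proof. by rewrite invr_gt0 ltr0n population_gt0. Qed.

Lemma scaleS n : scale n = (branching n)%:R * scale n.+1.
Proof.
rewrite /scale /= natrM invfM mulrCA divff ?mulr1 // pnatr_eq0 -lt0n.
exact: branching_gt0.
Qed.

Lemma branchingE n :
  (branching n)%:R = (side n)%:R ^+ 2 * (ringsize (side n))%:R :> R.
Proof. by rewrite /branching natrM natrX. Qed.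

Lemma sideE n : (side n)%:R = 2 ^+ (n + 8) :> R.
Proof. by rewrite /side natrX. Qed.

Lemma branching_ge n : 64 * 2 ^+ n <= (branching n)%:R :> R.
Proof.
rewrite branchingE.
have h := @ringsize_ge R _ (side_ge64 n).
have s1 : 64 <= (side n)%:R :> R by rewrite (ler_nat _ 64) side_ge64.
have s2 : 2 ^+ n <= (side n)%:R :> R.
  by rewrite sideE ler_weXn2l ?leq_addr // ler1n.
have s3 : 1 <= (side n)%:R ^+ 2 :> R by rewrite exprn_ege1 //; lra.
have s4 : (side n)%:R <= (side n)%:R ^+ 2 :> R by nra.
apply: (@le_trans _ _ (ringsize (side n))%:R); first lra.
by rewrite ler_peMl.
Qed.

Lemma child_index_lt n i (p : child n) : (i < population n)%N ->
  (child_index i p < population n.+1)%N.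
Proof.
move=> iN; apply: (@leq_trans (i.+1 * branching n)); last first.
  by rewrite /= leq_mul2r iN orbT.
rewrite /child_index mulSn addnC ltn_add2r /branching.
have : (p.1 * ringsize (side n) + p.2 < p.1.+1 * ringsize (side n))%N.
  by rewrite mulSn addnC ltn_add2r.
by move/leq_trans; apply; rewrite leq_mul2r ltn_ord orbT.
Qed.


Lemma center_child n i (p : child n) :
  center n.+1 (child_index i p) =
  center n i + (scale n)%:C%C * disc_point (side n) p.1 p.2.
Proof.
have lt : (p.1 * ringsize (side n) + p.2 < branching n)%N.
  have : (p.1 * ringsize (side n) + p.2 < p.1.+1 * ringsize (side n))%N.
    by rewrite mulSn addnC ltn_add2r.
  by move/leq_trans; apply; rewrite leq_mul2r ltn_ord orbT.
rewrite /child_index /=; move: lt; set l := (_ + p.2)%N => lt.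
rewrite divnMDl ?branching_gt0 // (divn_small lt) addn0.
rewrite modnMDl (modn_small lt) /l.
rewrite divnMDl ?ringsize_gt0 // (divn_small (ltn_ord _)) addn0.
by rewrite modnMDl (modn_small (ltn_ord _)).
Qed.

Lemma child_index_surj n l :
  exists p : child n, l = child_index (l %/ branching n) p.
Proof.
have m0 := branching_gt0 n; have q0 := ringsize_gt0 (side n).
have h1 : (l %% branching n %/ ringsize (side n) < side n ^ 2)%N.
  by rewrite ltn_divLR // ltn_mod.
have h2 : (l %% branching n %% ringsize (side n) < ringsize (side n))%N.
  by rewrite ltn_mod.
by exists (Ordinal h1, Ordinal h2); rewrite /child_index /= -divn_eq -divn_eq.
Qed.

(** Extends bounds on the centres to addresses out of range, which occur for times outside [0,
    1). *)
Lemma center_mod n k : center n k = center n (k %% population n).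
Proof.
elim: n k => //= n IH k; rewrite -modn_divl -IH.
have -> // : (k %% (population n * branching n) %% branching n = k %% branching n)%N.
by rewrite modn_dvdm // dvdn_mull.
Qed.

Lemma sum_nat_mul (V : zmodType) (m k : nat) (F : nat -> V) :
  \sum_(0 <= l < m * k) F l = \sum_(i < m) \sum_(j < k) F (i * k + j)%N.
Proof.
rewrite big_nat_mul big_mkord; apply: eq_bigr => i _.
rewrite -{1}[(i * k)%N]add0n big_addn mulSn addnK big_mkord.
by apply: eq_bigr => j _; rewrite addnC.
Qed.

Lemma sum_child_index (V : zmodType) n (F : nat -> V) :
  \sum_(0 <= i < population n) \sum_(p : child n) F (child_index i p) =
  \sum_(0 <= k < population n.+1) F k.
Proof.
rewrite /= sum_nat_mul big_mkord; apply: eq_bigr => i _.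
rewrite -(pair_bigA _ (fun (k : 'I_(side n ^ 2)) (j : ringi n) =>
  F (child_index i (k, j)))) /=.
rewrite -(big_mkord predT (fun l => F (i * branching n + l)%N)) sum_nat_mul.
by [].
Qed.

Lemma card_child n : #|{: child n}| = branching n.
Proof. by rewrite card_prod !card_ord. Qed.

(* Field of the part of the generation [h + j] approximation of the measure that
   descends from the disc [i] of generation [j]. *)
Fixpoint subtree_field h j i z : R[i] :=
  if h is h'.+1 then
    \sum_(p : child j) subtree_field h' j.+1 (child_index i p) z
  else (scale j)%:C%C * kernelK (z - center j i).

Lemma sum_subtree_field h j z :
  \sum_(0 <= i < population j) subtree_field h j i z =
  \sum_(0 <= k < population (h + j)) (scale (h + j))%:C%C *
     kernelK (z - center (h + j) k).
Proof.
elim: h j => // h IH j; rewrite addSnnS -IH.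
by rewrite -(@sum_child_index _ j (fun k => subtree_field h j.+1 k z)).
Qed.

Lemma center_child_le n i (p : child n) :
  cmod (center n.+1 (child_index i p) - center n i) <= scale n.
Proof.
rewrite center_child [_ - center n i]addrC addKr cmodM cmod_real.
rewrite ger0_norm ?(ltW (scale_gt0 n)) // (@cmod_disc_point R _ (side_ge64 n)).
rewrite -[leRHS]mulr1 ler_wpM2l ?(ltW (scale_gt0 n)) //.
exact: (radius_le1 (side_ge64 n)).
Qed.

Lemma scale_double n : 2 * scale n.+1 <= scale n.
Proof.
rewrite [scale n]scaleS; apply: ler_wpM2r; first exact: ltW (scale_gt0 _).
apply: le_trans (branching_ge n).
by have : 1 <= 2 ^+ n :> R; [rewrite exprn_ege1 // ler1n|lra].
Qed.

(** The enlargement by 2 survives the descent because scale j + 2 scale (j+1) <= 2 scale j. [kap]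
    will be the kernel at the centre, to replace a subtree by a point mass, or 0, to bound its
    field. *)
Lemma subtree_field_approx h j i z (kap : R[i]) (e : R) :
  (forall y, cmod (y - center j i) <= 2 * scale j ->
     cmod (kernelK (z - y) - kap) <= e) ->
  cmod (subtree_field h j i z - (scale j)%:C%C * kap) <= scale j * e.
Proof.
elim: h j i => [|h IH] j i H /=.
  rewrite -mulrBr cmodM cmod_real ger0_norm ?(ltW (scale_gt0 j)) //.
  rewrite ler_wpM2l ?(ltW (scale_gt0 j)) // H // subrr cmod0.
  by rewrite mulr_ge0 // (ltW (scale_gt0 j)).
have -> : (scale j)%:C%C * kap = \sum_(p : child j) (scale j.+1)%:C%C * kap.
  rewrite sumr_const card_child -[RHS]mulr_natl mulrA [scale j]scaleS.
  by rewrite (rmorphM (real_complex R)) (rmorph_nat (real_complex R)).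
rewrite -sumrB; apply: (le_trans (ler_cmod_sum _ _ _)).
apply: (@le_trans _ _ (\sum_(p : child j) scale j.+1 * e)); last first.
  by rewrite sumr_const card_child -[leLHS]mulr_natl mulrA -scaleS.
apply: ler_sum => p _; apply: IH => y hy; apply: H.
apply: (le_trans (ler_cmod_dist (center j.+1 (child_index i p)) _ _)).
have := center_child_le i p; have := scale_double j; lra.
Qed.

Lemma kernelK_perturb z c y (s : R) : 0 < s -> 4 * s <= cmod (z - c) ->
  cmod (y - c) <= 2 * s ->
  cmod (kernelK (z - y) - kernelK (z - c)) <= 8 * s / cmod (z - c) ^+ 2.
Proof.
move=> s0 hc hy.
have zy : cmod (z - c) / 2 <= cmod (z - y).
  have -> : z - y = (z - c) - (y - c) by ring.
  by apply: le_trans (lerB_cmod _ _); lra.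
have d0 : 0 < cmod (z - c) by lra.
have y0 : 0 < cmod (z - y) by lra.
rewrite cmod_distC; apply: (le_trans (kernelK_lipschitz _ _)).
- by rewrite -cmod_gt0.
- by rewrite -cmod_gt0.
have -> : z - c - (z - y) = y - c by ring.
have -> : 8 * s / cmod (z - c) ^+ 2 = (2 * s) * (4 / cmod (z - c) ^+ 2) by ring.
apply: ler_pM; rewrite ?cmod_ge0 //.
  by rewrite addr_ge0 // ?invr_ge0 ?mulr_ge0 ?invr_ge0 ?exprn_ge0 ?cmod_ge0.
have -> : 4 / cmod (z - c) ^+ 2 = 2 / cmod (z - c) ^+ 2 + 2 / cmod (z - c) ^+ 2.
  by rewrite -mulrDl; congr (_ / _); ring.
rewrite lerD2l; have -> : 2 / cmod (z - c) ^+ 2 = (cmod (z - c) * (cmod (z - c) / 2))^-1.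
  by field; rewrite gt_eqF.
by rewrite lef_pV2 ?posrE ?mulr_gt0 ?divr_gt0 // ler_wpM2l // ltW.
Qed.

(** [S0] has a point mass in place of each sibling; rescaled to the unit disc it is the field of
    [disc_field] divided by a^2 q. The replacement costs 8 (a^2 q)^-2 times the inverse-square sum,
    at most 8 10^5 / a. *)
Lemma siblings_field h j i z : cmod (z - center j i) <= 4 * scale j ->
  exists p0 : child j,
  let S := \sum_(p : child j | p != p0)
     subtree_field h j.+1 (child_index i p) z in
  cmod S <= 9 * 10 ^+ 5 /\
  (cmod (z - center j i) <= scale j -> cmod S <= 9 * 10 ^+ 5 / (side j)%:R).
Proof.
move=> hz.
set a := side j; set q := ringsize a.
have a64 : (64 <= a)%N by exact: side_ge64.
have a1 : 64 <= a%:R :> R by rewrite (ler_nat _ 64).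
have r0 := scale_gt0 j; have s0 := scale_gt0 j.+1.
have q1 : 64 * a%:R ^+ 2 <= q%:R :> R by exact: ringsize_ge.
have q0 : 0 < q%:R :> R by rewrite ltr0n.
have m0 : 0 < a%:R ^+ 2 * q%:R :> R by rewrite mulr_gt0 // exprn_gt0; lra.
have sE : scale j = a%:R ^+ 2 * q%:R * scale j.+1 by rewrite scaleS branchingE.
pose Z := (scale j)^-1%:C%C * (z - center j i).
have cZ : cmod Z = cmod (z - center j i) / scale j.
  by rewrite cmodM cmod_real mulrC ger0_norm // invr_ge0 ltW.
have Z4 : cmod Z <= 4 by rewrite cZ ler_pdivrMr.
have [p0 [sep f1 f2 sq]] := disc_field a64 Z4.
exists p0 => S.
have rZ : (scale j)%:C%C * Z = z - center j i.
  rewrite /Z mulrA -(rmorphM (real_complex R)) divff ?gt_eqF //.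
  by rewrite (rmorph1 (real_complex R)) mul1r.
have dE (p : child j) : z - center j.+1 (child_index i p) =
    (scale j)%:C%C * (Z - disc_point a p.1 p.2).
  by rewrite center_child mulrBr rZ; ring.
have dE' (p : child j) : cmod (z - center j.+1 (child_index i p)) =
    scale j * cmod (Z - disc_point a p.1 p.2).
  by rewrite dE cmodM cmod_real ger0_norm // ltW.
pose S0 := \sum_(p : child j | p != p0)
  (scale j.+1)%:C%C * kernelK (z - center j.+1 (child_index i p)).
have S0E : cmod S0 = (a%:R ^+ 2 * q%:R)^-1 *
   cmod (\sum_(p : child j | p != p0) kernelK (Z - disc_point a p.1 p.2)).
  have -> : S0 = ((a%:R ^+ 2 * q%:R)^-1)%:C%C *
      \sum_(p : child j | p != p0) kernelK (Z - disc_point a p.1 p.2).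
    rewrite mulr_sumr; apply: eq_bigr => p _.
    rewrite dE kernelK_scale mulrA -(rmorphM (real_complex R)).
    congr (_%:C%C * _); rewrite sE; field.
    by rewrite (gt_eqF s0) (gt_eqF q0) gt_eqF //; lra.
  by rewrite cmodM cmod_real ger0_norm // invr_ge0 ltW.
have err : cmod (S - S0) <= 8 * 10 ^+ 5 / a%:R.
  rewrite /S /S0 -sumrB; apply: (le_trans (ler_cmod_sum _ _ _)).
  apply: (@le_trans _ _ (\sum_(p : child j | p != p0)
     8 * (a%:R ^+ 2 * q%:R) ^- 2 * (cmod (Z - disc_point a p.1 p.2) ^+ 2)^-1)).
    apply: ler_sum => p /sep hp.
    have h4 : 4 * scale j.+1 <= cmod (z - center j.+1 (child_index i p)).
      rewrite dE' sE; rewrite ler_pdivrMr // in hp.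
      have -> : a%:R ^+ 2 * q%:R * scale j.+1 * cmod (Z - disc_point a p.1 p.2) =
        (cmod (Z - disc_point a p.1 p.2) * (a%:R ^+ 2 * q%:R)) * scale j.+1 by ring.
      by apply: ler_wpM2r => //; exact: ltW.
    have Zp0 : 0 < cmod (Z - disc_point a p.1 p.2).
      by apply: lt_le_trans hp; rewrite divr_gt0.
    apply: (le_trans (subtree_field_approx _ (fun y hy => kernelK_perturb s0 h4 hy))).
    rewrite dE' le_eqVlt; apply/orP; left; apply/eqP; rewrite sE.
    by field; rewrite (gt_eqF s0) (gt_eqF q0) (gt_eqF Zp0) gt_eqF //; lra.
  rewrite -mulr_sumr.
  apply: (@le_trans _ _ (8 * (a%:R ^+ 2 * q%:R) ^- 2 * (10 ^+ 5 * (a%:R ^+ 3 * q%:R ^+ 2)))).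
    by apply: ler_wpM2l; rewrite ?mulr_ge0 ?invr_ge0 ?exprn_ge0 // ltW.
  rewrite le_eqVlt; apply/orP; left; apply/eqP.
  by field; rewrite (gt_eqF q0) gt_eqF //; lra.
have SS0 : cmod S <= cmod S0 + 8 * 10 ^+ 5 / a%:R.
  by rewrite -{1}(subrK S0 S) addrC; apply: (le_trans (ler_cmodD _ _)); rewrite lerD2l.
have aV : a%:R^-1 <= 1 :> R by rewrite invf_le1; lra.
split.
  apply: (le_trans SS0); have : cmod S0 <= 10 ^+ 5.
    by rewrite S0E ler_pdivrMl // mulrC.
  by lra.
move=> hz1; apply: (le_trans SS0).
have : cmod S0 <= 10 ^+ 5 / a%:R.
  rewrite S0E ler_pdivrMl //; apply: le_trans (f2 _) _.
    by rewrite cZ ler_pdivrMr // mul1r.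
  rewrite le_eqVlt; apply/orP; left; apply/eqP.
  by field; rewrite gt_eqF //; lra.
by lra.
Qed.

Lemma subtree_field_far h j i z : 4 * scale j <= cmod (z - center j i) ->
  cmod (subtree_field h j i z) <= 1.
Proof.
move=> hz; have s0 := scale_gt0 j.
have H y : cmod (y - center j i) <= 2 * scale j ->
    cmod (kernelK (z - y) - 0) <= (2 * scale j)^-1.
  move=> hy; rewrite subr0 cmod_kernelK.
  have hd : 2 * scale j <= cmod (z - y).
    have -> : z - y = (z - center j i) - (y - center j i) by ring.
    by apply: le_trans (lerB_cmod _ _); lra.
  by rewrite lef_pV2 ?posrE; lra.
have := @subtree_field_approx h j i z 0 _ H; rewrite mulr0 subr0 => /le_trans; apply.
have -> : scale j * (2 * scale j)^-1 = 2^-1 by field; rewrite gt_eqF.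
lra.
Qed.

(** Descend while z is within four radii of the exceptional child: z is then in the parent disc and
    the siblings cost O(1/side j). The term 10^6 pays for the generation where the descent stops,
    and 2 10^6 2^-j for the geometric tail. *)
Lemma subtree_field_near h j i z : (i < population j)%N ->
  cmod (z - center j i) <= 4 * scale j ->
  (forall k, (k < population (h + j))%N ->
     scale (h + j) <= cmod (z - center (h + j) k)) ->
  cmod (subtree_field h j i z) <= 10 ^+ 6 + 2 * 10 ^+ 6 * 2 ^- j.
Proof.
elim: h j i => [|h IH] j i iN hz leaves.
  have := leaves i iN; rewrite add0n => hi.
  rewrite /= cmodM cmod_real ger0_norm ?(ltW (scale_gt0 j)) // cmod_kernelK.
  apply: (@le_trans _ _ 1).
    by rewrite ler_pdivrMr ?mul1r // (lt_le_trans (scale_gt0 j) hi).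
  have : 0 <= 2 ^- j :> R by rewrite invr_ge0 exprn_ge0.
  by lra.
rewrite /=; have [p0 [far near]] := siblings_field h hz.
rewrite (bigD1 p0) //=; apply: (le_trans (ler_cmodD _ _)).
have j0 : 0 <= 2 ^- j :> R by rewrite invr_ge0 exprn_ge0.
have s0 : 0 < scale j.+1 :> R := scale_gt0 j.+1.
have [own|own] := leP (cmod (z - center j.+1 (child_index i p0))) (4 * scale j.+1).
  have hz1 : cmod (z - center j i) <= scale j.
    apply: (le_trans (ler_cmod_dist (center j.+1 (child_index i p0)) _ _)).
    rewrite center_child [_ - center j i]addrC addKr cmodM cmod_real.
    rewrite ger0_norm ?(ltW (scale_gt0 j)) // (@cmod_disc_point R _ (side_ge64 j)).
    have rl := @radius_le R _ (side_ge64 j) p0.1.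
    have a1 : 64 <= (side j)%:R :> R by rewrite (ler_nat _ 64) side_ge64.
    have q1 := @ringsize_ge R _ (side_ge64 j).
    have M0 : 0 < (side j)%:R ^+ 2 :> R by rewrite exprn_gt0; lra.
    have : scale j * radius (side j) p0.1 <=
        scale j * (1 - (4 * (side j)%:R ^+ 2)^-1).
      by apply: ler_wpM2l => //; exact: ltW (scale_gt0 j).
    have : 4 * scale j.+1 <= scale j * (4 * (side j)%:R ^+ 2)^-1 :> R.
      rewrite ler_pdivlMr; last by rewrite mulr_gt0.
      rewrite [scale j]scaleS branchingE.
      have -> : 4 * scale j.+1 * (4 * (side j)%:R ^+ 2) =
        (16 * (side j)%:R ^+ 2) * scale j.+1 by ring.
      apply: ler_wpM2r; first exact: ltW.
      have q16 : 16 <= (ringsize (side j))%:R :> R by nra.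
      by nra.
    by move: (own); rewrite center_child; lra.
  have := IH j.+1 _ (child_index_lt p0 iN) own.
  rewrite addnS => /(_ leaves) h1; apply: (le_trans (lerD h1 (near hz1))).
  have -> : 2 ^- j.+1 = 2^-1 * 2 ^- j :> R by rewrite exprS invfM.
  have -> : (side j)%:R^-1 = 2 ^- 8 * 2 ^- j :> R.
    by rewrite sideE exprD invfM mulrC.
  have : 9 * 10 ^+ 5 * (2 ^- 8 * 2 ^- j) <= 10 ^+ 6 * 2 ^- j :> R.
    by rewrite mulrA; apply: ler_wpM2r => //; lra.
  lra.
apply: (le_trans (lerD (subtree_field_far h (ltW own)) far)).
lra.
Qed.

Lemma tree_field_bound n z :
  (forall k, (k < population n)%N -> scale n <= cmod (z - center n k)) ->
  cmod (\sum_(0 <= k < population n) (scale n)%:C%C * kernelK (z - center n k))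
  <= 10 ^+ 7.
Proof.
move=> leaves; have := sum_subtree_field n 0 z; rewrite addn0 => <-.
rewrite big_nat1.
have [z4|z4] := leP (cmod (z - center 0 0)) (4 * scale 0).
  apply: (le_trans (@subtree_field_near n 0 0 z _ z4 _)) => //.
    by rewrite addn0.
  by rewrite expr0 invr1; lra.
by apply: (le_trans (subtree_field_far n (ltW z4))); lra.
Qed.

(* Gaps exceed radii by an unbounded factor: this is what kills rectifiable
   curves in the limit. *)
Lemma center_sep n k k' : (k < population n)%N -> (k' < population n)%N ->
  k != k' -> 2 ^+ (n + 4) * scale n <= cmod (center n k - center n k').
Proof.
elim: n k k' => [|n IH] k k'; first by rewrite !ltnS !leqn0 => /eqP -> /eqP ->.
move=> kN k'N kk'.
have idx l : (l < population n.+1)%N -> exists i (p : child n),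
    (i < population n)%N /\ l = child_index i p.
  move=> lN; have [p lE] := child_index_surj n l.
  by exists (l %/ branching n)%N, p; rewrite ltn_divLR ?branching_gt0.
have [i [p [iN kE]]] := idx k kN; have [i' [p' [i'N k'E]]] := idx k' k'N.
have r0 : 0 < scale n :> R := scale_gt0 n.
have s0 : 0 < scale n.+1 :> R := scale_gt0 n.+1.
have rE : scale n = _ :> R := scaleS n; have bg : _ <= _ :> R := branching_ge n.
have t1 : 1 <= 2 ^+ n :> R by rewrite exprn_ege1 // ler1n.
have tE : 2 ^+ (n.+1 + 4) = 2 ^+ 5 * 2 ^+ n :> R by rewrite -exprD addSn addnC.
have [ii|ii] := eqVneq i i'.
  have pp : p != p' by apply: contra kk' => /eqP e; rewrite kE k'E ii e.
  rewrite kE k'E !center_child ii.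
  have -> : center n i' + (scale n)%:C%C * disc_point (side n) p.1 p.2 -
    (center n i' + (scale n)%:C%C * disc_point (side n) p'.1 p'.2) =
    (scale n)%:C%C * (disc_point (side n) p.1 p.2 - disc_point (side n) p'.1 p'.2).
    by ring.
  rewrite cmodM cmod_real ger0_norm ?(ltW r0) //.
  have a1 : 64 <= (side n)%:R :> R by rewrite (ler_nat _ 64) side_ge64.
  have q0 : 0 < (ringsize (side n))%:R :> R by rewrite ltr0n.
  have := @disc_point_sep R _ (side_ge64 n) p p' pp.
  move/(ler_wpM2l (ltW r0)); apply: le_trans.
  rewrite ler_pdivlMr; last by rewrite !mulr_gt0 //; lra.
  rewrite rE branchingE tE.
  have -> : 2 ^+ 5 * 2 ^+ n * scale n.+1 * (4 * (side n)%:R * (ringsize (side n))%:R) =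
     (2 ^+ 5 * 2 ^+ n * 4) * ((side n)%:R * (ringsize (side n))%:R * scale n.+1) by ring.
  have -> : (side n)%:R ^+ 2 * (ringsize (side n))%:R * scale n.+1 =
     (side n)%:R * ((side n)%:R * (ringsize (side n))%:R * scale n.+1) by ring.
  apply: ler_wpM2r; first by rewrite !mulr_ge0 // ltW.
  by rewrite sideE exprD; lra.
(* Distinct parents are at least 16 scale n apart and each child is within scale n of its parent, so
   more than scale n remains, and scale n is branching n times the new scale. *)
have := IH i i' iN i'N ii.
have c1 := center_child_le i p; have c2 := center_child_le i' p'.
rewrite -kE in c1; rewrite -k'E in c2.
have tri : cmod (center n i - center n i') <=
    scale n + cmod (center n.+1 k - center n.+1 k') + scale n.
  have d1 := ler_cmod_dist (center n.+1 k) (center n i) (center n i').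
  have d2 := ler_cmod_dist (center n.+1 k') (center n.+1 k) (center n i').
  by rewrite [cmod (center n i - center n.+1 k)]cmod_distC in d1; lra.
rewrite exprD => h.
have : scale n <= cmod (center n.+1 k - center n.+1 k').
  move: h tri; move: (2 ^+ n) t1 => t t1; nra.
apply: le_trans; rewrite tE rE; apply: ler_wpM2r; first exact: ltW.
lra.
Qed.

End tree.

Local Open Scope classical_set_scope.

(** * The measure *)

Section measure_construction.
Context {R : realType}.
Implicit Types (t : R) (n k : nat).

(* The time interval [0, 1) is cut into [population n] equal intervals, one for
   each disc of generation [n]; the limit measure is the law of [param]. *)
Definition address n t : nat := Num.truncn ((population n)%:R * t).

Definition approx n t : R[i] := center n (address n t).

Lemma address_div n t : (address n.+1 t %/ branching n)%N = address n t.
Proof.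
rewrite /address /=; have m0 := branching_gt0 n; have N0 := population_gt0 n.
have [t0|t0] := leP 0 t; last first.
  (* Truncation sends negative reals to 0, so for negative times every address is 0. *)
  have small m : Num.truncn (m%:R * t) = 0%N.
    apply/eqP; rewrite -leqn0 truncn_le_nat.
    by apply: (@le_lt_trans _ _ 0) => //; rewrite mulr_ge0_le0 // ltW.
  by rewrite !small div0n.
apply/esym/truncn_def.
have Nt0 m : 0 <= m%:R * t by rewrite mulr_ge0.
have /andP[] := truncn_itv (Nt0 (population n * branching n)%N).
set k := Num.truncn _ => k1 k2.
have M0 : 0 < (branching n)%:R :> R by rewrite ltr0n.
have E : (population n * branching n)%:R * t = (population n)%:R * t * (branching n)%:R.
  by rewrite natrM mulrAC.
rewrite E in k1 k2; apply/andP; split.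
  rewrite -(ler_pM2r M0) -natrM; apply: le_trans k1.
  by rewrite ler_nat leq_trunc_div.
rewrite -(ltr_pM2r M0) -natrM; apply: (lt_le_trans k2).
by rewrite ler_nat ltn_ceil.
Qed.

Lemma approx_step n t : cmod (approx n.+1 t - approx n t) <= scale n.
Proof.
have [p E] := child_index_surj n (address n.+1 t).
by rewrite /approx [in center n.+1 _]E address_div center_child_le.
Qed.

Lemma scale_le n : scale n <= 2^-1 ^+ n :> R.
Proof.
elim: n => [|n IH]; first by rewrite expr0 /scale /= invr1.
by rewrite exprS; have := @scale_double R n; lra.
Qed.

Lemma scale_cvg0 : (scale n : R) @[n --> \oo] --> (0 : R).
Proof.
apply: (@squeeze_cvgr _ _ _ _ (fun=> 0) (fun n => (2^-1 : R) ^+ n)).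
- by near=> n; rewrite ltW ?scale_gt0 //= scale_le.
- exact: cvg_cst.
- by apply: cvg_expr; rewrite ger0_norm // invf_lt1 // ltr1n.
Unshelve. all: end_near. Qed.

Section coordinate.
Context (t : R) (f : R[i] -> R).
Context (f_lip : forall x y, `|f x - f y| <= cmod (x - y)).

(** Nested intervals: a step moves the midpoint by at most scale n, while the half-width shrinks by
    2 scale n - 2 scale (n+1) >= scale n. *)
Let lower n := f (approx n t) - 2 * scale n.
Let upper n := f (approx n t) + 2 * scale n.

Let lower_nd : nondecreasing_seq lower.
Proof.
apply/nondecreasing_seqP => n; rewrite /lower.
have := le_trans (f_lip _ _) (approx_step n t); rewrite ler_norml => /andP[h1 h2].
have := @scale_double R n; lra.
Qed.

Let upper_ni : nonincreasing_seq upper.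
Proof.
apply/nonincreasing_seqP => n; rewrite /upper.
have := le_trans (f_lip _ _) (approx_step n t); rewrite ler_norml => /andP[h1 h2].
have := @scale_double R n; lra.
Qed.

Let lower_le_upper m n : lower m <= upper n.
Proof.
apply: (@le_trans _ _ (lower (maxn m n))); first by apply: lower_nd; exact: leq_maxl.
apply: (@le_trans _ _ (upper (maxn m n))); last by apply: upper_ni; exact: leq_maxr.
by rewrite /lower /upper; have := @scale_gt0 R (maxn m n); lra.
Qed.

Let scale2_cvg0 : (2 * scale n : R) @[n --> \oo] --> (0 : R).
Proof.
by rewrite -[X in _ --> X](mulr0 2); apply: cvgM; [exact: cvg_cst|exact: scale_cvg0].
Qed.

Lemma coordinate_cvg : cvgn (fun n => f (approx n t)).
Proof.
have cl : cvgn lower.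
  apply: nondecreasing_is_cvgn => //; exists (upper 0%N) => _ [n _ <-].
  exact: lower_le_upper.
have -> : (fun n => f (approx n t)) = lower \+ (fun n => 2 * scale n).
  by apply/funext => n; rewrite /lower /= subrK.
by apply: is_cvgD => //; apply/cvg_ex; exists 0; exact: scale2_cvg0.
Qed.

Lemma coordinate_lim n :
  `|limn (fun m => f (approx m t)) - f (approx n t)| <= 2 * scale n.
Proof.
rewrite ler_distl; apply/andP; split.
  apply: limr_ge; first exact: coordinate_cvg.
  near=> m; apply: (@le_trans _ _ (lower m)).
    by apply: lower_nd; near: m; exists n.
  by rewrite gerBl mulr_ge0 // ltW // scale_gt0.
apply: limr_le; first exact: coordinate_cvg.
near=> m; apply: (@le_trans _ _ (upper m)).
  by rewrite lerDl mulr_ge0 // ltW // scale_gt0.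
by apply: upper_ni; near: m; exists n.
Unshelve. all: end_near. Qed.
End coordinate.

Let Re_lip (x y : R[i]) : `|complex.Re x - complex.Re y| <= cmod (x - y).
Proof. by rewrite -ReN -ReD ler_Re_cmod. Qed.

Let Im_lip (x y : R[i]) : `|complex.Im x - complex.Im y| <= cmod (x - y).
Proof.
by apply: le_trans (ler_Im_cmod _); case: x => a b; case: y.
Qed.

Definition param (t : measurableTypeR R) : R * R :=
  (limn (fun n => complex.Re (approx n t)), limn (fun n => complex.Im (approx n t))).

(** Each coordinate costs 2 scale n. The resulting 4 is the factor by which discs are enlarged from
    here on. *)
Lemma param_approx n t : cmod (toC (param t) - approx n t) <= 4 * scale n.
Proof.
apply: (le_trans (cmod_leD _)).
have := coordinate_lim t Re_lip n; have := coordinate_lim t Im_lip n.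
by rewrite /toC /param /=; case: (approx n t) => a b /=; lra.
Qed.

Lemma measurable_address_eq n k : measurable [set t | address n t = k].
Proof.
have le_m j : measurable [set t | (address n t <= j)%N].
  have -> : [set t | (address n t <= j)%N] =
      setT `&` (fun t => (population n)%:R * t < j.+1%:R) @^-1` [set true].
    by rewrite setTI; apply/seteqP; split => t /=; rewrite /address truncn_le_nat.
  have : measurable_fun setT (fun t : R => (population n)%:R * t < j.+1%:R).
    by apply: measurable_fun_ltr => //; exact: measurable_funM.
  by apply.
case: k => [|k].
  have -> : [set t | address n t = 0%N] = [set t | (address n t <= 0)%N].
    by apply/seteqP; split => t /=; rewrite leqn0 => /eqP.
  exact: le_m.
have -> : [set t | address n t = k.+1] =
    [set t | (address n t <= k.+1)%N] `\` [set t | (address n t <= k)%N].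
  apply/seteqP; split => t /= => [->|[h1 /negP]]; first by rewrite ltnn leqnn.
  by rewrite -ltnNge => h2; apply/eqP; rewrite eqn_leq h1 h2.
by apply: measurableD; exact: le_m.
Qed.

Lemma measurable_address (F : nat -> R) n :
  measurable_fun setT (fun t => F (address n t)).
Proof.
move=> _ Y mY; rewrite setTI.
have -> : (fun t => F (address n t)) @^-1` Y =
    \bigcup_k (if F k \in Y then [set t | address n t = k] else set0).
  apply/seteqP; split => t /=.
    by move=> Yt; exists (address n t) => //; rewrite mem_set.
  by move=> [k _]; case: ifPn => // kY /= ->; exact: set_mem.
apply: bigcupT_measurable => k; case: ifP => // _; exact: measurable_address_eq.
Qed.

Lemma measurable_param :
  @measurable_fun _ _ (measurableTypeR R) (R * R)%type setT param.
Proof.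
apply/measurable_fun_pairP; split.
  apply: (@measurable_fun_cvg _ _ _ setT (fun n t => complex.Re (approx n t))).
    by move=> n; exact: (measurable_address (fun k => complex.Re (center n k))).
  by move=> t _; exact: coordinate_cvg Re_lip.
apply: (@measurable_fun_cvg _ _ _ setT (fun n t => complex.Im (approx n t))).
  by move=> n; exact: (measurable_address (fun k => complex.Im (center n k))).
by move=> t _; exact: coordinate_cvg Im_lip.
Qed.

HB.instance Definition _ := isMeasurableFun.Build _ _ _ _ param measurable_param.

Definition unif : probability (measurableTypeR R) R := uniform_prob (@ltr01 R).

Definition limit_measure : probability (R * R)%type R := distribution unif param.

Lemma unif_sub01 (A : set R) : measurable A -> A `<=` `[0, 1] ->
  unif A = lebesgue_measure A.
Proof.
move=> mA A01; rewrite /unif /= /uniform_prob.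
rewrite (eq_integral (fun=> 1%E)); last first.
  move=> x; rewrite inE => /A01 /=; rewrite in_itv /= /uniform_pdf => ->.
  by rewrite subr0 invr1.
by rewrite integral_cst // mul1e.
Qed.

Lemma unif_address n k : (k < population n)%N ->
  unif [set t | address n t = k] = (scale n)%:E.
Proof.
move=> kN; have N0 : 0 < (population n)%:R :> R by rewrite ltr0n population_gt0.
have aE : [set t | address n t = k] `&` `[0, 1] = `[k%:R * scale n, k.+1%:R * scale n[.
  apply/seteqP; split => t /=; rewrite !in_itv /=.
    move=> [<- /andP[t0 t1]].
    have /andP[h1 h2] := truncn_itv (mulr_ge0 (ltW N0) t0).
    by rewrite ler_pdivrMr // ltr_pdivlMr // [t * _]mulrC h1 h2.
  rewrite ler_pdivrMr // ltr_pdivlMr // ![t * _]mulrC => /andP[h1 h2]; split.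
    by apply: truncn_def; rewrite h1 h2.
  apply/andP; split.
    by rewrite -(pmulr_rge0 _ N0); apply: le_trans h1.
  rewrite -(ler_pM2l N0) mulr1; apply: (le_trans (ltW h2)).
  by rewrite ler_nat.
have mA := measurable_address_eq n k.
have out : unif (~` `[0, 1]) = 0%E.
  rewrite probability_setC //.
  rewrite unif_sub01 //.
  by rewrite lebesgue_measure_itv /= lte_fin ltr01 oppr0 adde0 subee.
have mI : measurable (~` `[(0:R), 1]) by exact: measurableC.
have mAI : measurable ([set t | address n t = k] `&` ~` `[(0:R), 1]) by exact: measurableI.
have mA01 : measurable ([set t | address n t = k] `&` `[(0:R), 1]) by exact: measurableI.
transitivity (unif ([set t | address n t = k] `&` `[0, 1])).
  rewrite -[in LHS](setIT [set t | _]) -(setvU `[(0:R), 1]) setIUr.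
  rewrite measureU //; last by rewrite setIACA setICl !setI0.
  rewrite [X in (X + _)%E](_ : _ = 0%E) ?add0e //.
  by apply: (subset_measure0 _ _ _ out) => //; exact: subIsetr.
rewrite aE unif_sub01 //; last by rewrite -aE.
rewrite lebesgue_measure_itv /= lte_fin ltr_pM2r ?scale_gt0 // ltr_nat ltnSn.
by rewrite -EFinB -mulrBl -natr1 addrC addKr mul1r.
Qed.

End measure_construction.

(** * Support, growth and unrectifiability *)

Section limit_measure_support.
Context {R : realType}.
Implicit Types (t : R) (n k : nat) (z w : R * R) (c : R[i]).

Notation mu := (@limit_measure R).

Lemma open_cmod_gt c (d : R) : open [set w : R * R | d < cmod (toC w - c)].
Proof.
pose f (w : R * R) := (w.1 - complex.Re c) ^+ 2 + (w.2 - complex.Im c) ^+ 2.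
have fE w : cmod (toC w - c) = Num.sqrt (f w) by case: c @f => a b f.
have cf : continuous (fun w : R * R => Num.sqrt (f w)).
  move=> w; apply: (@continuous_comp _ _ _ f Num.sqrt); last exact: sqrt_continuous.
  apply: cvgD; apply: cvgM; apply: cvgB; do ?exact: cvg_cst.
  - exact: cvg_fst.
  - exact: cvg_fst.
  - exact: cvg_snd.
  - exact: cvg_snd.
have -> : [set w : R * R | d < cmod (toC w - c)] =
    (fun w : R * R => Num.sqrt (f w)) @^-1` [set x | d < x].
  by apply/seteqP; split => w /=; rewrite fE.
by move/continuousP : cf; apply; exact: open_gt.
Qed.

Lemma cdiscE z (r : R) : cdisc z r = ~` [set w | r < cmod (toC w - toC z)].
Proof. by apply/seteqP; split => w /=; rewrite /cdisc /= leNgt => /negP. Qed.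

Lemma measurable_cdisc z (r : R) : measurable (cdisc z r).
Proof.
by rewrite cdiscE; apply: measurableC; apply: open_measurable_plane; exact: open_cmod_gt.
Qed.

Lemma bigsetU_finP (T : Type) (I : finType) (P : pred I) (F : I -> set T) x :
  (\big[setU/set0]_(i | P i) F i) x <-> exists2 i, P i & F i x.
Proof.
rewrite -bigcup_seq_cond; split => [[i /= /andP[_ Pi] Fx]|[i Pi Fx]].
  by exists i.
by exists i => //=; rewrite mem_index_enum.
Qed.

Lemma unif_cells n (S : {set 'I_(population n)}) :
  unif (\big[setU/set0]_(k < population n | k \in S)
     [set t : measurableTypeR R | address n t = k]) = (#|S|%:R * scale n)%:E.
Proof.
rewrite measure_bigsetU_ord //; first last.
- by move=> i j _ _ [t /= [e1 e2]]; apply: ord_inj; rewrite -e1 -e2.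
- by move=> i; exact: measurable_address_eq.
rewrite (eq_bigr (fun=> (scale n)%:E)); last by move=> k _; exact: unif_address.
by rewrite sumEFin sumr_const mulr_natl.
Qed.

(** The cells with index below [population n] already carry total mass 1. *)
Lemma unif_overflow n : unif [set t : measurableTypeR R | (population n <= address n t)%N] = 0%E.
Proof.
have := unif_cells [set: 'I_(population n)]%SET.
rewrite cardsT card_ord mulfV ?pnatr_eq0 -?lt0n ?population_gt0 // => U1.
set A := (X in unif X) in U1.
have -> : [set t : measurableTypeR R | (population n <= address n t)%N] = ~` A.
  apply/seteqP; split => t /=.
    by move=> h /bigsetU_finP[k _ /= e]; move: h; rewrite e leqNgt ltn_ord.
  move=> h; rewrite leqNgt; apply/negP => kN; apply: h; apply/bigsetU_finP.
  by exists (Ordinal kN) => //; rewrite finset.in_setT.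
rewrite probability_setC; first by rewrite U1 subee.
apply: bigsetU_measurable => k _; exact: measurable_address_eq.
Qed.

Lemma measurable_param_preimage (A : set (R * R)) : measurable A ->
  @measurable _ (measurableTypeR R) (param @^-1` A).
Proof. by move=> mA; rewrite -[X in measurable X]setTI; exact: measurable_param. Qed.

(** Upper bounds on the mass by counting cells: with [S] empty it locates the support, with [S] the
    discs near a given one it gives the growth. *)
Lemma limit_measure_cover n (S : {set 'I_(population n)}) (A : set (R * R)) :
  measurable A ->
  (forall t (tN : (address n t < population n)%N), A (param t) -> Ordinal tN \in S) ->
  (mu A <= (#|S|%:R * scale n)%:E)%E.
Proof.
move=> mA AS; rewrite -unif_cells -[leRHS]addr0.
rewrite /limit_measure /= /distribution /pushforward.
set B := \big[setU/set0]_(_ < _ | _) _.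
have mB : measurable B.
  by apply: bigsetU_measurable => k _; exact: measurable_address_eq.
have mC : @measurable _ (measurableTypeR R) [set t | (population n <= address n t)%N].
  have -> : [set t : measurableTypeR R | (population n <= address n t)%N] =
      ~` \big[setU/set0]_(k < population n) [set t | address n t = k].
    apply/seteqP; split => t /=.
      by move=> h /bigsetU_finP[k _ /= e]; move: h; rewrite e leqNgt ltn_ord.
    move=> h; rewrite leqNgt; apply/negP => kN; apply: h; apply/bigsetU_finP.
    by exists (Ordinal kN).
  apply: measurableC; apply: bigsetU_measurable => k _; exact: measurable_address_eq.
apply: (@le_trans _ _ (unif (B `|` [set t | (population n <= address n t)%N]))).
  apply: le_measure; rewrite ?inE.
  - exact: measurable_param_preimage.
  - exact: measurableU.
  - move=> t /= At; have [tN|tN] := ltnP (address n t) (population n).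
      by left; apply/bigsetU_finP; exists (Ordinal tN) => //; exact: AS.
    by right.
apply: (le_trans (measureU2 _ _ _)) => //.
by apply: leeD2l; rewrite -(unif_overflow n).
Qed.

End limit_measure_support.

Section limit_measure_geometry.
Context {R : realType}.
Implicit Types (t : R) (n k : nat) (z w : R * R) (c : R[i]).

Notation mu := (@limit_measure R).

Definition ofC c : R * R := (complex.Re c, complex.Im c).

Lemma ofCK c : toC (ofC c) = c.
Proof. by case: c. Qed.

Lemma limit_measure_disc n k (A : set (R * R)) : (k < population n)%N ->
  measurable A ->
  (forall y, cmod (toC y - center n k) <= 4 * scale n -> A y) ->
  ((scale n)%:E <= mu A)%E.
Proof.
move=> kN mA DA; rewrite -(@unif_address R n k kN).
apply: le_measure; rewrite ?inE.
- exact: measurable_address_eq.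
- exact: measurable_param_preimage.
- by move=> t /= tk; apply: DA; rewrite -tk; exact: param_approx.
Qed.

Lemma msupp_sub n z : msupp mu z ->
  exists k : 'I_(population n), cmod (toC z - center n k) <= 4 * scale n.
Proof.
move=> zs; apply: contrapT => nk.
pose V := \big[setU/set0]_(k < population n) ~` [set w : R * R |
  4 * scale n < cmod (toC w - center n k)].
have oV : open (~` V).
  apply: closed_openC; apply: closed_bigsetU => k _; apply: open_closedC.
  exact: open_cmod_gt.
have Vz : (~` V) z.
  by move=> /bigsetU_finP[k _ /= h]; apply: nk; exists k; rewrite leNgt; apply/negP.
have := zs _ oV Vz; apply/negP; rewrite -leNgt.
apply: le_trans (@limit_measure_cover R n finset.set0 _ _ _) _.
- exact: open_measurable_plane.
- move=> t tN /= h; exfalso; apply: h; apply/bigsetU_finP.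
  by exists (Ordinal tN) => //=; apply/negP; rewrite -leNgt; exact: param_approx.
- by rewrite cards0 mul0r.
Qed.

(** A centre closer than d would put a whole disc of positive mass into a null neighbourhood of z,
    of radius 2d. *)
Lemma msupp_dist z : ~ msupp mu z -> exists2 d : R, 0 < d &
  forall n k, 8 * scale n <= d -> (k < population n)%N ->
    d <= cmod (toC z - center n k).
Proof.
move=> /existsNP[U /not_implyP[oU /not_implyP[Uz /negP]]]; rewrite -leNgt => U0.
have /nbhs_ballP[e /= e0 eU] : nbhs z U by exact: open_nbhs_nbhs.
exists (e / 2); first by rewrite divr_gt0.
move=> n k hn kN; rewrite leNgt; apply/negP => zc.
have : ((scale n)%:E <= mu U)%E.
  apply: (limit_measure_disc kN); first exact: open_measurable_plane.
  move=> y hy; apply: eU.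
  have yz : cmod (toC z - toC y) < e.
    apply: (le_lt_trans (ler_cmod_dist (center n k) _ _)).
    by rewrite [cmod (center n k - _)]cmod_distC; lra.
  by split; rewrite /ball /=; apply: le_lt_trans yz;
    [exact: (ler_Re_cmod (toC z - toC y))|exact: (ler_Im_cmod (toC z - toC y))].
move/le_trans/(_ U0); rewrite lee_fin leNgt => /negP; apply.
exact: scale_gt0.
Qed.

Lemma hausdorff_content_le (delta : R) n (S : {set 'I_(population n)})
    (E : set (R * R)) : 4 * scale n <= delta ->
  (forall z, E z -> exists2 k, k \in S & cmod (toC z - center n k) <= 4 * scale n) ->
  (hausdorff_content delta E <= (#|S|%:R * (4 * scale n))%:E)%E.
Proof.
move=> dn ES; apply: ereal_inf_lbound.
pose r := [seq nat_of_ord i | i <- enum S].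
exists [set` r], (fun k => ofC (center n k)), (fun=> 4 * scale n); split.
- by move=> j _; rewrite dn andbT mulr_gt0 // scale_gt0.
- move=> z /ES[k kS hk]; exists (k : nat).
    by apply/mapP; exists k => //; rewrite mem_enum.
  by change (cmod (toC z - toC (ofC (center n k))) <= 4 * scale n); rewrite ofCK.
rewrite esum_fset; first last.
- by move=> i _; rewrite lee_fin mulr_ge0 // ltW // scale_gt0.
- exact: finite_seq.
rewrite -fsbig_seq; last by rewrite map_inj_uniq ?enum_uniq //; exact: ord_inj.
by rewrite big_map big_enum /= sumEFin sumr_const mulr_natl.
Qed.

Lemma scale_small (e : R) : 0 < e -> exists n0, forall n, (n0 <= n)%N -> scale n <= e.
Proof.
move=> e0; have /cvgrPdist_le /(_ e e0)[n0 _ h] := @scale_cvg0 R.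
exists n0 => n /h /=; rewrite sub0r normrN ger0_norm // ltW //.
exact: scale_gt0.
Qed.

Lemma hausdorff1_msupp : (hausdorff1 (msupp mu) < +oo)%E.
Proof.
apply: (@le_lt_trans _ _ 4%:E); last exact: ltry.
apply: ub_ereal_sup => _ [d /= d0 <-].
have d4 : 0 < d / 4 by rewrite divr_gt0.
have [n0 /(_ n0 (leqnn _)) hn] := scale_small d4.
apply: (le_trans (@hausdorff_content_le d n0 (finset.setTfor _) _ _ _)).
- by rewrite mulrC -ler_pdivlMr.
- by move=> z /(msupp_sub n0)[k hk]; exists k => //; rewrite finset.in_setT.
rewrite cardsT card_ord mulrCA mulfV ?mulr1 //.
by rewrite pnatr_eq0 -lt0n population_gt0.
Qed.

End limit_measure_geometry.

Section growth_and_unrectifiability.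
Context {R : realType}.
Implicit Types (t : R) (n k : nat) (z w : R * R) (c : R[i]).

Notation mu := (@limit_measure R).

(** Take n with scale (n+1) <= r < scale n. The discs of generation n+1 that matter have centres
    within r + 4 scale (n+1) <= 5r and a common parent, so [disc_count] applies, and 150 = 30 *
    5. *)
Lemma limit_measure_growth z (r : R) : 0 < r -> (mu (cdisc z r) <= (150 * r)%:E)%E.
Proof.
move=> r0; have [r1|r1] := leP 1 r.
  by apply: (le_trans (probability_le1 _ (measurable_cdisc _ _))); rewrite lee_fin; lra.
have [m hm] : exists m, scale m <= r.
  by have [m /(_ m (leqnn m)) h] := scale_small r0; exists m.
have exP : exists m, (fun m => scale m <= r) m by exists m.
case: (ex_minnP exP) => -[|n]; first by rewrite /scale /= invr1 leNgt r1.
move=> hn minn; have rn : r < scale n.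
  by rewrite ltNge; apply/negP => /minn; rewrite ltnn.
have s0 : 0 < scale n.+1 :> R by exact: scale_gt0.
have r0' : 0 < scale n :> R by exact: scale_gt0.
pose S := [set k : 'I_(population n.+1) |
  cmod (toC z - center n.+1 k) <= 5 * r]%SET.
apply: (le_trans (@limit_measure_cover R n.+1 S _ (measurable_cdisc _ _) _)).
  move=> t tN ht; have h : cmod (toC (param t) - toC z) <= r := ht.
  rewrite inE /=.
  apply: (le_trans (ler_cmod_dist (toC (param t)) _ _)).
  have := param_approx n.+1 t; rewrite cmod_distC in h.
  by rewrite /approx; lra.
rewrite lee_fin; have [->|[k0 k0S]] := finset.set_0Vmem S.
  by rewrite cards0 mul0r mulr_ge0 // ltW.
have [p0 k0E] := child_index_surj n k0.
set i := (k0 %/ branching n)%N in k0E.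
have iN : (i < population n)%N.
  by rewrite ltn_divLR ?branching_gt0 //; exact: ltn_ord.
have dist_parent k : cmod (toC z - center n.+1 k) <= 5 * r ->
    cmod (toC z - center n (k %/ branching n)) <= 5 * r + scale n.
  move=> h; apply: (le_trans (ler_cmod_dist (center n.+1 k) _ _)).
  have [p kE] := child_index_surj n k.
  by apply: lerD => //; rewrite [in center n.+1 _]kE center_child_le.
pose Z := (scale n)^-1%:C%C * (toC z - center n i).
have rZ : (scale n)%:C%C * Z = toC z - center n i.
  rewrite /Z mulrA -(rmorphM (real_complex R)) divff ?gt_eqF //.
  by rewrite (rmorph1 (real_complex R)) mul1r.
pose T := [set p : 'I_(side n ^ 2) * 'I_(ringsize (side n)) |
  cmod (Z - disc_point (side n) p.1 p.2) <= 5 * r / scale n]%SET.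
have ST : (#|S| <= #|T|)%N.
  pose f (p : 'I_(side n ^ 2) * 'I_(ringsize (side n))) :=
    Ordinal (child_index_lt p iN).
  apply: leq_trans (leq_imset_card f (mem T)).
  apply/subset_leq_card/fintype.subsetP => k; rewrite inE => hk.
  have [p kE] := child_index_surj n k.
  have ik : (k %/ branching n)%N = i.
    (* Both parents are within 5r + scale n < 6 scale n of z, whereas distinct ones are at least 16
       scale n apart. *)
    apply/eqP/negPn/negP => /(@center_sep R n) h.
    have kN : (k %/ branching n < population n)%N.
      by rewrite ltn_divLR ?branching_gt0 //; exact: ltn_ord.
    have := h kN iN; apply/negP; rewrite -ltNge.
    have h1 := dist_parent _ hk.
    have h2 : cmod (toC z - center n i) <= 5 * r + scale n.
      by apply: dist_parent; move: k0S; rewrite inE.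
    apply: (le_lt_trans (ler_cmod_dist (toC z) _ _)).
    rewrite [cmod (_ - toC z)]cmod_distC.
    apply: (@lt_le_trans _ _ (16 * scale n)); first lra.
    apply: ler_wpM2r; first exact: ltW.
    have : 1 <= 2 ^+ n :> R by rewrite exprn_ege1 // ler1n.
    by rewrite exprD; lra.
  apply/imsetP; exists p; last by apply: val_inj; rewrite /= kE ik.
  rewrite inE ler_pdivlMr //.
  have -> : cmod (Z - disc_point (side n) p.1 p.2) * scale n =
      cmod (toC z - center n.+1 k).
    have -> : toC z - center n.+1 k =
        (scale n)%:C%C * (Z - disc_point (side n) p.1 p.2).
      by rewrite kE center_child ik mulrBr rZ; ring.
    by rewrite cmodM cmod_real (ger0_norm (ltW r0')) mulrC.
  by [].
have := @disc_count R (side n) (side_ge64 n) Z (5 * r / scale n).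
have sE : scale n = (side n)%:R ^+ 2 * (ringsize (side n))%:R * scale n.+1 :> R.
  by rewrite scaleS branchingE.
have b0 : 0 < (side n)%:R ^+ 2 * (ringsize (side n))%:R :> R.
  by rewrite -branchingE ltr0n branching_gt0.
have tau1 : ((side n)%:R ^+ 2 * (ringsize (side n))%:R)^-1 <= 5 * r / scale n.
  rewrite ler_pdivlMr // sE mulKf ?gt_eqF //; lra.
move=> /(_ tau1) cT.
apply: (@le_trans _ _ (#|T|%:R * scale n.+1)).
  by apply: ler_wpM2r; [exact: ltW|rewrite ler_nat].
apply: (le_trans (ler_wpM2r (ltW s0) cT)).
rewrite sE le_eqVlt; apply/orP; left; apply/eqP.
have a0 : 0 < (side n)%:R :> R by rewrite ltr0n (leq_trans _ (side_ge64 n)).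
have q0 : 0 < (ringsize (side n))%:R :> R by rewrite ltr0n.
by field; rewrite (gt_eqF s0) (gt_eqF q0) (gt_eqF a0).
Qed.

Lemma limit_measure_one_dimensional : one_dimensional mu.
Proof.
split; first exact: hausdorff1_msupp.
exists 150 => // z r r0; exact: limit_measure_growth.
Qed.

Lemma size_rem_ge (T : eqType) (x : T) (s : seq T) : ((size s).-1 <= size (rem x s))%N.
Proof.
have [xs|xs] := boolP (x \in s); first by rewrite size_rem.
by rewrite rem_id // leq_pred.
Qed.

(** The subdivision is [s] completed by [b]. The edge from [a] and the edge to [b] are discarded;
    the edges between consecutive points of [s], one fewer than the points, are kept. *)
Lemma curve_length_ge (a b d : R) (gamma : R -> R * R) (s : seq R) :
  a < b -> 0 <= d -> sorted <%R s -> {in s, forall x, a < x < b} ->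
  {in s &, forall x y, x != y -> d <= cmod (toC (gamma x) - toC (gamma y))} ->
  ((((size s).-1)%:R * d)%:E <= curve_length a b gamma)%E.
Proof.
move=> ab d0 ss sab sd.
have part : itv_partition a b (rcons s b).
  split; last by rewrite last_rcons.
  rewrite rcons_path; case: s ss sab {sd} => [|x s] /= ss sab; first by rewrite ab.
  have /andP[-> _] := sab x (mem_head _ _); rewrite ss /=.
  by have /andP[] := sab (last x s) (mem_last _ _).
apply: (@le_trans _ _ (polygon_length a b gamma (rcons s b))%:E); last first.
  by apply: ereal_sup_ubound; exists (rcons s b).
rewrite lee_fin /polygon_length size_rcons.
set t := nth b (a :: rcons s b).
have [->|sn] := posnP (size s).
  by rewrite mul0r sumr_ge0 // => *; exact: cmod_ge0.
rewrite big_ltn // big_nat_recr //=.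
apply: (@le_trans _ _ (\sum_(1 <= n < size s) cmod (toC (gamma (t n.+1)) - toC (gamma (t n))))).
  have -> : ((size s).-1)%:R * d = \sum_(1 <= n < size s) d.
    by rewrite sumr_const_nat subn1 mulr_natl.
  apply: ler_sum_nat => n /andP[n1 ns].
  have tn (m : nat) : (m < size s)%N -> t m.+1 = nth b s m.
    by move=> ms; rewrite /t /= nth_rcons ms.
  have n1s : (n.-1 < size s)%N by rewrite (leq_ltn_trans (leq_pred _)).
  rewrite (tn n ns) -(prednK n1) (tn _ n1s) prednK //.
  apply: sd; rewrite ?mem_nth //.
  rewrite nth_uniq //; first by rewrite -{1}(prednK n1) gtn_eqF.
  exact: (sorted_uniq (@lt_trans _ _) (@ltxx _ _)).
by rewrite addrCA lerDl addr_ge0 ?cmod_ge0.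
Qed.

End growth_and_unrectifiability.

Section unrectifiability.
Context {R : realType}.
Implicit Types (t : R) (n : nat) (z : R * R).

Notation mu := (@limit_measure R).

Lemma half_expr_small (e : R) : 0 < e ->
  exists n0, forall n, (n0 <= n)%N -> 2^-1 ^+ n <= e.
Proof.
move=> e0.
have : (2^-1 : R) ^+ n @[n --> \oo] --> (0 : R).
  by apply: cvg_expr; rewrite ger0_norm // invf_lt1 // ltr1n.
move/cvgrPdist_le /(_ e e0) => [n0 _ h].
by exists n0 => n /h /=; rewrite sub0r normrN ger0_norm.
Qed.

(* Times spent in distinct discs are the vertices of an inscribed polygon whose
   edges are at least as long as the gaps between discs. *)
Lemma curve_disc_count n (a b L : R) (gamma : R -> R * R)
    (S : {set 'I_(population n)}) : a <= b -> 0 <= L ->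
  (curve_length a b gamma <= L%:E)%E ->
  (forall k, k \in S -> exists2 t, a <= t <= b &
     cmod (toC (gamma t) - center n k) <= 4 * scale n) ->
  #|S|%:R <= 3 + L / (8 * 2 ^+ n * scale n).
Proof.
move=> ab L0 hL hS; have s0 : 0 < scale n :> R by exact: scale_gt0.
have p1 : 1 <= 2 ^+ n :> R by rewrite exprn_ege1 // ler1n.
(* Centres are 16 2^n scale n apart, and the two enlarged discs take away 8 scale n. *)
set d := 8 * 2 ^+ n * scale n.
have d0 : 0 < d by rewrite /d !mulr_gt0 //; lra.
pose hits (k : 'I_(population n)) := [set t | a <= t <= b /\
  cmod (toC (gamma t) - center n k) <= 4 * scale n].
pose tau k := xget a (hits k).
have tauP k : k \in S -> hits k (tau k).
  by move=> /hS[t t1 t2]; apply: (@xgetPex _ a (hits k)); exists t.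
have far k k' : k \in S -> k' \in S -> k != k' ->
    d <= cmod (toC (gamma (tau k)) - toC (gamma (tau k'))).
  move=> /tauP[_ h1] /tauP[_ h2] kk.
  have := @center_sep R n k k' (ltn_ord k) (ltn_ord k') kk.
  have := ler_cmod_dist (toC (gamma (tau k))) (center n k) (center n k').
  have := ler_cmod_dist (toC (gamma (tau k'))) (toC (gamma (tau k))) (center n k').
  rewrite [cmod (center n k - toC _)]cmod_distC => e1 e2.
  rewrite exprD => e3.
  have : scale n <= 2 ^+ n * scale n :> R by rewrite ler_peMl // ltW.
  by rewrite /d; lra.
pose r0 := [seq tau k | k <- enum S].
have r0_uniq : uniq r0.
  rewrite map_inj_in_uniq ?enum_uniq // => k k'; rewrite !mem_enum => kS k'S e.
  apply/eqP/negPn/negP => /(far _ _ kS k'S); rewrite e subrr cmod0.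
  by rewrite leNgt d0.
have r0_size : size r0 = #|S| by rewrite size_map cardE.
have r0_in x : x \in r0 -> a <= x <= b.
  by move=> /mapP[k]; rewrite mem_enum => /tauP[h _] ->.
have [eab|/eqP neab] := pselect (a = b).
  have : (size r0 <= size [:: a])%N.
    apply: uniq_leq_size => // x /r0_in; rewrite -eab inE eq_le => /andP[-> ->] //.
  rewrite r0_size /= -(ler_nat R) => /le_trans; apply.
  by rewrite -[1]addr0; apply: lerD; [lra|rewrite divr_ge0 // ltW].
have lt_ab : a < b by rewrite lt_neqAle neab.
(* Vertices must lie strictly between the endpoints. Removing these loses at most two points, and
   having fewer edges than vertices loses one more: hence the 3. *)
pose s := sort <=%R (rem b (rem a r0)).
have s_mem x : x \in s -> [/\ x \in r0, x != a & x != b].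
  rewrite mem_sort mem_rem_uniq ?rem_uniq // inE => /andP[xb].
  by rewrite mem_rem_uniq // inE => /andP[xa xr].
have hs := @curve_length_ge R a b d gamma s lt_ab (ltW d0).
have : ((((size s).-1)%:R * d)%:E <= L%:E)%E.
  apply: le_trans hL; apply: hs.
  - by rewrite sort_lt_sorted !rem_uniq.
  - move=> x /s_mem[/r0_in/andP[x1 x2] xa xb].
    by rewrite !lt_neqAle x1 x2 xb eq_sym xa.
  - move=> x y /s_mem[/mapP[k kS ->] _ _] /s_mem[/mapP[k' k'S ->] _ _] xy.
    rewrite !mem_enum in kS k'S; apply: far => //.
    by apply: contra xy => /eqP ->.
rewrite lee_fin -ler_pdivlMr // => h.
have sz : (#|S| <= (size s).-1 + 3)%N.
  rewrite -r0_size size_sort.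
  have := size_rem_ge a r0; have := size_rem_ge b (rem a r0).
  move: (size r0) (size (rem a r0)) (size (rem b (rem a r0))); clear; lia.
have : #|S|%:R <= ((size s).-1 + 3)%:R :> R by rewrite ler_nat.
by rewrite natrD; lra.
Qed.

Lemma hausdorff_content_ge0 (delta : R) (E : set (R * R)) :
  (0 <= hausdorff_content delta E)%E.
Proof.
apply: le_ereal_inf_tmp => _ [J [x [r [h _ ->]]]].
by apply: esum_ge0 => j /h /andP[r0 _]; rewrite lee_fin ltW.
Qed.

Lemma limit_measure_unrectifiable : purely_unrectifiable mu.
Proof.
move=> _ [a [b [gamma [ab _ Lfin ->]]]].
have [L L0 hL] : exists2 L : R, 0 <= L & (curve_length a b gamma <= L%:E)%E.
  move: Lfin; case: (curve_length a b gamma) => [r _|//|_].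
    by exists `|r| => //; rewrite lee_fin ler_norm.
  by exists 0 => //; rewrite leNye.
set E := _ `&` _.
have content0 (delta : R) : 0 < delta -> hausdorff_content delta E = 0%E.
  move=> delta0; apply/eqP; rewrite eq_le hausdorff_content_ge0 andbT.
  apply/lee_addgt0Pr => e e0; rewrite add0e.
  have [n1 h1] := half_expr_small (divr_gt0 delta0 (ltr0Sn R 3)).
  have e1 : 0 < e / (12 + L) by rewrite divr_gt0 //; lra.
  have [n2 h2] := half_expr_small e1.
  pose n := maxn n1 n2.
  have sn := @scale_le R n; have s0 : 0 < scale n :> R by exact: scale_gt0.
  have n1n := h1 n (leq_maxl _ _); have n2n := h2 n (leq_maxr _ _).
  have p0 : 0 < 2 ^+ n :> R by rewrite exprn_gt0.
  pose S := [set k : 'I_(population n) | `[< exists2 t, a <= t <= b &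
     cmod (toC (gamma t) - center n k) <= 4 * scale n >]]%SET.
  have cS : #|S|%:R <= 3 + L / (8 * 2 ^+ n * scale n).
    by apply: (curve_disc_count ab L0 hL) => k; rewrite inE => /asboolP.
  apply: (le_trans (@hausdorff_content_le R delta n S _ _ _)).
  - by rewrite ler_pdivlMr // in n1n; lra.
  - move=> z [[t /= tab <-] /(msupp_sub n)[k hk]]; exists k => //.
    by rewrite inE; apply/asboolP; exists t => //; rewrite in_itv in tab.
  rewrite lee_fin; apply: (le_trans (ler_wpM2r _ cS)).
    by rewrite mulr_ge0 // ltW.
  (* The scale cancels in the second term, leaving only the ratio 2^-n of radius to gap. *)
  have -> : (3 + L / (8 * 2 ^+ n * scale n)) * (4 * scale n) =
      12 * scale n + L / 2 * 2^-1 ^+ n.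
    by rewrite exprVn; field; rewrite (gt_eqF s0) (gt_eqF p0).
  apply: (@le_trans _ _ ((12 + L) * 2^-1 ^+ n)); last first.
    by rewrite mulrC -ler_pdivlMr //; lra.
  have : 0 <= 2^-1 ^+ n :> R by rewrite exprn_ge0.
  by nra.
apply/eqP; rewrite eq_le; apply/andP; split.
  by apply: ub_ereal_sup => _ [d /= d0 <-]; rewrite content0.
by rewrite -(content0 1) //; apply: ereal_sup_ubound; exists 1 => //=.
Qed.

End unrectifiability.

(** * Boundedness of the transform *)

Section bounded_transform.
Context {R : realType}.
Implicit Types (t : R) (n : nat) (z : R * R).

Notation mu := (@limit_measure R).

Lemma measurable_inv : measurable_fun [set: R] (@GRing.inv R).
Proof.
have -> : [set: R] = [set 0] `|` ~` [set 0] by rewrite setUv.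
apply/measurable_funU => //; first exact: measurableC.
split; first exact: measurable_fun_set1.
apply: open_continuous_measurable_fun; first by apply: closed_openC; exact: closed_eq.
by move=> x; rewrite inE /= => /eqP x0; exact: inv_continuous.
Qed.

(** K(z) = conj(z)^3 / |z|^4, a form with real denominator from which measurability of both parts
    can be read off. *)
Lemma kernelK_Complex (a b : R) : kernelK (Complex a b) =
  Complex ((a ^+ 3 - 3 * a * b ^+ 2) / (a ^+ 2 + b ^+ 2) ^+ 2)
          ((b ^+ 3 - 3 * a ^+ 2 * b) / (a ^+ 2 + b ^+ 2) ^+ 2).
Proof.
have [z0|z0] := eqVneq (Complex a b) 0.
  rewrite z0 /kernelK conjc0 mul0r; case: z0 => -> ->.
  by rewrite !expr0n /= !mulr0 subr0 !mul0r.
have -> : kernelK (Complex a b) =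
    conjc (Complex a b) ^+ 3 * ((cmod (Complex a b) ^+ 2) ^- 2)%:C%C.
  have h := sqr_cmodC (Complex a b).
  have c0 : conjc (Complex a b) != 0 by rewrite conjc_eq0.
  have -> : ((cmod (Complex a b) ^+ 2) ^- 2)%:C%C =
      ((cmod (Complex a b) ^+ 2)%:C%C ^+ 2)^-1 :> R[i].
    by rewrite -(rmorphXn (real_complex R)) -(fmorphV (real_complex R)).
  rewrite h /kernelK; move: (conjc (Complex a b)) (Complex a b) c0 z0 => x y x0 y0.
  by field; rewrite x0 y0.
rewrite sqr_cmod /=; apply/eqP; rewrite eq_complex /=.
by apply/andP; split; apply/eqP; ring.
Qed.

Lemma measurable_kernelK_translate z :
  measurable_fun [set: R * R] (fun xi => complex.Re (kernelK (toC z - toC xi) * 1)) /\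
  measurable_fun [set: R * R] (fun xi => complex.Im (kernelK (toC z - toC xi) * 1)).
Proof.
have mx : measurable_fun [set: R * R] (fun xi : R * R => z.1 - xi.1).
  by apply: measurable_funB => //; exact: measurable_fst.
have my : measurable_fun [set: R * R] (fun xi : R * R => z.2 - xi.2).
  by apply: measurable_funB => //; exact: measurable_snd.
have md : measurable_fun [set: R * R]
    (fun xi : R * R => (((z.1 - xi.1) ^+ 2 + (z.2 - xi.2) ^+ 2) ^+ 2)^-1).
  apply: (measurableT_comp measurable_inv).
  by apply: measurable_funX; apply: measurable_funD; exact: measurable_funX.
have E xi : kernelK (toC z - toC xi) * 1 = kernelK (Complex (z.1 - xi.1) (z.2 - xi.2)).
  by rewrite mulr1.
split.
  under eq_fun do rewrite E kernelK_Complex /=.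
  apply: measurable_funM md; apply: measurable_funB; first exact: measurable_funX.
  by apply: measurable_funM; [exact: measurable_funM|exact: measurable_funX].
under eq_fun do rewrite E kernelK_Complex /=.
apply: measurable_funM md; apply: measurable_funB; first exact: measurable_funX.
by apply: measurable_funM => //; apply: measurable_funM => //; exact: measurable_funX.
Qed.

Lemma Rintegral_unif_cells n (G : measurableTypeR R -> R) :
  unif.-integrable setT (EFin \o G) ->
  Rintegral unif setT G =
  \sum_(k < population n) Rintegral unif [set t | address n t = k] G.
Proof.
move=> iG.
have mcell k : measurable [set t : measurableTypeR R | address n t = k].
  exact: measurable_address_eq.
have mB : measurable (\big[setU/set0]_(k < population n)
    [set t : measurableTypeR R | address n t = k]).
  by apply: bigsetU_measurable => k _.
rewrite /Rintegral (negligible_integral (N := [set t : measurableTypeR R |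
  (population n <= address n t)%N])) //; last 2 first.
- have -> : [set t : measurableTypeR R | (population n <= address n t)%N] =
      ~` \big[setU/set0]_(k < population n) [set t | address n t = k].
    apply/seteqP; split => t /=.
      by move=> h /bigsetU_finP[k _ /= e]; move: h; rewrite e leqNgt ltn_ord.
    move=> h; rewrite leqNgt; apply/negP => kN; apply: h; apply/bigsetU_finP.
    by exists (Ordinal kN).
  exact: measurableC.
- exact: unif_overflow.
have -> : setT `\` [set t : measurableTypeR R | (population n <= address n t)%N] =
    \big[setU/set0]_(k < population n) [set t | address n t = k].
  apply/seteqP; split => t /=.
    move=> [_ /negP]; rewrite -ltnNge => kN; apply/bigsetU_finP.
    by exists (Ordinal kN).
  by move=> /bigsetU_finP[k _ /= e]; split => //; rewrite e leqNgt ltn_ord.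
have /measurable_int mG := iG.
rewrite integral_bigsetU_EFin //; last 3 first.
- exact: index_enum_uniq.
- by move=> i j _ _ [t /= [e1 e2]]; apply: ord_inj; rewrite -e1 -e2.
- exact: measurable_funTS.
have iGk (k : 'I_(population n)) :
    unif.-integrable [set t | address n t = k] (EFin \o G).
  by apply: integrableS iG.
rewrite (eq_bigr (fun k : 'I_(population n) => (fine (\int[unif]_(x in
    [set t | address n t = k]) (G x)%:E))%:E)).
  by rewrite sumEFin.
by move=> k _; rewrite fineK //; apply: integrable_fin_num.
Qed.

(** [f] stands for the real and the imaginary part. The generation n depends on the distance of z to
    the support, but [tree_field_bound] is uniform in n, and passing from the measure to generation
    n costs at most 1. *)
Lemma limit_measure_integral_bound (f : R[i] -> R) z :
  (forall x, `|f x| <= cmod x) -> {morph f : x y / x + y} ->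
  {morph f : x y / x - y} ->
  (forall (a : R) x, f (a%:C%C * x) = a * f x) ->
  measurable_fun [set: R * R] (fun xi => f (kernelK (toC z - toC xi) * 1)) ->
  ~ msupp mu z ->
  `|Rintegral mu setT (fun xi => f (kernelK (toC z - toC xi) * 1))| <= 10 ^+ 7 + 1.
Proof.
move=> f_le fD fB fZ mg /msupp_dist[d d0 sep].
(* The first bound is the requirement of [msupp_dist]. The second makes the error 8 (2 scale n) /
   d^2 of [kernelK_perturb], applied with radius 2 scale n, at most 1. *)
have e0 : 0 < Num.min (d / 8) (d ^+ 2 / 16).
  by rewrite lt_min !divr_gt0 // exprn_gt0.
have [n /(_ n (leqnn n)) hn] := scale_small e0.
have {hn} [hn1 hn2] : 8 * scale n <= d /\ 16 * scale n <= d ^+ 2.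
  by move: hn; rewrite le_min !ler_pdivlMr // => /andP[h1 h2]; split; lra.
have s0 : 0 < scale n :> R by exact: scale_gt0.
have zc k : d <= cmod (toC z - center n k).
  rewrite center_mod; apply: sep => //; rewrite ltn_mod; exact: population_gt0.
pose g (xi : R * R) := f (kernelK (toC z - toC xi) * 1).
pose h k := f (kernelK (toC z - center n k)).
have g_near t : `|g (param t) - h (address n t)| <= 1.
  rewrite /g /h mulr1 -fB; apply: (le_trans (f_le _)).
  have zk := zc (address n t).
  apply: (le_trans (@kernelK_perturb R (toC z) (center n (address n t)) (toC (param t))
    (2 * scale n) _ _ _)).
  - by rewrite mulr_gt0.
  - by lra.
  - by have := param_approx n t; rewrite /approx; lra.
  have zk0 : 0 < cmod (toC z - center n (address n t)) by lra.
  rewrite ler_pdivrMr ?exprn_gt0 // mul1r; apply: (@le_trans _ _ (d ^+ 2)).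
    lra.
  by rewrite lerXn2r ?nnegrE ?cmod_ge0 // ltW.
have h_le k : `|h k| <= d^-1.
  apply: (le_trans (f_le _)); rewrite cmod_kernelK lef_pV2 ?posrE //.
  exact: lt_le_trans (zc k).
have mG : @measurable_fun _ _ (measurableTypeR R) R setT (g \o param).
  exact: measurableT_comp mg measurable_param.
have iG : unif.-integrable setT (EFin \o (g \o param)).
  apply: measurable_bounded_integrable => //.
    by apply: (le_lt_trans (probability_le1 unif measurableT)); exact: ltry.
  exists (d^-1 + 1); split; first exact: num_real.
  move=> M hM t _ /=.
  apply: (@le_trans _ _ (d^-1 + 1)); last exact: ltW.
  have := g_near t; have := h_le (address n t).
  have := ler_normD (g (param t) - h (address n t)) (h (address n t)).
  by rewrite subrK; lra.
have -> : Rintegral mu setT (fun xi => f (kernelK (toC z - toC xi) * 1)) =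
    Rintegral unif setT (g \o param).
  rewrite /Rintegral; congr fine.
  rewrite /limit_measure integral_distribution //.
  exact/measurable_EFinP.
rewrite (Rintegral_unif_cells n iG).
(* On a cell, of mass scale n, the integrand is within 1 of its value at the centre; over all cells
   these errors add up to 1. *)
have cell_bound (k : 'I_(population n)) :
    `|Rintegral unif [set t | address n t = k] (g \o param) - scale n * h k| <= scale n.
  have mk : measurable [set t : measurableTypeR R | address n t = k].
    exact: measurable_address_eq.
  have ik : unif.-integrable [set t | address n t = k] (EFin \o (g \o param)).
    by apply: integrableS iG.
  have ic (v : R) : unif.-integrable [set t | address n t = k] (EFin \o (fun=> v)).
    exact: finite_measure_integrable_cst.
  have vc : forall v : R,
      Rintegral unif [set t | address n t = k] (fun=> v) = v * scale n.
    move=> v; rewrite Rintegral_cst //; congr (_ * _).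
    exact: (congr1 fine (@unif_address R n k (ltn_ord k))).
  have up := @le_Rintegral _ _ R unif [set t | address n t = k] (g \o param)
    (fun=> h k + 1) mk ik (ic _).
  have lo := @le_Rintegral _ _ R unif [set t | address n t = k] (fun=> h k - 1)
    (g \o param) mk (ic _) ik.
  rewrite !vc in up lo.
  have {}up := up _; have {}lo := lo _.
  rewrite ler_distl; apply/andP; split.
    have -> : scale n * h k - scale n = (h k - 1) * scale n by ring.
    apply: lo => t /= tk; have := g_near t; rewrite tk ler_distl => /andP[]; lra.
  have -> : scale n * h k + scale n = (h k + 1) * scale n by ring.
  by apply: up => t /= tk; have := g_near t; rewrite tk ler_distl => /andP[]; lra.
have sumK : `|\sum_(k < population n) scale n * h k| <= 10 ^+ 7.
  have -> : \sum_(k < population n) scale n * h k =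
      f (\sum_(0 <= k < population n) (scale n)%:C%C * kernelK (toC z - center n k)).
    have f0 : f 0 = 0 by have := fB 0 0; rewrite !subrr.
    rewrite big_mkord (big_morph f fD f0); apply: eq_bigr => k _.
    by rewrite fZ.
  apply: (le_trans (f_le _)); apply: tree_field_bound => k _.
  by apply: le_trans (zc k); lra.
set I := \sum_(k < _) Rintegral _ _ _.
rewrite -(subrK (\sum_(k < population n) scale n * h k) I) addrC.
apply: (le_trans (ler_normD _ _)); apply: lerD => //.
rewrite /I -sumrB; apply: (le_trans (ler_norm_sum _ _ _)).
apply: (le_trans (ler_sum _ (fun k _ => cell_bound k))).
by rewrite sumr_const card_ord -mulr_natl mulfV // pnatr_eq0 -lt0n population_gt0.
Qed.

Lemma limit_measure_Top_bound z : ~ msupp mu z ->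
  cmod (Top mu (fun _ => 1) z) <= 2 * (10 ^+ 7 + 1).
Proof.
move=> zs; have [mRe mIm] := measurable_kernelK_translate z.
apply: (le_trans (cmod_leD _)); rewrite mulr_natl mulr2n; apply: lerD.
  apply: (@limit_measure_integral_bound (fun x => complex.Re x)) => //.
  - exact: ler_Re_cmod.
  - by move=> [? ?] [? ?].
  - by move=> [? ?] [? ?].
  - by move=> a [x y] /=; rewrite mul0r subr0.
apply: (@limit_measure_integral_bound (fun x => complex.Im x)) => //.
- exact: ler_Im_cmod.
- by move=> [? ?] [? ?].
- by move=> [? ?] [? ?].
- by move=> a [x y] /=; rewrite mul0r addr0.
Qed.

Lemma limit_measure_bounded :
  (Linfty_norm (~` msupp mu) (Top mu (fun _ => 1%R)) < +oo)%E.
Proof.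
rewrite /Linfty_norm unlock /=; case: ifPn => // _.
apply: (@le_lt_trans _ _ (2 * (10 ^+ 7 + 1))%:E); last exact: ltry.
apply: ereal_inf_lbound; apply: aeW => z /=.
rewrite patchE; case: ifPn => [|_]; last by rewrite abse0 lee_fin; lra.
rewrite inE => zs; rewrite abse_EFin lee_fin ger0_norm ?cmod_ge0 //.
exact: limit_measure_Top_bound.
Qed.

End bounded_transform.

Theorem theorem1p1 (R : realType) :
  exists mu : probability (R * R)%type R,
    [/\ one_dimensional mu,
        purely_unrectifiable mu &
        (Linfty_norm (~` msupp mu) (Top mu (fun _ => 1%R)) < +oo)%E].
Proof.
exists limit_measure; split; first exact: limit_measure_one_dimensional.
- exact: limit_measure_unrectifiable.
- exact: limit_measure_bounded.
Qed.
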